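(* Let $n\ge3$, $2^*=\frac{2n}{n-2}$, $s\in(0,1)$, $a\ge0$, $\lambda\in\mathbb{R}$, and let $\Omega\subset\mathbb{R}^n$ be a bounded, star-shaped $C^2$ domain. Consider the problem $$-\Delta u+a(-\Delta)^su=|u|^{2^*-2}u+\lambda u\quad\text{in }\Omega,\qquad u=0\quad\text{in }\Omega^c=\mathbb{R}^n\setminus\Omega,$$ and let $\lambda_{1,s}$ be the Dirichlet principal eigenvalue of $(-\Delta)^s$ in $\Omega$, $$\lambda_{1,s}=\inf\left\{[u]_s^2\;:\;\|u\|_{L^2(\mathbb{R}^n)}=1\ \text{and}\ u=0\ \text{in }\Omega^c\right\}.$$ If $\lambda<a(1-s)\lambda_{1,s}$, then the problem has no non-trivial solution in $C^2(\Omega)\cap C(\mathbb{R}^n)$. If $\lambda\le a(1-s)\lambda_{1,s}$, then the problem has no solution in $C^2(\Omega)\cap C(\mathbb{R}^n)$ that is positive in $\Omega$.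
   Context: For $s\in(0,1)$, the fractional Laplacian is $$(-\Delta)^s u(x)=c_{n,s}\,\mathrm{PV}\int_{\mathbb{R}^n}\frac{u(x)-u(y)}{|x-y|^{n+2s}}\,dy,\qquad c_{n,s}=\frac{s\,2^{2s}\,\Gamma\left(\frac{n+2s}{2}\right)}{\pi^{n/2}\,\Gamma(1-s)},$$ and $$[u]_s=\left(\frac{c_{n,s}}{2}\int_{\mathbb{R}^n}\int_{\mathbb{R}^n}\frac{|u(x)-u(y)|^2}{|x-y|^{n+2s}}\,dx\,dy\right)^{1/2}.$$ ''Star-shaped'' means star-shaped with respect to some point of $\Omega$. *)

(* Defs.v *)
From HB Require Import structures.
From mathcomp Require Import all_boot all_order all_algebra.
From mathcomp Require Import all_classical all_reals all_analysis.

Set Implicit Arguments.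
Unset Strict Implicit.
Unset Printing Implicit Defensive.

Import Order.TTheory GRing.Theory Num.Theory.
Import numFieldNormedType.Exports.

Local Open Scope classical_set_scope.
Local Open Scope ring_scope.

(* The norm that the library puts on 'rV[R]_n is the sup norm.  It is used only
   through the topology and boundedness; distances are Euclidean ([enorm]). *)

Section measurable_rV.
Context {R : realType} (n : nat).

Let coord (i : 'I_n) (v : 'rV[R]_n) : measurableTypeR R := v 0 i.

Let rV_set0 : g_sigma_preimage coord set0.
Proof. exact: sigma_algebra0. Qed.

Let rV_setC A : g_sigma_preimage coord A -> g_sigma_preimage coord (~` A).
Proof. exact: sigma_algebraC. Qed.

Let rV_bigcup (F : (set 'rV[R]_n)^nat) :
  (forall i, g_sigma_preimage coord (F i)) ->
  g_sigma_preimage coord (\bigcup_i F i).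
Proof. exact: sigma_algebra_bigcup. Qed.

(* Borel sets of R^n, as the sigma-algebra generated by the coordinates. *)
HB.instance Definition _ := @isMeasurable.Build
  default_measure_display 'rV[R]_n
  (g_sigma_preimage coord) rV_set0 rV_setC rV_bigcup.

End measurable_rV.

Section lebesgue_rV.
Context {R : realType}.

Definition cons_rV n (p : measurableTypeR R * 'rV[R]_n) : 'rV[R]_n.+1 :=
  row_mx (p.1)%:M p.2.

Lemma measurable_coord_rV n (i : 'I_n) :
  measurable_fun [set: 'rV[R]_n] (fun v => v 0 i : measurableTypeR R).
Proof.
move=> _ Y mY; rewrite setTI; apply: sub_sigma_algebra => /=.
rewrite -bigcup_seq/=; exists i => /=; first by rewrite mem_index_enum.
by exists Y => //; rewrite setTI.
Qed.

Lemma measurable_fun_rV d (T : measurableType d) n (f : T -> 'rV[R]_n) :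
  (forall i, measurable_fun setT (fun t => f t 0 i : measurableTypeR R)) ->
  measurable_fun setT f.
Proof.
move=> mf _ Y mY; rewrite setTI.
move: Y mY; suff : (measurable : set (set 'rV[R]_n)) `<=`
    [set Y | measurable (f @^-1` Y)] by move=> sub Y /sub.
apply: smallest_sub.
  split => /=.
  - by rewrite preimage_set0.
  - by move=> A mA; rewrite setTD -preimage_setC; exact: measurableC.
  - by move=> F mF; rewrite preimage_bigcup; exact: bigcupT_measurable.
move=> A; rewrite -bigcup_seq/= => -[i _ [B mB <-]]; rewrite setTI.
by have := mf i measurableT B mB; rewrite setTI.
Qed.

Lemma measurable_cons_rV n : measurable_fun setT (@cons_rV n).
Proof.
apply: measurable_fun_rV => i.
case: (@split_ordP 1 n i) => j ->; rewrite /cons_rV.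
  rewrite (_ : (fun _ => _) = fst) ?measurable_fst//.
  apply/funext => -[x v]; rewrite [LHS](@row_mxEl R 1 1 n).
  by rewrite !ord1 mxE eqxx mulr1n.
rewrite (_ : (fun _ => _) = (fun v : 'rV[R]_n => v 0 j) \o snd).
  by apply: measurableT_comp => //; exact: measurable_coord_rV.
by apply/funext => -[x v]; rewrite [LHS](@row_mxEr R 1 1 n).
Qed.

Definition uncons_rV n (v : 'rV[R]_n.+1) : measurableTypeR R * 'rV[R]_n :=
  (v 0 0, @rsubmx R 1 1 n v).

Lemma cons_rVK n : cancel (@cons_rV n) (@uncons_rV n).
Proof.
move=> [x v]; rewrite /uncons_rV /cons_rV /= row_mxKr; congr pair.
rewrite (_ : 0 = lshift n (0 : 'I_1)); last exact: val_inj.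
by rewrite [LHS](@row_mxEl R 1 1 n) mxE eqxx mulr1n.
Qed.

Lemma measurable_uncons_rV n : measurable_fun setT (@uncons_rV n).
Proof.
apply/measurable_fun_pairP; split; first exact: measurable_coord_rV.
apply: measurable_fun_rV => i.
rewrite (_ : (fun _ => _) = (fun v : 'rV[R]_n.+1 => v 0 (rshift 1 i))).
  exact: measurable_coord_rV.
by apply/funext => v /=; rewrite mxE.
Qed.

Section lebesgue_rVS.
Variables (n : nat) (mu : {sigma_finite_measure set 'rV[R]_n -> \bar R}).

Definition lebesgue_rVS : set 'rV[R]_n.+1 -> \bar R :=
  pushforward (lebesgue_measure \x mu)%E (@cons_rV n).

Let mcons := @measurable_cons_rV n.

Let lebesgue_rVS0 : lebesgue_rVS set0 = 0%E.
Proof. by rewrite /lebesgue_rVS; exact: measure0. Qed.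

Let lebesgue_rVS_ge0 A : (0 <= lebesgue_rVS A)%E.
Proof. by rewrite /lebesgue_rVS; exact: measure_ge0. Qed.

Let lebesgue_rVS_sigma_additive : semi_sigma_additive lebesgue_rVS.
Proof. by rewrite /lebesgue_rVS; exact: measure_semi_sigma_additive. Qed.

HB.instance Definition _ := isMeasure.Build _ _ _ lebesgue_rVS
  lebesgue_rVS0 lebesgue_rVS_ge0 lebesgue_rVS_sigma_additive.

Let lebesgue_rVS_sigma_finite : sigma_finite setT lebesgue_rVS.
Proof.
have /sigma_finiteP[F [TF ndF Foo]] := sigma_finiteT (@lebesgue_measure R).
have /sigma_finiteP[G [TG ndG Goo]] := sigma_finiteT mu.
exists (fun k => @uncons_rV n @^-1` (F k `*` G k)).
  apply/esym; rewrite -subTset => v _.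
  have [i _ Fi] : (\bigcup_i F i) (uncons_rV v).1 by rewrite -TF.
  have [j _ Gj] : (\bigcup_i G i) (uncons_rV v).2 by rewrite -TG.
  exists (maxn i j) => //; split.
    by move: Fi; exact/subsetPset/ndF/leq_maxl.
  by move: Gj; exact/subsetPset/ndG/leq_maxr.
move=> k; have [mF Fk] := Foo k; have [mG Gk] := Goo k; split.
  rewrite -[X in measurable X]setTI; apply: measurable_uncons_rV => //.
  exact: measurableX.
rewrite /lebesgue_rVS /pushforward -comp_preimage (_ : _ \o _ = id); last first.
  by apply/funext => p /=; exact: cons_rVK.
rewrite preimage_id product_measure1E//.
by rewrite lte_mul_pinfty// ge0_fin_numE.
Qed.

HB.instance Definition _ := Measure_isSigmaFinite.Build _ _ _ lebesgue_rVS
  lebesgue_rVS_sigma_finite.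

End lebesgue_rVS.

(* Lebesgue measure on R^n, as the n-fold product of Lebesgue measure on R. *)
Fixpoint lebesgue_rV n : {sigma_finite_measure set 'rV[R]_n -> \bar R} :=
  match n with
  | 0 => \d_(0 : 'rV[R]_0)
  | n'.+1 => lebesgue_rVS (lebesgue_rV n')
  end.

Lemma lebesgue_rV_box n (I : 'I_n -> set (measurableTypeR R)) :
  (forall i, measurable (I i)) ->
  lebesgue_rV n [set v | forall i, I i (v 0 i)] =
  (\prod_(i < n) lebesgue_measure (I i))%E.
Proof.
elim: n I => [|n IH] I mI.
  by rewrite big_ord0 /= diracE mem_set// => -[].
rewrite /= /lebesgue_rVS /pushforward.
rewrite (_ : _ @^-1` _ =
    I 0 `*` [set v : 'rV[R]_n | forall i, I (lift ord0 i) (v 0 i)]).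
  rewrite product_measure1E//; last first.
    rewrite (_ : [set _ | _] = \bigcap_(i in [set: 'I_n])
        ((fun v : 'rV[R]_n => v 0 i : measurableTypeR R)
          @^-1` I (lift ord0 i))).
      apply: fin_bigcap_measurable; first exact: (@finite_finset (ordinal n)).
      move=> i _; rewrite -[X in measurable X]setTI.
      by apply: (@measurable_coord_rV n i) => //; exact: mI.
    apply/seteqP; split => v /=; first by move=> h i _; exact: h.
    by move=> h i; exact: h.
  rewrite big_ord_recl; congr (_ * _)%E.
  exact: (IH (fun i => I (lift ord0 i))).
apply/seteqP; split => -[x v] /=.
  move=> h; split.
    have := h 0; rewrite (_ : 0 = lshift n (0 : 'I_1)); last exact: val_inj.
    by rewrite (@row_mxEl R 1 1 n) mxE eqxx mulr1n.
  move=> i; have := h (lift ord0 i).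
  rewrite (_ : lift ord0 i = rshift 1 i); last exact: val_inj.
  by rewrite (@row_mxEr R 1 1 n).
move=> [hx hv] i.
case: (unliftP ord0 i) => [j ->|->].
  have := hv j; rewrite (_ : lift ord0 j = rshift 1 j); last exact: val_inj.
  by rewrite (@row_mxEr R 1 1 n).
rewrite (_ : cons_rV (x, v) 0 ord0 = x)//.
rewrite (_ : (ord0 : 'I_n.+1) = lshift n (0 : 'I_1)); last exact: val_inj.
by rewrite [LHS](@row_mxEl R 1 1 n) mxE eqxx mulr1n.
Qed.

End lebesgue_rV.

Section fractional_laplacian.
Context {R : realType}.
Implicit Types s : R.

Definition enorm n (v : 'rV[R]_n) : R := Num.sqrt (\sum_(i < n) v 0 i ^+ 2).

(* Euler's Gamma function; the integral is meaningful for [0 < x]. *)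
Definition Gamma (x : R) : R :=
  \int[lebesgue_measure]_(t in `]0, +oo[%classic) (t `^ (x - 1) * expR (- t)).

Definition c_frac (n : nat) s : R :=
  s * 2 `^ (2 * s) * Gamma ((n%:R + 2 * s) / 2) /
  (pi `^ (n%:R / 2) * Gamma (1 - s)).

(* The principal value excises Euclidean balls centred at [x].  The limit exists
   whenever [u] is bounded, measurable, and C^2 near [x]. *)
Definition frac_laplacian n s (u : 'rV[R]_n -> R) (x : 'rV[R]_n) : R :=
  c_frac n s *
  lim ((fun e : R => \int[lebesgue_rV n]_(y in [set y | e <= enorm (x - y)])
          ((u x - u y) / enorm (x - y) `^ (n%:R + 2 * s))) @ 0^'+).

Definition gagliardo n s (u : 'rV[R]_n -> R) : \bar R :=
  (((c_frac n s / 2)%:E *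
    \int[lebesgue_rV n]_x \int[lebesgue_rV n]_y
      (`|u x - u y| ^+ 2 / enorm (x - y) `^ (n%:R + 2 * s))%:E) `^ 2^-1)%E.

Definition lambda1 n s (Om : set 'rV[R]_n) : \bar R :=
  ereal_inf [set (gagliardo s u ^+ 2)%E | u in
    [set u : 'rV[R]_n -> R | [/\ measurable_fun setT u,
      'N[lebesgue_rV n]_2%:E[EFin \o u]%E = 1%E &
      forall x, ~ Om x -> u x = 0]]].

End fractional_laplacian.

Section domains.
Context {R : realType}.

(* [f] is C^2 on the open set [A]: all partial derivatives of order at most two
   exist and are continuous at every point of [A]. *)
Definition C2 n (A : set 'rV[R]_n) (f : 'rV[R]_n -> R) : Prop :=
  forall x, A x ->
  [/\ {for x, continuous f},
      forall i : 'I_n, let e := delta_mx 0 i in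
        derivable f x e /\ {for x, continuous ('D_e f)} &
      forall i j : 'I_n, let e := delta_mx 0 i in let e' := delta_mx 0 j in
        derivable ('D_e f) x e' /\ {for x, continuous ('D_e' ('D_e f))}].

Definition laplacian n (u : 'rV[R]_n -> R) (x : 'rV[R]_n) : R :=
  \sum_(i < n) 'D_(delta_mx 0 i) ('D_(delta_mx 0 i) u) x.

(* Near each boundary point, up to relabelling ([k]) and reversing ([b]) the
   coordinate axes, the set is the region above the graph of a C^2 function of
   the n - 1 remaining coordinates. *)
Definition C2_boundary n (Om : set 'rV[R]_n) : Prop :=
  forall p, (closure Om `\` Om°) p ->
  exists r : R, 0 < r /\
  exists (k : 'I_n) (b : bool) (g : 'rV[R]_n.-1 -> R), C2 setT g /\
    forall x, enorm (x - p) < r ->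
      Om x <-> g (col' k x) < (-1) ^+ b * x 0 k.

Definition C2_domain n (Om : set 'rV[R]_n) : Prop :=
  [/\ Om !=set0, open Om, connected Om & C2_boundary Om].

Definition star_shaped n (Om : set 'rV[R]_n) : Prop :=
  exists2 z, Om z &
    forall x, Om x -> forall t : R, 0 <= t <= 1 -> Om (z + t *: (x - z)).

End domains.

Section problem.
Context {R : realType}.

Definition crit_exp (n : nat) : R := 2 * n%:R / (n%:R - 2).

Definition is_solution n (s a lam : R) (Om : set 'rV[R]_n)
    (u : 'rV[R]_n -> R) : Prop :=
  (forall x, Om x ->
    - laplacian u x + a * frac_laplacian s u x =
    `|u x| `^ (crit_exp n - 2) * u x + lam * u x) /\
  (forall x, ~ Om x -> u x = 0).

End problem.

(* Main.v *)
Require Import Defs.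
From HB Require Import structures.
From mathcomp Require Import all_boot all_order all_algebra.
From mathcomp Require Import all_classical all_reals all_analysis.
From mathcomp Require Import measurable_realfun ring lra.
Set Implicit Arguments.
Unset Strict Implicit.
Unset Printing Implicit Defensive.
Import Order.TTheory GRing.Theory Num.Theory.
Import numFieldNormedType.Exports.
Local Open Scope classical_set_scope.
Local Open Scope ring_scope.

(** The classical tool is Pohozaev's identity, obtained by testing the equation with (x - z) . grad
    u. For a solution that is only C^2 inside [Om] and continuous up to the boundary, the proof
    tests instead with the dilations u_t(x) = u(z + t (x - z)), t > 1, where z is a centre of
    star-shapedness. Then u_t still vanishes outside [Om], and the first-order terms in t - 1 are
    the terms of Pohozaev's identity.

    No gradient is ever integrated. The Dirichlet energy is replaced by difference quotients D_tau
    ([Dform]), the Gagliardo energy is written G ([Gform]), A stands for a c_frac / 2, f for the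
    right-hand side and M for the integral of u^2. Test functions get compact support inside [Om] by
    soft thresholding ([shrink]). Since thresholding is firmly nonexpansive, this yields D_tau(u) +
    A G(u) <= int u f(u) for every tau ([energy_le]).

    Both energies scale exactly, with factors t^(2-n) and t^(2s-n). Polarization between u and u_t
    ([energy_pair]), a tangent inequality for the primitive of f ([power_tangent]) and int (u -
    u_t)^2 = O((t-1)^2) ([dilation_L2]) give [key_inequality]: A (1-s) (t^2-1) G(u) + D_tau(u-u_t) +
    A G(u-u_t) <= lam M (t^2-1) + C (t-1)^2. The exponent being critical, the terms in int u f(u)
    cancel to first order.

    Hence A (1-s) G(u) <= lam M, while the hypothesis on lam and the definition of the eigenvalue
    ([lambda1_le]) give the reverse inequality. If A > 0, then u is a zero, hence a minimizer, of a
    nonnegative quadratic form q. So q(u - u_t) = q(u_t), which is of order t - 1, whereas the key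
    inequality makes it O((t-1)^2); this is [saturated_contradiction]. If A = 0, both inequalities
    force lam = 0, which rules out the strict hypothesis.

    There remains a positive u with - laplacian u > 0 and D_tau(u - u_t) <= C (t-1)^2 for all tau.
    Let p be the point of the complement closest to z. By Hopf's barrier ([hopf_ball],
    [linear_growth]) u grows at least linearly off the boundary near p, and dilations move the
    boundary there transversally. So u - u_t has a definite slope in a layer of width comparable to
    t - 1, and D_tau(u - u_t) >= X (t - 1) for a suitable tau ([boundary_layer_energy]), a
    contradiction. *)

(** * Affine changes of variables for Lebesgue measure on R^n *)

Section change_of_variables.
Context {R : realType}.
Implicit Types (r c : R) (n : nat).
Local Open Scope ereal_scope.
Notation mu := (lebesgue_rV _).
Notation TR := (measurableTypeR R).

Definition affine1 c r : TR -> TR := fun x => (c + r * x)%R.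

Lemma measurable_affine1 c r : measurable_fun setT (affine1 c r).
Proof.
apply: measurable_funD; first exact: measurable_cst.
apply: measurable_funM => //; exact: measurable_cst.
Qed.

Definition scaled_pushforward c r : {measure set TR -> \bar R} :=
  mscale (NngNum (normr_ge0 r))
    (measure_function_pushforward__canonical__measure_function_Measure
       (@lebesgue_measure R) (measurable_affine1 c r)).

(** By uniqueness of Lebesgue measure it suffices to compare both measures on half-open intervals;
    the sign of [r] decides which end of the preimage is closed. *)
Lemma lebesgue_measure_affine1 c r (r0 : r != 0%R) A : measurable A ->
  lebesgue_measure A = (`|r|%:E * lebesgue_measure (affine1 c r @^-1` A)).
Proof.
move=> mA.
apply: (lebesgue_measure_unique (mu := scaled_pushforward c r)) => // X [[a b] /=] _ <-{X mA A}.
rewrite /= /mscale /= /pushforward lebesgue_measure_itv /= lte_fin.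
have [r0'|r0'] := leP 0%R r.
  have {r0'}r0 : (0 < r)%R by rewrite lt_def r0.
  have -> : affine1 c r @^-1` `]a, b] = [set` `](a - c) / r, (b - c) / r]%R].
    apply/seteqP; split => x /=; rewrite !in_itv /= /affine1;
    by rewrite ltr_pdivrMr// ler_pdivlMr// ltrBlDl lerBrDl (mulrC r).
  rewrite lebesgue_measure_itv /= lte_fin ltr_pM2r ?invr_gt0// ltrD2r gtr0_norm//.
  case: ifPn => _; rewrite ?mule0// -!EFinD -EFinM; congr EFin.
  by field; rewrite gt_eqF.
have -> : affine1 c r @^-1` `]a, b] = [set` `[(b - c) / r, (a - c) / r[%R].
  apply/seteqP; split => x /=; rewrite !in_itv /= /affine1 andbC;
  by rewrite ler_ndivrMr// ltr_ndivlMr// ltrBlDl lerBrDl (mulrC r).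
rewrite lebesgue_measure_itv /= lte_fin ltr_nM2r ?invr_lt0// ltrD2r ltr0_norm//.
case: ifPn => _; rewrite ?mule0// -!EFinD -EFinM; congr EFin.
by field; rewrite lt_eqF.
Qed.

Lemma ge0_integral_affine1 c r (f : TR -> \bar R) : (r != 0)%R ->
  measurable_fun setT f -> (forall x, 0 <= f x) ->
  \int[lebesgue_measure]_x f x =
  `|r|%:E * \int[lebesgue_measure]_x f (c + r * x)%R.
Proof.
move=> r0 mf f0.
have -> : \int[lebesgue_measure]_x f x = \int[scaled_pushforward c r]_x f x.
  apply: eq_measure_integral => A mA _.
  exact: lebesgue_measure_affine1.
rewrite ge0_integral_mscale// ge0_integral_pushforward//.
exact: measurable_affine1.
Qed.

Lemma integral_rVS n (f : 'rV[R]_n.+1 -> \bar R) : measurable_fun setT f ->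
  (forall x, 0 <= f x) -> \int[lebesgue_rV n.+1]_x f x =
  \int[lebesgue_measure]_x \int[lebesgue_rV n]_v f (cons_rV (x, v)).
Proof.
move=> mf f0.
have mc := @measurable_cons_rV R n.
rewrite -[LHS]/(\int[pushforward (lebesgue_measure \x lebesgue_rV n) (@cons_rV R n)]_x f x).
rewrite ge0_integral_pushforward//.
rewrite preimage_setT fubini_tonelli1//.
exact: measurableT_comp.
Unshelve. all: by move=> x; exact: f0.
Qed.

Lemma cons_rVl n (x : TR) (v : 'rV[R]_n) (j : 'I_1) : cons_rV (x, v) 0%R (lshift n j) = x.
Proof. by rewrite [LHS](@row_mxEl R 1 1 n) !ord1 mxE eqxx mulr1n. Qed.

Lemma cons_rVr n (x : TR) (v : 'rV[R]_n) j :
  cons_rV (x, v) 0%R (rshift 1 j) = v 0%R j.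
Proof. by rewrite [LHS](@row_mxEr R 1 1 n). Qed.

Lemma cons_rV_affine n (c : 'rV[R]_n.+1) r (x : TR) (v : 'rV[R]_n) :
  (c + r *: cons_rV (x, v))%R =
  cons_rV ((c 0 0 + r * x)%R, (@rsubmx R 1 1 n c + r *: v)%R).
Proof.
apply/rowP => i; case: (@split_ordP 1 n i) => j ->; rewrite mxE [X in (_ + X)%R]mxE.
  by rewrite !cons_rVl ord1; congr (c _ _ + _)%R; apply: val_inj.
by rewrite !cons_rVr !mxE.
Qed.

Lemma measurable_affine_rV n (c : 'rV[R]_n) r :
  measurable_fun setT (fun x : 'rV[R]_n => c + r *: x)%R.
Proof.
apply: measurable_fun_rV => i.
rewrite (_ : (fun _ => _) = (fun v : 'rV[R]_n => affine1 (c 0 i) r (v 0 i)))%R.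
  apply: measurableT_comp; first exact: measurable_affine1.
  exact: measurable_coord_rV.
by apply/funext => v; rewrite !mxE.
Qed.

(** Induction on the dimension: Tonelli splits off the first coordinate, which contributes one
    factor |r|. *)
Lemma ge0_integral_affine n (c : 'rV[R]_n) r (f : 'rV[R]_n -> \bar R) :
  (r != 0)%R -> measurable_fun setT f -> (forall x, 0 <= f x) ->
  \int[lebesgue_rV n]_x f x =
  (`|r| ^+ n)%:E * \int[lebesgue_rV n]_x f (c + r *: x)%R.
Proof.
move=> r0; elim: n c f => [|n IH] c f mf f0.
  rewrite expr0 mul1e; apply: eq_integral => x _; congr f.
  by apply/rowP => -[].
have maff := measurable_affine_rV c r.
have mc := @measurable_cons_rV R n.
pose c' := @rsubmx R 1 1 n c.
have mF (g : 'rV[R]_n.+1 -> \bar R) : measurable_fun setT g -> (forall x, 0 <= g x) ->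
    measurable_fun setT (fun x : TR => \int[lebesgue_rV n]_v g (cons_rV (x, v))).
  move=> mg g0.
  have := @measurable_fun_fubini_tonelli_F _ _ TR _ R (lebesgue_rV n)
    (g \o @cons_rV R n).
  by apply; (exact: (measurableT_comp mg mc) || by move=> x; exact: g0).
have mfa := measurableT_comp mf maff.
rewrite (integral_rVS mf f0) (integral_rVS mfa); last by move=> x; exact: f0.
rewrite (ge0_integral_affine1 (c 0 0)%R r0 (mF _ mf f0)); last first.
  by move=> x; apply: integral_ge0 => v _; exact: f0.
rewrite exprS EFinM -muleA; congr (_ * _).
have k0 : 0 <= (`|r| ^+ n)%:E by rewrite lee_fin exprn_ge0.
rewrite -(ge0_integralZl lebesgue_measure measurableT (mF _ mfa (fun x => f0 _)) _ k0); last first.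
  by move=> x _; apply: integral_ge0 => v _; exact: f0.
apply: eq_integral => x _.
rewrite (IH c'); [| |by move=> v; exact: f0].
  by congr (_ * _); apply: eq_integral => v _; rewrite /= cons_rV_affine.
apply: (measurableT_comp mf); apply: (measurableT_comp mc).
exact: pair1_measurable.
Qed.

End change_of_variables.

(** * Borel sets of R^n, cubes and open sets *)

Section borel_rV.
Context {R : realType}.
Implicit Types (r : R) (n : nat).

Lemma measurable_box n (I : 'I_n -> set (measurableTypeR R)) :
  (forall i, measurable (I i)) ->
  measurable [set v : 'rV[R]_n | forall i, I i (v 0 i)].
Proof.
move=> mI; rewrite (_ : [set _ | _] = \bigcap_(i in [set: 'I_n])
    ((fun v : 'rV[R]_n => v 0 i : measurableTypeR R) @^-1` I i)).
  apply: fin_bigcap_measurable; first exact: (@finite_finset (ordinal n)).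
  move=> i _; rewrite -[X in measurable X]setTI.
  by apply: (@measurable_coord_rV R n i) => //; exact: mI.
apply/seteqP; split => v /=; first by move=> h i _; exact: h.
by move=> h i; exact: h.
Qed.

Lemma coord_le_norm n (x : 'rV[R]_n) i : `|x 0 i| <= `|x|.
Proof.
rewrite [`|x|]mx_normrE.
by apply: (le_bigmax _ (fun ij : 'I_1 * 'I_n => `|x ij.1 ij.2|) (0, i)).
Qed.

Lemma norm_rV_le n (x : 'rV[R]_n) r : 0 <= r -> (forall i, `|x 0 i| <= r) ->
  `|x| <= r.
Proof.
move=> r0 xr; rewrite [`|x|]mx_normrE; apply/bigmax_leP; split => // -[i j] _ /=.
by rewrite ord1.
Qed.

(** The sigma-algebra is generated by the coordinates, the topology by the sup norm. They meet in
    the boxes with rational centres and radii 1/(k+1): an open set is the countable union of those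
    it contains. *)
Lemma open_measurable_rV n (U : set 'rV[R]_n) : open U -> measurable U.
Proof.
move=> oU.
pose box (p : 'rV[rat]_n * nat) : set 'rV[R]_n :=
  [set v | forall i, ball (ratr (p.1 0 i) : R) p.2.+1%:R^-1 (v 0 i)].
pose F k := if unpickle k is Some p then
  (if `[< box p `<=` U >] then box p else set0) else set0.
have -> : U = \bigcup_k F k.
  apply/seteqP; split => [x Ux|x [k _]]; last first.
    by rewrite /F; case: unpickle => // p; case: asboolP => // + ?; exact.
  have /nbhs_ballP[e /= e0 eU] : nbhs x U by exact: open_nbhs_nbhs.
  have e20 : 0 < e / 2 by rewrite divr_gt0.
  have [k _ /(_ k (leqnn k)) /= ke] := near_infty_natSinv_lt (PosNum e20).
  have k0 : 0 < k.+1%:R^-1 :> R by rewrite invr_gt0.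
  have qx i : exists q : rat, ball (ratr q : R) k.+1%:R^-1 (x 0 i).
    have /rat_in_itvoo[q] : x 0 i - k.+1%:R^-1 < x 0 i by rewrite ltrBlDr ltrDl.
    rewrite in_itv /= => /andP[q1 q2]; exists q.
    by rewrite /ball /= distrC gtr0_norm ?subr_gt0// ltrBlDl -ltrBlDr.
  have bx : box (\row_i xchoose (qx i), k) x.
    by move=> i /=; rewrite mxE; exact: (xchooseP (qx i)).
  exists (pickle (\row_i xchoose (qx i), k)) => //; rewrite /F pickleK.
  case: asboolP => // -[] y by_; apply: eU.
  have [d dE] : exists d : R, d = k.+1%:R^-1 by exists k.+1%:R^-1.
  rewrite -dE in ke k0.
  rewrite -ball_normE /=; apply: (@le_lt_trans _ _ (2 * d)); last by lra.
  apply: norm_rV_le => [|i]; first by rewrite mulr_ge0// ltW.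
  rewrite !mxE; move: (bx i) (by_ i); move: (\row_i xchoose (qx i)) => q; rewrite /ball /= -dE.
  rewrite !ltr_norml => /andP[? ?] /andP[? ?].
  by rewrite ler_norml; apply/andP; split; lra.
apply: bigcupT_measurable => k; rewrite /F; case: unpickle => // p.
case: asboolP => // _; apply: (@measurable_box n (fun i => ball _ _)) => i.
by apply: open_measurable; exact: ball_open.
Qed.

Lemma continuous_measurable_rV n (f : 'rV[R]_n -> R) :
  continuous f -> measurable_fun setT f.
Proof.
move=> cf; apply: (measurability _ (RGenOpens.measurableE R)) => _ [_ [a [b ->] <-]].
by rewrite setTI; apply: open_measurable_rV; move: cf => /continuousP; apply; exact: interval_open.
Qed.

Lemma lebesgue_rV_cube n r : 0 <= r ->
  lebesgue_rV n [set v : 'rV[R]_n | `|v| <= r] = ((2 * r) ^+ n)%:E.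
Proof.
move=> r0.
have -> : [set v : 'rV[R]_n | `|v| <= r] = [set v | forall i, `[- r, r]%classic (v 0 i)].
  apply/seteqP; split => v /= vr.
    by move=> i; rewrite in_itv /= -ler_norml (le_trans (coord_le_norm _ _)).
  by apply: norm_rV_le => // i; have := vr i; rewrite in_itv /= -ler_norml.
rewrite (@lebesgue_rV_box R n (fun=> `[- r, r]%classic))//; under eq_bigr => i _.
  rewrite lebesgue_measure_itv /= lte_fin.
  rewrite (_ : (if _ then _ else _) = (2 * r)%:E); first over.
  case: ifPn => [_|]; first by rewrite -EFinB; congr EFin; lra.
  by rewrite -leNgt => ?; congr EFin; lra.
by rewrite prodEFin prodr_const card_ord.
Qed.

Lemma lebesgue_rV_open_gt0 n (U : set 'rV[R]_n) : open U -> U !=set0 ->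
  (0 < lebesgue_rV n U)%E.
Proof.
move=> oU [x Ux].
have /nbhs_ballP[e /= e0 eU] : nbhs x U by exact: open_nbhs_nbhs.
pose B := [set v : 'rV[R]_n | forall i, `[x 0 i - e / 2, x 0 i + e / 2]%classic (v 0 i)].
have mB : measurable B by apply: (@measurable_box n (fun i => _)) => i.
apply: (@lt_le_trans _ _ (lebesgue_rV n B)); last first.
  apply: le_measure; rewrite ?inE//; first exact: open_measurable_rV.
  move=> v Bv; apply: eU; rewrite -ball_normE /=.
  apply: (@le_lt_trans _ _ (e / 2)); last lra.
  apply: norm_rV_le => [|i]; first lra.
  have := Bv i; rewrite /= in_itv /= !mxE => /andP[? ?].
  by rewrite ler_norml; apply/andP; split; lra.
rewrite /B (@lebesgue_rV_box R n (fun i => `[x 0 i - e / 2, x 0 i + e / 2]%classic))//; under eq_bigr => i _.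
  rewrite lebesgue_measure_itv /= lte_fin.
  rewrite (_ : (if _ then _ else _) = e%:E); first over.
  by case: ifPn => [_|]; [rewrite -EFinB; congr EFin; lra|rewrite -leNgt => ?; exfalso; lra].
by rewrite prodEFin prodr_const card_ord lte_fin exprn_gt0.
Qed.

End borel_rV.

(** * Real-valued integrals on R^n and limit theorems *)

Section integral_rV.
Context {R : realType}.
Implicit Types (r B : R) (n : nat).

Definition Intg n (f : 'rV[R]_n -> R) : Prop :=
  (lebesgue_rV n).-integrable setT (EFin \o f).

(* Sealed, so that unification never unfolds integrals. *)
Fact Int_key : unit. Proof. exact: tt. Qed.
Definition Int n (f : 'rV[R]_n -> R) : R :=
  locked_with Int_key (fine (\int[lebesgue_rV n]_x (f x)%:E)).

Lemma IntE n (f : 'rV[R]_n -> R) :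
  Int f = fine (\int[lebesgue_rV n]_x (f x)%:E).
Proof. by rewrite /Int unlock. Qed.

Section fixed_dimension.
Variable n : nat.
Implicit Types f g : 'rV[R]_n -> R.

Lemma eq_Int f g : f =1 g -> Int f = Int g.
Proof. by move=> /funext ->. Qed.

Lemma Intg_measurable f : Intg f -> measurable_fun setT f.
Proof. by move=> /measurable_int /measurable_EFinP. Qed.

Lemma Intg_EFin f : Intg f -> (\int[lebesgue_rV n]_x (f x)%:E = (Int f)%:E)%E.
Proof. by move=> fi; rewrite IntE fineK//; exact: integrable_fin_num. Qed.

Lemma ge0_Intg f : measurable_fun setT f -> (forall x, 0 <= f x) ->
  (\int[lebesgue_rV n]_x (f x)%:E < +oo)%E -> Intg f.
Proof.
move=> mf f0 foo; apply/integrableP; split; first exact/measurable_EFinP.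
by under eq_integral => x _ do rewrite /= ger0_norm//.
Qed.

Lemma le_Intg f g : measurable_fun setT f -> (forall x, `|f x| <= g x) ->
  Intg g -> Intg f.
Proof.
move=> mf fg; apply: le_integrable => //; first exact/measurable_EFinP.
by move=> x _ /=; rewrite lee_fin (le_trans (fg x))// ler_norm.
Qed.

Lemma IntgD f g : Intg f -> Intg g -> Intg (fun x => f x + g x).
Proof. by move=> fi gi; apply: (integrableD measurableT fi gi). Qed.

Lemma IntgB f g : Intg f -> Intg g -> Intg (fun x => f x - g x).
Proof. by move=> fi gi; apply: (integrableB measurableT fi gi). Qed.

Lemma IntgZ (k : R) f : Intg f -> Intg (fun x => k * f x).
Proof. by move=> fi; apply: (integrableZl measurableT k fi). Qed.

Lemma Intg0 : Intg (fun _ : 'rV[R]_n => 0).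
Proof. exact: integrable0. Qed.

Lemma Intg_norm f : Intg f -> Intg (fun x => `|f x|).
Proof. by move=> fi; apply: (integrable_abse fi). Qed.

Lemma IntD f g : Intg f -> Intg g ->
  Int (fun x => f x + g x) = Int f + Int g.
Proof.
move=> fi gi; apply: EFin_inj; rewrite EFinD -!Intg_EFin//; last exact: IntgD.
by rewrite -(integralD measurableT fi gi).
Qed.

Lemma IntZ (k : R) f : Intg f -> Int (fun x => k * f x) = k * Int f.
Proof.
move=> fi; apply: EFin_inj; rewrite EFinM -!Intg_EFin//; last exact: IntgZ.
by rewrite -(integralZl measurableT fi).
Qed.

Lemma IntB f g : Intg f -> Intg g ->
  Int (fun x => f x - g x) = Int f - Int g.
Proof.
move=> fi gi; rewrite -mulN1r -IntZ// -IntD//; last exact: IntgZ.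
by apply: eq_Int => x; rewrite mulN1r.
Qed.

Lemma Int0 : Int (fun _ : 'rV[R]_n => 0) = 0.
Proof. by rewrite IntE integral0. Qed.

Lemma Int_ge0 f : (forall x, 0 <= f x) -> 0 <= Int f.
Proof. by move=> f0; rewrite IntE fine_ge0//; apply: integral_ge0 => x _; rewrite lee_fin. Qed.

Lemma le_Int f g : Intg f -> Intg g -> (forall x, f x <= g x) -> Int f <= Int g.
Proof. by move=> fi gi fg; rewrite -subr_ge0 -IntB//; apply: Int_ge0 => x; rewrite subr_ge0. Qed.

Lemma norm_Int_le f g : Intg f -> Intg g -> (forall x, `|f x| <= g x) ->
  `|Int f| <= Int g.
Proof.
move=> fi gi fg; rewrite ler_norml; apply/andP; split; last first.
  by apply: le_Int => // x; exact: le_trans (ler_norm _) (fg x).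
rewrite -subr_ge0 opprK -IntD//; apply: Int_ge0 => x.
by have := fg x; rewrite ler_norml => /andP[? _]; lra.
Qed.

Lemma Intg_sum (I : Type) (s : seq I) (F : I -> 'rV[R]_n -> R) :
  (forall i, Intg (F i)) -> Intg (fun x => \sum_(i <- s) F i x).
Proof.
move=> Fi; elim: s => [|i s IH].
  by rewrite (_ : (fun _ => _) = fun=> 0)//; [exact: Intg0|apply/funext => x; rewrite big_nil].
rewrite (_ : (fun _ => _) = fun x => F i x + \sum_(j <- s) F j x); first exact: IntgD.
by apply/funext => x; rewrite big_cons.
Qed.

Lemma Int_sum (I : Type) (s : seq I) (F : I -> 'rV[R]_n -> R) :
  (forall i, Intg (F i)) ->
  Int (fun x => \sum_(i <- s) F i x) = \sum_(i <- s) Int (F i).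
Proof.
move=> Fi; elim: s => [|i s IH].
  by rewrite big_nil -[RHS]Int0; apply: eq_Int => x; rewrite big_nil.
rewrite big_cons -IH -IntD//; last exact: Intg_sum.
by apply: eq_Int => x; rewrite big_cons.
Qed.

Lemma ge0_integral_affine_EFin (c : 'rV[R]_n) r f : r != 0 -> measurable_fun setT f ->
  (forall x, 0 <= f x) -> (\int[lebesgue_rV n]_x (f x)%:E =
  (`|r| ^+ n)%:E * \int[lebesgue_rV n]_x (f (c + r *: x))%:E)%E.
Proof.
move=> r0 mf f0; apply: (@ge0_integral_affine R n c r (EFin \o f)) => //.
exact/measurable_EFinP.
Qed.

Lemma measurable_affine_comp (c : 'rV[R]_n) r f : measurable_fun setT f ->
  measurable_fun setT (fun x : 'rV[R]_n => f (c + r *: x)).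
Proof. by move=> mf; apply: (measurableT_comp mf); exact: measurable_affine_rV. Qed.

Lemma Intg_affine (c : 'rV[R]_n) r f : r != 0 -> Intg f ->
  Intg (fun x : 'rV[R]_n => f (c + r *: x)).
Proof.
move=> r0 fi; have mf := Intg_measurable fi.
apply: (le_Intg (g := fun x : 'rV[R]_n => `|f (c + r *: x)|)) => //.
  exact: measurable_affine_comp.
have mn : measurable_fun setT (fun x => `|f x|) by exact: measurableT_comp.
apply: ge0_Intg => //; first exact: (measurable_affine_comp c r mn).
have := ge0_integral_affine_EFin c r0 mn (fun x => normr_ge0 _).
rewrite Intg_EFin; last exact: Intg_norm.
have rn : 0 < `|r| ^+ n by rewrite exprn_gt0 ?normr_gt0.
move=> /(congr1 (fun z => ((`|r| ^+ n)^-1)%:E * z)%E).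
by rewrite muleA -(EFinM _ (`|r| ^+ n)) mulVf ?gt_eqF// mul1e => <-; rewrite -EFinM ltry.
Qed.

Lemma Int_affine (c : 'rV[R]_n) r f : r != 0 -> Intg f ->
  Int f = `|r| ^+ n * Int (fun x : 'rV[R]_n => f (c + r *: x)).
Proof.
(* A signed f is reduced to the nonnegative case by f = (|f| + f) - |f|. *)
move=> r0; wlog f0 : f / forall x, 0 <= f x => [ge0_case fi|fi].
  have fE : Int f = Int (fun x => `|f x| + f x) - Int (fun x => `|f x|).
    by rewrite IntD//; [rewrite addrAC subrr add0r|exact: Intg_norm].
  rewrite fE (ge0_case (fun x => `|f x|))//; last exact: Intg_norm.
  rewrite (ge0_case (fun x => `|f x| + f x)).
  - rewrite -mulrBr -IntB; first by congr (_ * _); apply: eq_Int => x; rewrite addrAC subrr add0r.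
      apply: (@Intg_affine c r (fun x => `|f x| + f x) r0).
      by apply: IntgD => //; exact: Intg_norm.
    by apply: (@Intg_affine c r (fun x => `|f x|) r0); exact: Intg_norm.
  - by move=> x; have := ler_norm (- f x); rewrite normrN; lra.
  - by apply: IntgD => //; exact: Intg_norm.
apply: EFin_inj; rewrite EFinM -!Intg_EFin//; last exact: Intg_affine.
by apply: ge0_integral_affine_EFin => //; exact: Intg_measurable.
Qed.

Lemma Intg_shift h f : Intg f -> Intg (fun x => f (x + h)).
Proof.
move=> fi; have := Intg_affine h (oner_neq0 R) fi.
by under eq_fun do rewrite scale1r addrC.
Qed.

Lemma Int_shift h f : Intg f -> Int (fun x => f (x + h)) = Int f.
Proof.
move=> fi; rewrite (Int_affine h (oner_neq0 R) fi) normr1 expr1n mul1r.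
by apply: eq_Int => x; rewrite scale1r addrC.
Qed.

Lemma dominated_Int (f_ : nat -> 'rV[R]_n -> R) f g :
  (forall k, measurable_fun setT (f_ k)) -> Intg g ->
  (forall x, f_ ^~ x @ \oo --> f x) ->
  (forall k x, `|f_ k x| <= g x) ->
  Intg f /\ (fun k => Int (f_ k)) @ \oo --> Int f.
Proof.
move=> mf_ gi fcv fg.
have mf : measurable_fun setT f.
  by apply: (measurable_fun_cvg (h := f_)) => // x _; exact: fcv.
have [] := @dominated_convergence _ _ _ (lebesgue_rV n) setT measurableT
  (fun k => EFin \o f_ k) (EFin \o f) (EFin \o g).
- by move=> k; exact/measurable_EFinP.
- exact/measurable_EFinP.
- by apply/aeW => x _; apply: cvg_EFin; [exact: nearW|exact: fcv].
- exact: gi.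
- by apply/aeW => x k _; rewrite /= lee_fin.
move=> fi _ cv; split => //.
have f_i k : Intg (f_ k) by exact: le_Intg (fg k) gi.
rewrite (_ : (fun k => Int (f_ k)) =
    fine \o (fun k => \int[lebesgue_rV n]_x (f_ k x)%:E)%E); last first.
  by apply/funext => k; rewrite IntE.
by apply: fine_cvg; rewrite -Intg_EFin.
Qed.

(** Integrability of the limit is a conclusion: this is how finite energies are produced from
    uniform bounds. *)
Lemma fatou_Int (f_ : nat -> 'rV[R]_n -> R) f B :
  (forall k, Intg (f_ k)) -> (forall k x, 0 <= f_ k x) ->
  (forall x, f_ ^~ x @ \oo --> f x) -> (forall k, Int (f_ k) <= B) ->
  Intg f /\ Int f <= B.
Proof.
move=> fi f0 fcv fB.
have mf : measurable_fun setT f.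
  by apply: (measurable_fun_cvg (h := f_)) => [k|x _]; [exact: Intg_measurable|exact: fcv].
have ff0 x : 0 <= f x.
  have /(limr_ge (cvgP _ (fcv x))) : \forall k \near \oo, 0 <= f_ k x by exact: nearW.
  by rewrite (cvg_lim _ (fcv x)).
have lef : (\int[lebesgue_rV n]_x (f x)%:E <= B%:E)%E.
  have := @fatou _ _ _ (lebesgue_rV n) setT measurableT (fun k => EFin \o f_ k).
  move=> /(_ (fun k => measurable_int _ (fi k))) /(_ (fun k x _ => f0 k x)).
  have -> : (fun x => limn_einf (fun k => (EFin \o f_ k) x)) = EFin \o f.
    apply/funext => x; apply: (cvg_limn_einf_sup _).1.
    by apply: cvg_EFin; [exact: nearW|exact: fcv].
  move=> /le_trans; apply; rewrite limn_einf_lim; apply: lime_le; first exact: is_cvg_einfs.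
  apply: nearW => k; apply: (@le_trans _ _ (Int (f_ k))%:E); last by rewrite lee_fin.
  by rewrite -Intg_EFin//; apply: ereal_inf_lbound; exists k => /=.
have fi' : Intg f by apply: ge0_Intg => //; exact: le_lt_trans lef (ltry _).
by split => //; rewrite -lee_fin -Intg_EFin.
Qed.

Lemma bounded_support_Intg f B r : measurable_fun setT f ->
  (forall x, `|f x| <= B) -> (forall x, r < `|x| -> f x = 0) -> Intg f.
Proof.
move=> mf fB fr.
pose A := [set v : 'rV[R]_n | `|v| <= `|r|].
have mA : measurable A.
  rewrite -[A]setCK; apply: measurableC; apply: open_measurable_rV.
  rewrite (_ : ~` A = (fun v : 'rV[R]_n => `|v|) @^-1` [set t | `|r| < t]).
    by move: (@norm_continuous R 'rV[R]_n) => /continuousP; apply; exact: open_gt.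
  by apply/seteqP; split => v; rewrite /A /= ltNge => /negP.
apply: (@le_Intg _ (fun x => B * \1_A x)) => //.
  move=> x; rewrite indicE; have [xA|xA] := boolP (x \in A).
    by rewrite mulr1.
  rewrite mulr0 fr ?normr0//; apply: le_lt_trans (ler_norm r) _.
  by rewrite ltNge; apply/negP => xr; move: xA => /negP; apply; exact: mem_set.
apply: IntgZ; apply: ge0_Intg => //.
by rewrite integral_indic// setIT [X in (X < _)%E]lebesgue_rV_cube// ltry.
Qed.

Lemma Int_gt0 f x : continuous f -> Intg f -> (forall x, 0 <= f x) -> 0 < f x ->
  0 < Int f.
Proof.
move=> cf fi f0 fx.
pose U := f @^-1` [set t | f x / 2 < t].
have oU : open U by move: cf => /continuousP; apply; exact: open_gt.
have Ux : U x by rewrite /U /=; lra.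
have mU := open_measurable_rV oU.
have Ui : (0 < lebesgue_rV n U)%E by apply: lebesgue_rV_open_gt0 => //; exists x.
rewrite -lte_fin -Intg_EFin//.
apply: (@lt_le_trans _ _ ((f x / 2)%:E * lebesgue_rV n U)%E).
  by rewrite mule_gt0// lte_fin divr_gt0.
rewrite -[X in (_ * lebesgue_rV n X)%E]setIT -integral_indic// -ge0_integralZl//; last 2 first.
- by apply/measurable_EFinP.
- by rewrite lee_fin; lra.
apply: ge0_le_integral => //.
- by move=> y _; rewrite -EFinM lee_fin mulr_ge0//; lra.
- by apply/measurable_EFinP; apply: measurable_funM.
- by apply/measurable_EFinP; exact: Intg_measurable.
move=> y _; rewrite -EFinM lee_fin indicE; have [yU|_] := boolP (y \in U).
  by move: yU => /set_mem; rewrite /U /= mulr1 => /ltW.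
by rewrite mulr0.
Qed.

End fixed_dimension.

End integral_rV.

(** * Fubini under a product bound *)

Section fubini_rV.
Context {R : realType} (n m : nat).
Notation V := 'rV[R]_n.
Notation W := 'rV[R]_m.

Lemma measurable_fst_comp (a : V -> R) : measurable_fun setT a ->
  measurable_fun setT (fun p : V * W => a p.1).
Proof. by move=> ma; apply: (measurableT_comp ma); exact: measurable_fst. Qed.

Lemma measurable_snd_comp (a : W -> R) : measurable_fun setT a ->
  measurable_fun setT (fun p : V * W => a p.2).
Proof. by move=> ma; apply: (measurableT_comp ma); exact: measurable_snd. Qed.

(** The bound a(x) b(y) makes F integrable on the product space, so Fubini applies. The sections are
    integrable for every x and y, not just almost everywhere, which suits the total function
    [Int]. *)
Lemma Int_swap (F : V -> W -> R) (a : V -> R) (b : W -> R) :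
  measurable_fun setT (fun p : V * W => F p.1 p.2) ->
  Intg a -> Intg b -> (forall x y, `|F x y| <= a x * b y) ->
  [/\ Intg (fun x => Int (F x)), Intg (fun y => Int (fun x => F x y)) &
      Int (fun x => Int (F x)) = Int (fun y => Int (fun x => F x y))].
Proof.
move=> mF ai bi Fab.
have mF1 x : measurable_fun setT (F x) by exact: (measurable_fun_pair2 x mF).
have mF2 y : measurable_fun setT (fun x => F x y).
  exact: (measurable_fun_pair1 y mF).
have F1i x : Intg (F x) by apply: le_Intg (mF1 x) (Fab x) _; exact: IntgZ.
have F2i y : Intg (fun x => F x y).
  apply: (le_Intg (g := fun x => b y * a x)) => // [x|]; first by rewrite mulrC.
  exact: IntgZ.
have Fi : (lebesgue_rV n \x lebesgue_rV m)%E.-integrable setT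
    (fun p : V * W => (F p.1 p.2)%:E).
  apply/integrable12ltyP; first exact/measurable_EFinP.
  have -> : (\int[lebesgue_rV n]_x \int[lebesgue_rV m]_y `|(F (x, y).1 (x, y).2)%:E|)%E =
      (\int[lebesgue_rV n]_x (Int (fun y => `|F x y|))%:E)%E.
    by apply: eq_integral => x _; rewrite -Intg_EFin//; exact: Intg_norm.
  apply: (@le_lt_trans _ _ (\int[lebesgue_rV n]_x (`|Int b| * `|a x|)%:E)%E).
    apply: ge0_le_integral => //.
    - by move=> x _; rewrite lee_fin; apply: Int_ge0.
    - rewrite (_ : (fun _ => _) = fun x => \int[lebesgue_rV m]_y `|(F x y)%:E|)%E.
        apply: (@measurable_fun_fubini_tonelli_F _ _ _ _ R (lebesgue_rV m)
          (fun p : V * W => `|(F p.1 p.2)%:E|%E)) => //.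
        by apply: measurableT_comp => //; exact/measurable_EFinP.
      by apply/funext => x; rewrite -Intg_EFin//; exact: Intg_norm.
    - apply/measurable_EFinP; apply: measurable_funM => //.
      by apply: measurableT_comp => //; exact: Intg_measurable.
    move=> x _; rewrite lee_fin -normrM mulrC -IntZ//.
    apply: le_trans (ler_norm _); apply: le_Int => //; first exact: Intg_norm.
    exact: IntgZ.
  rewrite Intg_EFin ?ltry//; apply: IntgZ; exact: Intg_norm.
split.
- have := integrable_fubini_F Fi; rewrite /fubini_F /Intg.
  by under eq_fun => x do rewrite /= Intg_EFin//.
- apply: (@le_Intg _ _ _ (fun y => Int a * b y)); last exact: IntgZ.
    apply/measurable_EFinP; have := measurable_fubini_G Fi; rewrite /fubini_G.
    by under eq_fun => x do rewrite /= Intg_EFin//.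
  move=> y; rewrite mulrC -IntZ//; apply: norm_Int_le => //; first exact: IntgZ.
  by move=> x; rewrite mulrC.
have := Fubini Fi => /=.
under eq_integral => x _ do rewrite Intg_EFin//.
under [in X in _ = X -> _]eq_integral => y _ do rewrite Intg_EFin//.
by rewrite !IntE => ->.
Qed.

End fubini_rV.

(** * Continuous functions with bounded support *)

Section compact_support.
Context {R : realType} (n : nat).
Notation V := 'rV[R]_n.
Implicit Types (f g : V -> R) (t : R).

Definition Cc f := continuous f /\ exists r : R, forall x, r < `|x| -> f x = 0.

Lemma Cc_continuous f : Cc f -> continuous f. Proof. by case. Qed.

Lemma Cc_measurable f : Cc f -> measurable_fun setT f.
Proof. by move=> /Cc_continuous; exact: continuous_measurable_rV. Qed.

Lemma Cc_bounded f : Cc f -> exists B, forall x, `|f x| <= B.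
Proof.
move=> [cf [r fr]].
pose A := [set x : V | `|x| <= `|r|].
have cA : compact A.
  apply: bounded_closed_compact.
    exists `|r|; split; first exact: num_real.
    by move=> t rt x /= /le_trans; apply; exact: ltW.
  rewrite (_ : A = (fun v : V => `|v|) @^-1` [set t | t <= `|r|])//.
  apply: closed_comp; last exact: closed_le.
  by move=> x _; exact: norm_continuous.
have A0 : A !=set0 by exists 0; rewrite /A /= normr0.
have cn : {within A, continuous (fun x => `|f x|)}.
  apply: continuous_subspaceT => x.
  by apply: (continuous_comp (cf x)); exact: norm_continuous.
have [c _ cmax] := compact_EVT_max A0 cA cn.
exists `|f c| => x; have [xr|rx] := leP `|x| `|r|.
  by apply: cmax; rewrite inE.
by rewrite fr ?normr0//; apply: le_lt_trans rx; exact: ler_norm.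
Qed.

Lemma Cc_Intg f : Cc f -> Intg f.
Proof.
move=> Cf; have [B fB] := Cc_bounded Cf; have [_ [r fr]] := Cf.
exact: bounded_support_Intg (Cc_measurable Cf) fB fr.
Qed.

Lemma CcD f g : Cc f -> Cc g -> Cc (fun x => f x + g x).
Proof.
move=> [cf [r fr]] [cg [r' gr]]; split=> [x|]; first exact: (cvgD (cf x) (cg x)).
by exists (Num.max r r') => x; rewrite gt_max => /andP[? ?]; rewrite fr// gr// addr0.
Qed.

Lemma CcM f g : Cc f -> continuous g -> Cc (fun x => f x * g x).
Proof.
move=> [cf [r fr]] cg; split=> [x|]; first exact: (cvgM (cf x) (cg x)).
by exists r => x rx; rewrite fr// mul0r.
Qed.

Lemma CcZ t f : Cc f -> Cc (fun x => t * f x).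
Proof.
by move=> Cf; under eq_fun do rewrite mulrC; exact: (CcM Cf (@cst_continuous _ _ t)).
Qed.

Lemma CcB f g : Cc f -> Cc g -> Cc (fun x => f x - g x).
Proof.
move=> Cf Cg; rewrite (_ : (fun _ => _) = fun x => f x + -1 * g x).
  by apply: CcD => //; exact: CcZ.
by apply/funext => x; rewrite mulN1r.
Qed.

Lemma Cc_comp (phi : R -> R) f : continuous phi -> phi 0 = 0 -> Cc f ->
  Cc (fun x => phi (f x)).
Proof.
move=> cphi phi0 [cf [r fr]]; split=> [x|]; last by exists r => x rx; rewrite fr.
by apply: (continuous_comp (cf x)); exact: cphi.
Qed.

Lemma continuous_affine_rV (c : V) t : continuous (fun x : V => c + t *: x).
Proof.
move=> x; apply: (@continuousD _ _ _ (fun=> c) (fun x : V => t *: x)).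
  exact: cst_continuous.
exact: scaler_continuous.
Qed.

Lemma Cc_affine (c : V) t f : t != 0 -> Cc f -> Cc (fun x => f (c + t *: x)).
Proof.
move=> t0 [cf [r fr]]; split=> [x|].
  by apply: (continuous_comp (@continuous_affine_rV c t x)); exact: cf.
exists ((r + `|c|) / `|t|) => x; rewrite ltr_pdivrMr ?normr_gt0// => rx.
apply: fr; have := ler_normB (c + t *: x) c.
by rewrite addrAC subrr add0r normrZ mulrC; lra.
Qed.

Lemma Cc_shift (h : V) f : Cc f -> Cc (fun x => f (x + h)).
Proof.
move=> /(Cc_affine h (oner_neq0 R)).
by under eq_fun do rewrite scale1r addrC.
Qed.

Lemma measurable_combination (a b : R) f : measurable_fun setT f ->
  measurable_fun setT (fun p : V * V => f (a *: p.1 + b *: p.2)).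
Proof.
move=> mf; apply: (measurableT_comp mf); apply: measurable_fun_rV => i.
rewrite (_ : (fun _ => _) = fun p : V * V => a * p.1 0 i + b * p.2 0 i).
  apply: (@measurable_funD _ _ _ _ (fun p : V * V => a * p.1 0 i)
      (fun p => b * p.2 0 i)).
    apply: (@measurable_fst_comp R n n (fun x => a * x 0 i)).
    by apply: measurable_funM => //; exact: measurable_coord_rV.
  apply: (@measurable_snd_comp R n n (fun x => b * x 0 i)).
  by apply: measurable_funM => //; exact: measurable_coord_rV.
by apply/funext => p; rewrite !mxE.
Qed.

Lemma measurable_shift2 f : measurable_fun setT f ->
  measurable_fun setT (fun p : V * V => f (p.2 + p.1)).
Proof.
by move=> /(measurable_combination 1 1); under eq_fun do rewrite !scale1r addrC.
Qed.

End compact_support.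

(** * Soft thresholding *)

Section shrink.
Context {R : realType}.
Implicit Types e r x y : R.

(* Soft thresholding: moves r towards 0 by e. *)
Definition shrink e r : R := Num.max (r - e) 0 + Num.min (r + e) 0.

Lemma continuous_shrink e : continuous (shrink e).
Proof.
move=> x; apply: (@continuousD _ _ _ (fun r : R => Num.max (r - e) 0)
    (fun r : R => Num.min (r + e) 0)).
  apply: (@continuous_max _ _ (fun r : R => r - e) (fun=> 0)).
    by apply: (@continuousB _ _ _ id (fun=> e)); [exact: cvg_id|exact: cst_continuous].
  exact: cst_continuous.
apply: (@continuous_min _ _ (fun r : R => r + e) (fun=> 0)).
  by apply: (@continuousD _ _ _ id (fun=> e)); [exact: cvg_id|exact: cst_continuous].
exact: cst_continuous.
Qed.

Lemma shrink_spec e r : 0 <= e -> [\/ `|r| <= e /\ shrink e r = 0,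
  e < r /\ shrink e r = r - e | r < - e /\ shrink e r = r + e].
Proof.
move=> e0; rewrite /shrink; have [re|re] := leP r e; have [re'|re'] := leP (- e) r.
- apply: Or31; split; first by rewrite ler_norml re re'.
  by rewrite max_r ?min_r//; lra.
- by apply: Or33; split => //; rewrite max_r ?min_l//; lra.
- by apply: Or32; split => //; rewrite max_l ?min_r//; lra.
- exfalso; lra.
Qed.

Lemma shrink0 e : 0 <= e -> shrink e 0 = 0.
Proof. by move=> e0; case: (shrink_spec 0 e0) => -[? ->] //; lra. Qed.

Lemma shrink_small e r : 0 <= e -> `|r| <= e -> shrink e r = 0.
Proof.
by move=> e0; rewrite ler_norml => /andP[? ?]; case: (shrink_spec r e0) => -[? ->] //; lra.
Qed.

Lemma shrink_dist e r : 0 <= e -> `|shrink e r - r| <= e.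
Proof.
move=> e0; case: (shrink_spec r e0) => -[? ->]; rewrite ?sub0r ?normrN//.
  by rewrite addrAC subrr add0r normrN ger0_norm.
by rewrite addrAC subrr add0r ger0_norm.
Qed.

Lemma norm_shrink_le e r : 0 <= e -> `|shrink e r| <= `|r|.
Proof.
move=> e0; case: (shrink_spec r e0) => -[? ->]; first by rewrite normr0.
  by rewrite !gtr0_norm//; lra.
by rewrite !ltr0_norm//; lra.
Qed.

(** Firm nonexpansiveness: [shrink e] is nondecreasing and 1-Lipschitz. It makes the energy of a
    thresholded function at most its cross energy with the original. *)
Lemma shrink_monotone e x y : 0 <= e ->
  (shrink e x - shrink e y) ^+ 2 <= (x - y) * (shrink e x - shrink e y).
Proof.
by move=> e0; case: (shrink_spec x e0) => -[+ ->]; rewrite ?ler_norml => h;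
  case: (shrink_spec y e0) => -[+ ->]; rewrite ?ler_norml => h'; nra.
Qed.

Lemma shrink_contraction e x y : 0 <= e -> (shrink e x - shrink e y) ^+ 2 <= (x - y) ^+ 2.
Proof.
move=> /(shrink_monotone x y); set d := shrink e x - shrink e y.
by have := sqr_ge0 (x - y - d); nra.
Qed.

End shrink.

(** * Integrated products of increments *)

Section increments.
Context {R : realType} (n : nat).
Notation V := 'rV[R]_n.
Implicit Types (u v w : V -> R) (h : V) (t : R).

(** Common building block of both energies: increments along the axes give the Dirichlet form,
    increments averaged against the kernel give the Gagliardo form. *)
Definition Lam u v h := Int (fun x => (u (x + h) - u x) * (v (x + h) - v x)).

Lemma Cc_increment u h : Cc u -> Cc (fun x => u (x + h) - u x).
Proof. by move=> Cu; apply: CcB => //; exact: Cc_shift. Qed.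

Lemma Intg_Lam u v h : Cc u -> Cc v ->
  Intg (fun x => (u (x + h) - u x) * (v (x + h) - v x)).
Proof.
move=> Cu Cv; apply: Cc_Intg; apply: CcM; first exact: Cc_increment.
by apply: Cc_continuous; exact: Cc_increment.
Qed.

Lemma Lam_ge0 u h : 0 <= Lam u u h.
Proof. by apply: Int_ge0 => x; rewrite -expr2 sqr_ge0. Qed.

Lemma Lam_sub u v h : Cc u -> Cc v ->
  Lam (fun x => u x - v x) (fun x => u x - v x) h =
  Lam u u h + Lam v v h - 2 * Lam u v h.
Proof.
move=> Cu Cv; have iu := Intg_Lam h Cu Cu; have iv := Intg_Lam h Cv Cv.
have iuv := Intg_Lam h Cu Cv.
rewrite /Lam -IntD// -IntZ// -IntB; [|exact: IntgD|exact: IntgZ].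
by apply: eq_Int => x; ring.
Qed.

Lemma Lam_add u v h : Cc u -> Cc v ->
  Lam (fun x => u x + v x) (fun x => u x + v x) h =
  Lam u u h + Lam v v h + 2 * Lam u v h.
Proof.
move=> Cu Cv; have iu := Intg_Lam h Cu Cu; have iv := Intg_Lam h Cv Cv.
have iuv := Intg_Lam h Cu Cv.
rewrite /Lam -IntD// -IntZ// -IntD; [|exact: IntgD|exact: IntgZ].
by apply: eq_Int => x; ring.
Qed.

Lemma Lam_scale t u h : Cc u ->
  Lam (fun x => t * u x) (fun x => t * u x) h = t ^+ 2 * Lam u u h.
Proof.
move=> Cu; rewrite /Lam -IntZ; last exact: Intg_Lam.
by apply: eq_Int => x; ring.
Qed.

Lemma Lam_opp u v h : Cc u -> Cc v -> Lam u v (- h) = Lam u v h.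
Proof.
move=> Cu Cv; rewrite /Lam -(Int_shift (n := n) h); last exact: Intg_Lam.
by apply: eq_Int => x; rewrite addrK; ring.
Qed.

(** Discrete integration by parts: translating one of the two terms by h moves the difference from v
    onto u. *)
Lemma Lam_second u v h : Cc u -> Cc v ->
  Lam u v h = Int (fun x => v x * (2 * u x - u (x + h) - u (x - h))).
Proof.
move=> Cu Cv.
have C1 : Cc (fun x => (u x - u (x - h)) * v x).
  by apply: CcM (Cc_continuous Cv); apply: CcB => //; exact: Cc_shift.
have C2 : Cc (fun x => (u (x + h) - u x) * v x).
  by apply: CcM (Cc_continuous Cv); exact: Cc_increment.
rewrite /Lam -[RHS](_ : Int (fun x => (u x - u (x - h)) * v x) -
    Int (fun x => (u (x + h) - u x) * v x) = _); last first.
  by rewrite -IntB; [apply: eq_Int => x; ring|exact: Cc_Intg..].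
rewrite -[X in X - _](Int_shift h); last exact: Cc_Intg.
rewrite -IntB; [|by apply: Cc_Intg; exact: (Cc_shift h C1)|exact: Cc_Intg].
by apply: eq_Int => x; rewrite addrK; ring.
Qed.

Lemma Lam_affine u v (c : V) t h : t != 0 -> Cc u -> Cc v ->
  Lam u v (t *: h) =
  `|t| ^+ n * Lam (fun x => u (c + t *: x)) (fun x => v (c + t *: x)) h.
Proof.
move=> t0 Cu Cv; rewrite /Lam (Int_affine c t0); last exact: Intg_Lam.
by congr (_ * _); apply: eq_Int => x; rewrite scalerDr addrA.
Qed.

Lemma sqr_sumr_le (I : Type) (s : seq I) (a : I -> R) :
  (\sum_(i <- s) a i) ^+ 2 <= (size s)%:R * \sum_(i <- s) a i ^+ 2.
Proof.
elim: s => [|i s IH]; first by rewrite !big_nil expr0n mulr0.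
rewrite !big_cons /= -natr1; set S := \sum_(_ <- _) _ in IH *.
set Q := \sum_(_ <- _) _ in IH *; set k := (size s)%:R in IH *.
have k0 : 0 <= k by rewrite ler0n.
have Q0 : 0 <= Q by apply: sumr_ge0 => j _; exact: sqr_ge0.
have : 2 * a i * S <= k * a i ^+ 2 + Q.
  move: k0; rewrite le_eqVlt => /orP[/eqP k0|k0].
    have -> : S = 0 by apply/eqP; rewrite -sqrf_eq0 eq_le sqr_ge0 andbT; nra.
    by rewrite -k0; nra.
  rewrite -(ler_pM2l k0); have := sqr_ge0 (k * a i - S); nra.
by nra.
Qed.

(** The increment along k h telescopes into k translates of the increment along h; the
    Cauchy-Schwarz inequality costs a factor k, and the k integrals are equal. *)
Lemma Lam_natmul u k h : Cc u -> Lam u u (k%:R *: h) <= k%:R ^+ 2 * Lam u u h.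
Proof.
move=> Cu; pose F j x := (u (x + h + j%:R *: h) - u (x + j%:R *: h)) ^+ 2.
have Fi j : Intg (F j).
  rewrite /F (_ : (fun _ => _) = fun x => (u (x + j%:R *: h + h) - u (x + j%:R *: h))
      * (u (x + j%:R *: h + h) - u (x + j%:R *: h))).
    exact: (Intg_shift (j%:R *: h) (Intg_Lam h Cu Cu)).
  by apply/funext => x; rewrite expr2 addrAC.
have FE j : Int (F j) = Lam u u h.
  rewrite -[RHS](Int_shift (n := n) (j%:R *: h)); last exact: Intg_Lam.
  by apply: eq_Int => x; rewrite /F expr2 addrAC.
have -> : k%:R ^+ 2 * Lam u u h =
    Int (fun x => k%:R * \sum_(j <- iota 0 k) F j x).
  rewrite IntZ; last exact: Intg_sum.
  rewrite Int_sum// (eq_bigr (fun=> Lam u u h)) => [|j _]; last exact: FE.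
  by rewrite big_const_seq count_predT size_iota iter_addr_0 -(mulr_natl (Lam u u h)) expr2 mulrA.
apply: le_Int; [exact: Intg_Lam|by apply: IntgZ; exact: Intg_sum|move=> x].
have -> : u (x + k%:R *: h) - u x =
    \sum_(j <- iota 0 k) (u (x + h + j%:R *: h) - u (x + j%:R *: h)).
  elim: k => [|k IH]; first by rewrite big_nil scale0r addr0 subrr.
  rewrite -(addn1 k) iotaD big_cat /= big_seq1 -IH add0n natrD scalerDl scale1r.
  by rewrite (addrC (k%:R *: h)) addrA; ring.
by rewrite -expr2 (le_trans (sqr_sumr_le _ _))// size_iota.
Qed.

Lemma Lam_shrink u e h : 0 <= e -> Cc u ->
  let v x := shrink e (u x) in
  Lam v v h <= Lam u v h /\ Lam v v h <= Lam u u h.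
Proof.
move=> e0 Cu v.
have Cv : Cc v by apply: Cc_comp => //; [exact: continuous_shrink|exact: shrink0].
split; apply: le_Int; try exact: Intg_Lam; move=> x; rewrite -expr2.
  exact: shrink_monotone.
by rewrite -expr2; exact: shrink_contraction.
Qed.

(** Polarization reduces to u = v, where the integrand is nonnegative and Tonelli provides
    measurability. *)
Lemma measurable_Lam u v : Cc u -> Cc v -> measurable_fun setT (Lam u v).
Proof.
suff mL w : Cc w -> measurable_fun setT (Lam w w).
  move=> Cu Cv; rewrite (_ : Lam u v = fun h =>
    2^-1 * (Lam u u h + Lam v v h - Lam (fun x => u x - v x) (fun x => u x - v x) h)).
    apply: measurable_funM => //; apply: measurable_funB; last by apply: mL; exact: CcB.
    by apply: measurable_funD; exact: mL.
  by apply/funext => h; rewrite Lam_sub//; field.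
move=> Cw; have mw := Cc_measurable Cw.
apply/measurable_EFinP.
have -> : EFin \o Lam w w =
    fun h => (\int[lebesgue_rV n]_x ((w (x + h) - w x) * (w (x + h) - w x))%:E)%E.
  by apply/funext => h; rewrite Intg_EFin//; exact: Intg_Lam.
apply: (@measurable_fun_fubini_tonelli_F _ _ _ _ R (lebesgue_rV n)
   (fun p : V * V => ((w (p.2 + p.1) - w p.2) * (w (p.2 + p.1) - w p.2))%:E)); last first.
  by move=> p; rewrite lee_fin -expr2 sqr_ge0.
apply/measurable_EFinP.
have mF : measurable_fun setT (fun p : V * V => w (p.2 + p.1) - w p.2).
  apply: (@measurable_funB _ _ _ _ (fun p : V * V => w (p.2 + p.1)) (fun p => w p.2)).
    exact: measurable_shift2.
  exact: measurable_snd_comp.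
exact: measurable_funM.
Qed.

End increments.

(** * The Euclidean norm *)

Section euclidean_norm.
Context {R : realType} (n : nat).
Notation V := 'rV[R]_n.
Implicit Types (v h : V) (t : R).

Lemma enorm_ge0 v : 0 <= enorm v. Proof. exact: sqrtr_ge0. Qed.

Lemma enorm_sqr v : enorm v ^+ 2 = \sum_(i < n) v 0 i ^+ 2.
Proof. by rewrite sqr_sqrtr//; apply: sumr_ge0 => i _; exact: sqr_ge0. Qed.

Lemma coord_le_enorm v i : `|v 0 i| <= enorm v.
Proof.
rewrite -(@ler_pXn2r _ 2) ?nnegrE ?enorm_ge0// enorm_sqr real_normK ?num_real//.
by rewrite (bigD1 i)//= lerDl; apply: sumr_ge0 => j _; exact: sqr_ge0.
Qed.

Lemma norm_le_enorm v : `|v| <= enorm v.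
Proof. by apply: norm_rV_le; [exact: enorm_ge0|exact: coord_le_enorm]. Qed.

Lemma enorm_le_norm v : enorm v <= n%:R * `|v|.
Proof.
rewrite -(@ler_pXn2r _ 2) ?nnegrE ?enorm_ge0 ?mulr_ge0// enorm_sqr.
apply: (@le_trans _ _ (\sum_(i < n) `|v| ^+ 2)).
  apply: ler_sum => i _; rewrite -(real_normK (num_real (v 0 i))).
  by rewrite lerXn2r ?nnegrE//; exact: coord_le_norm.
rewrite sumr_const card_ord -(mulr_natl (`|v| ^+ 2)) exprMn ler_wpM2r ?sqr_ge0//.
by rewrite -natrX ler_nat; case: n => // m; rewrite leq_pmulr.
Qed.

Lemma enormZ t v : enorm (t *: v) = `|t| * enorm v.
Proof.
rewrite -sqrtr_sqr -sqrtrM ?sqr_ge0// mulr_sumr; congr Num.sqrt.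
by apply: eq_bigr => i _; rewrite mxE exprMn.
Qed.

Lemma enormN v : enorm (- v) = enorm v.
Proof. by rewrite -scaleN1r enormZ normrN1 mul1r. Qed.

Lemma enorm0 : enorm (0 : V) = 0.
Proof. by rewrite -(scale0r 0) enormZ normr0 mul0r. Qed.

Lemma continuous_enorm : continuous (@enorm R n).
Proof.
move=> x; apply: (@continuous_comp _ _ _ (fun v : V => \sum_(i < n) v 0 i ^+ 2) Num.sqrt).
  move: x; apply: continuous_big => [|i _ x]; first exact: add_continuous.
  apply: (@continuous_comp _ _ _ (fun v : V => v 0 i) (fun r : R => r ^+ 2)).
    exact: coord_continuous.
  exact: exprn_continuous.
exact: sqrt_continuous.
Qed.

Lemma measurable_enorm : measurable_fun setT (@enorm R n).
Proof. exact: (continuous_measurable_rV continuous_enorm). Qed.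

End euclidean_norm.

(** * Integrability of the fractional kernel *)

Section kernel.
Context {R : realType} (n : nat) (s : R).
Hypothesis s01 : 0 < s < 1.
Notation V := 'rV[R]_n.
Implicit Types (h : V) (t : R).

Definition ker h : R := (enorm h `^ (n%:R + 2 * s))^-1.

Lemma ker_ge0 h : 0 <= ker h.
Proof. by rewrite invr_ge0 powR_ge0. Qed.

Lemma ker_gt0 h : 0 < enorm h -> 0 < ker h.
Proof. by move=> h0; rewrite invr_gt0 powR_gt0. Qed.

Lemma kerN h : ker (- h) = ker h.
Proof. by rewrite /ker enormN. Qed.

Lemma kerZ t h : 0 < t -> ker (t *: h) = (t `^ (n%:R + 2 * s))^-1 * ker h.
Proof. by move=> t0; rewrite /ker enormZ gtr0_norm// powRM ?enorm_ge0 ?ltW// invfM. Qed.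

Lemma powR_critical t : 0 < t -> t `^ (n%:R + 2 * s) = t ^+ n * t `^ (2 * s).
Proof.
move=> t0; rewrite powRD ?powR_mulrn ?ltW//.
by rewrite (gt_eqF t0) implybT.
Qed.

Lemma powR_gt1 (x t : R) : 1 < x -> 0 < t -> 1 < x `^ t.
Proof.
move=> x1 t0; have := @gt0_ltr_powR R t t0 1 x.
by rewrite powR1; apply; rewrite // nnegrE; lra.
Qed.

Lemma measurable_ker : measurable_fun setT ker.
Proof.
rewrite /ker; under eq_fun do rewrite -powRN.
apply: (@measurableT_comp _ _ _ _ _ _ (fun x : R => x `^ (- (n%:R + 2 * s)))); last exact: measurable_enorm.
exact: measurable_powR.
Qed.

(* The masses of f_ satisfy J_(m+1) = Int g + theta J_m, hence stay below
   Int g / (1 - theta). *)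
Lemma Intg_self_similar (f_ : nat -> V -> R) (f g : V -> R) c rho theta :
  (forall h, f_ 0%N h = 0) ->
  (forall m h, f_ m.+1 h = g h + c * f_ m (rho *: h)) ->
  rho != 0 -> Intg g -> (forall h, 0 <= g h) -> 0 <= c ->
  c = theta * `|rho| ^+ n -> theta < 1 ->
  (forall h, f_ ^~ h @ \oo --> f h) -> Intg f.
Proof.
move=> f0 fS rho0 gi g0 c0 ctheta theta1 fcv.
have theta0 : 0 <= theta.
  by rewrite -(@pmulr_lge0 _ (`|rho| ^+ n)) -?ctheta// exprn_gt0// normr_gt0.
have fge m h : 0 <= f_ m h.
  elim: m h => [|m IH] h; first by rewrite f0.
  by rewrite fS addr_ge0// mulr_ge0.
have fE m : f_ m.+1 = fun h => g h + c * f_ m (0 + rho *: h).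
  by apply/funext => h; rewrite fS add0r.
have fi m : Intg (f_ m).
  elim: m => [|m IH].
    by rewrite (_ : f_ 0%N = fun=> 0); [exact: Intg0|apply/funext => h; rewrite f0].
  by rewrite fE; apply: IntgD => //; apply: IntgZ; exact: Intg_affine.
have Jm m : Int (f_ m) <= Int g / (1 - theta).
  have G0 := Int_ge0 g0.
  elim: m => [|m IH].
    rewrite (_ : f_ 0%N = fun=> 0); last by apply/funext => h; rewrite f0.
    by rewrite Int0 divr_ge0// subr_ge0 ltW.
  rewrite fE IntD//; last by apply: IntgZ; exact: Intg_affine.
  rewrite IntZ; last exact: Intg_affine.
  rewrite ctheta -mulrA -(Int_affine 0 rho0 (fi m)).
  apply: (@le_trans _ _ (Int g + theta * (Int g / (1 - theta)))).
    by rewrite lerD2l ler_wpM2l.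
  rewrite le_eqVlt; apply/orP; left; apply/eqP; field.
  by rewrite subr_eq0 gt_eqF.
by have [] := fatou_Int fi fge fcv Jm.
Qed.

Let gamma := n%:R + 2 * s.

Let gamma_gt0 : 0 < gamma.
Proof. by move: s01 => /andP[? ?]; rewrite ltr_wpDl// mulr_gt0. Qed.

Lemma Intg_annulus (f : V -> R) r : 0 < r -> measurable_fun setT f ->
  (forall h, r <= enorm h < 2 * r -> 0 <= f h <= ker h) ->
  Intg (fun h => if r <= enorm h < 2 * r then f h else 0).
Proof.
move=> r0 mf fk.
apply: (@bounded_support_Intg _ _ _ ((r `^ gamma)^-1) (2 * r)).
- apply: measurable_fun_if => //.
  + apply: measurable_and.
      by apply: measurable_fun_ler; [exact: measurable_cst|exact: measurable_enorm].
    by apply: measurable_fun_ltr; [exact: measurable_enorm|exact: measurable_cst].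
  + exact: measurable_funTS.
- move=> h; case: ifPn => [hr|_]; last by rewrite normr0 invr_ge0 powR_ge0.
  have /andP[fh0 fhk] := fk h hr; rewrite ger0_norm//; apply: le_trans fhk _.
  move: hr => /andP[rh _]; rewrite lef_pV2 ?posrE ?powR_gt0//; last first.
    exact: lt_le_trans r0 rh.
  by apply: ge0_ler_powR => //; rewrite ?nnegrE ?enorm_ge0 ?(ltW r0) ?(ltW gamma_gt0).
- move=> h rh; case: ifPn => // /andP[_ hr].
  by have := norm_le_enorm h; lra.
Qed.

(** Dyadic self-similarity in place of polar coordinates: cutting off at 2^-(m+1) gives one annulus
    plus the previous cut-off function composed with h -> 2 h. The ratio of masses 2^(2s) / 4 is
    below 1 because s < 1. *)
Lemma Intg_ker_origin :
  Intg (fun h : V => if 0 < enorm h < 1 then enorm h ^+ 2 * ker h else 0).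
Proof.
have g0 := gamma_gt0.
have half0 : 0 < 2^-1 :> R by rewrite invr_gt0.
have half2 : 2 * 2^-1 = 1 :> R by rewrite divff.
pose g (h : V) := if 2^-1 <= enorm h < 2 * 2^-1 then enorm h ^+ 2 * ker h else 0.
pose F m (h : V) := if 2^-1 ^+ m <= enorm h < 1 then enorm h ^+ 2 * ker h else 0.
have p0 : 0 < 2 `^ gamma :> R by rewrite powR_gt0.
apply: (@Intg_self_similar F _ g (2 `^ gamma / 4) 2 (2 `^ (2 * s) / 4)).
- by move=> h; rewrite /F expr0; case: ifPn => // /andP[h1]; rewrite ltNge h1.
- move=> m h; rewrite /F /g enormZ (@ger0_norm _ 2)// kerZ// -/gamma half2 exprS.
  have dm : 2^-1 ^+ m <= 1 :> R by rewrite exprn_ile1// invf_le1// ler1n.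
  have Eq : 2 `^ gamma / 4 * ((2 * enorm h) ^+ 2 * ((2 `^ gamma)^-1 * ker h)) =
      enorm h ^+ 2 * ker h by field; rewrite gt_eqF.
  set d := 2^-1 ^+ m in dm *; set E := enorm h in Eq *.
  have [hE|hE] := ltP E 1; last first.
    rewrite !andbF; have -> : (2 * E < 1) = false by apply/negbTE; rewrite -leNgt; lra.
    by rewrite andbF mulr0 addr0.
  rewrite !andbT; have [hE2|hE2] := leP (2^-1) E.
    have -> : 2^-1 * d <= E by apply: le_trans hE2; rewrite ler_piMr// ltW.
    have -> : (2 * E < 1) = false by apply/negbTE; rewrite -leNgt; lra.
    by rewrite andbF mulr0 addr0.
  have -> : 2 * E < 1 by lra.
  have -> : (2^-1 * d <= E) = (d <= 2 * E) by rewrite mulrC ler_pdivrMr// mulrC.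
  by rewrite andbT add0r; case: ifP => _; rewrite ?mulr0.
- by rewrite pnatr_eq0.
- apply: Intg_annulus => //.
    apply: measurable_funM; last exact: measurable_ker.
    by apply: measurable_funX; exact: measurable_enorm.
  move=> h /andP[_]; rewrite half2 => hE.
  rewrite mulr_ge0 ?ker_ge0 ?sqr_ge0//= ler_piMl ?ker_ge0//.
  by rewrite exprn_ile1 ?enorm_ge0// ltW.
- by move=> h; rewrite /g; case: ifP => // _; rewrite mulr_ge0 ?ker_ge0 ?sqr_ge0.
- by rewrite divr_ge0// ltW.
- by rewrite /gamma powR_critical// (@ger0_norm _ 2)//; field.
- rewrite ltr_pdivrMr// mul1r.
  have -> : 4 = 2 `^ (2 * s) * 2 `^ (2 - 2 * s) :> R.
    rewrite -powRD ?pnatr_eq0 ?implybT// addrC subrK.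
    by rewrite (powR_mulrn 2 (ler0n R 2)); ring.
  rewrite ltr_pMr ?powR_gt0//; apply: powR_gt1; first by rewrite ltr1n.
  by move: s01 => /andP[? ?]; lra.
move=> h; apply: cvg_near_cst; have [hE|hE] := ltP 0 (enorm h); last first.
  apply: nearW => m; rewrite /F; case: ifPn => // /andP[+ _].
  by move=> /le_trans /(_ hE); rewrite leNgt exprn_gt0.
have := near_infty_natSinv_expn_lt (PosNum hE); apply: filterS => m /= hm.
by rewrite /F exprVn -div1r ltW.
Qed.

(** Same argument outwards, with h -> h / 2; the ratio 2^(-2s) is below 1 because s > 0. *)
Lemma Intg_ker_infinity : Intg (fun h : V => if 1 <= enorm h then ker h else 0).
Proof.
have g0 := gamma_gt0.
pose g (h : V) := if 1 <= enorm h < 2 * 1 then ker h else 0.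
pose F m (h : V) := if 1 <= enorm h < 2 ^+ m then ker h else 0.
have p0 : 0 < 2 `^ gamma :> R by rewrite powR_gt0.
have half0 : 0 < 2^-1 :> R by rewrite invr_gt0.
apply: (@Intg_self_similar F _ g ((2 `^ gamma)^-1) 2^-1 ((2 `^ (2 * s))^-1)).
- by move=> h; rewrite /F expr0; case: ifPn => // /andP[h1]; rewrite ltNge h1.
- move=> m h; rewrite /F /g enormZ (@gtr0_norm _ 2^-1)// kerZ// -/gamma mulr1 exprS.
  have dm : 1 <= 2 ^+ m :> R by rewrite exprn_ege1// ler1n.
  have Eq : (2 `^ gamma)^-1 * ((2^-1 `^ gamma)^-1 * ker h) = ker h.
    rewrite mulrA -invfM -powRM ?ltW// divff// powR1 invr1 mul1r//.
  set d := 2 ^+ m in dm *; set E := enorm h in Eq *.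
  have [hE|hE] := leP 1 E; last first.
    have -> : (1 <= 2^-1 * E) = false by apply/negbTE; rewrite -ltNge; lra.
    by rewrite mulr0 addr0.
  have [hE2|hE2] := ltP E 2.
    have -> : E < 2 * d by lra.
    have -> : (1 <= 2^-1 * E) = false by apply/negbTE; rewrite -ltNge; lra.
    by rewrite mulr0 addr0.
  have -> : 1 <= 2^-1 * E by lra.
  have -> : (E < 2 * d) = (2^-1 * E < d) by rewrite (mulrC _ E) ltr_pdivrMr// mulrC.
  by rewrite add0r; case: ifP => _; rewrite ?mulr0.
- by rewrite gt_eqF.
- apply: Intg_annulus => //; first exact: measurable_ker.
  by move=> h _; rewrite ker_ge0 lexx.
- by move=> h; rewrite /g; case: ifP => // _; rewrite ker_ge0.
- by rewrite invr_ge0 ltW.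
- by rewrite /gamma powR_critical// (@gtr0_norm _ 2^-1)// invfM exprVn mulrC.
- rewrite invf_lt1 ?powR_gt0//; apply: powR_gt1; first by rewrite ltr1n.
  by move: s01 => /andP[? ?]; lra.
move=> h; apply: cvg_near_cst; have [hE|hE] := leP 1 (enorm h); last first.
  by apply: nearW => m; rewrite /F leNgt hE.
have E0 : 0 < (enorm h)^-1 by rewrite invr_gt0; lra.
have := near_infty_natSinv_expn_lt (PosNum E0); apply: filterS => m /= hm.
rewrite /F hE /=; move: hm; rewrite div1r ltf_pV2 ?posrE ?exprn_gt0//; last lra.
by move=> ->.
Qed.

(** The dominating function for fractional integrals: bounded functions have bounded second
    differences, and these are O(|h|^2) where the function is C^2. *)
Definition ker_weight (h : V) : R := Num.min (enorm h ^+ 2) 1 * ker h.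

Lemma ker_weight_ge0 h : 0 <= ker_weight h.
Proof. by rewrite mulr_ge0 ?ker_ge0// le_min sqr_ge0 ler01. Qed.

Lemma Intg_ker_weight : Intg ker_weight.
Proof.
apply: (le_Intg _ _ (IntgD Intg_ker_origin Intg_ker_infinity)).
  apply: measurable_funM; last exact: measurable_ker.
  apply: measurable_minr; last exact: measurable_cst.
  by apply: measurable_funX; exact: measurable_enorm.
move=> h; rewrite ger0_norm ?ker_weight_ge0// /ker_weight.
have [hE|hE] := leP 1 (enorm h).
  by rewrite andbF add0r min_r ?mul1r// exprn_ege1.
have E1 : enorm h ^+ 2 <= 1 by rewrite exprn_ile1 ?enorm_ge0// ltW.
rewrite andbT addr0 min_l//; have [h0|h0] := ltP 0 (enorm h); first by [].
have -> : enorm h = 0 by apply/eqP; rewrite eq_le h0 enorm_ge0.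
by rewrite expr0n mul0r.
Qed.

End kernel.

(** * Taylor estimates along the coordinate axes *)

Section taylor.
Context {R : realType}.
Implicit Types (a b M t : R).

(** The mean value theorem for g minus the polynomial a x + b x^2 / 2. With b = 0 it is a
    first-order estimate; the general case serves second differences. *)
Lemma mean_value_quadratic (g g' : R -> R) a b M t : 0 <= t ->
  (forall x, 0 <= x <= t -> is_derive x 1 g (g' x)) ->
  (forall x, 0 <= x <= t -> `|g' x - a - x * b| <= M) ->
  `|g t - g 0 - t * a - t ^+ 2 / 2 * b| <= M * t.
Proof.
rewrite le_eqVlt => /orP[/eqP <- _ _|t0 dg gM].
  by rewrite subrr mul0r expr0n /= !mul0r !subr0 normr0 mulr0.
pose q : R -> R := a \*: id + (b / 2) \*: (id ^+ 2).
pose psi := g - q.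
have dpsi x : 0 <= x <= t -> is_derive x 1 psi (g' x - a - x * b).
  move=> x0t; have dgx := dg x x0t.
  apply: is_derive_eq; rewrite /= expr1 -addrA -opprD; congr (_ - _).
  by rewrite /GRing.scale /=; field.
have [||c ct psiE] := @MVT R psi (fun x => g' x - a - x * b) 0 t t0.
- by move=> x; rewrite in_itv /= => /andP[? ?]; apply: dpsi; rewrite !ltW.
- apply: derivable_within_continuous => x; rewrite in_itv /= => xt.
  by have [] := dpsi x xt.
have -> : g t - g 0 - t * a - t ^+ 2 / 2 * b = (g' c - a - c * b) * t.
  transitivity (psi t - psi 0); last by rewrite -[in RHS](subr0 t); exact: psiE.
  change (g t - g 0 - t * a - t ^+ 2 / 2 * b = g t - (a * t + b / 2 * (t * t)) -
    (g 0 - (a * 0 + b / 2 * (0 * 0)))); by field.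
rewrite normrM (gtr0_norm t0) ler_pM2r//; apply: gM.
by move: ct; rewrite in_itv /= => /andP[? ?]; rewrite !ltW.
Qed.

Variable n : nat.
Notation V := 'rV[R]_n.
Implicit Types (f : V -> R) (x y h : V) (i : 'I_n).
Let e i : V := delta_mx 0 i.

Lemma norm_delta_le i : `|e i| <= 1.
Proof.
by apply: norm_rV_le => // j; rewrite mxE eqxx /=; case: (_ == _); rewrite ?normr1 ?normr0.
Qed.

Lemma is_derive_line f x i t : derivable f (x + t *: e i) (e i) ->
  is_derive t 1 (fun r => f (x + r *: e i)) ('D_(e i) f (x + t *: e i)).
Proof.
move=> df.
have E : (fun h : R => h^-1 *: ((f \o shift (x + t *: e i)) (h *: e i) - f (x + t *: e i))) =
    (fun h : R => h^-1 *: (((fun r => f (x + r *: e i)) \o shift t) (h *: 1) - f (x + t *: e i))).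
  apply/funext => h /=; congr (_ *: (f _ - _)).
  have -> : h *: (1 : R) = h by exact: mulr1.
  by rewrite scalerDl addrCA.
by split; [move: df; rewrite /derivable E|rewrite /derive -E].
Qed.

Lemma mean_value_coord f x i a M t :
  (forall r, `|r| <= `|t| -> derivable f (x + r *: e i) (e i)) ->
  (forall r, `|r| <= `|t| -> `|'D_(e i) f (x + r *: e i) - a| <= M) ->
  `|f (x + t *: e i) - f x - t * a| <= M * `|t|.
Proof.
move=> df fM; have [t0|t0] := leP 0 t.
  have := @mean_value_quadratic (fun r => f (x + r *: e i))
    (fun r => 'D_(e i) f (x + r *: e i)) a 0 M t t0.
  rewrite mulr0 subr0 scale0r addr0 (ger0_norm t0); apply => r /andP[r0 rt].
    by apply: is_derive_line; apply: df; rewrite !ger0_norm.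
  by rewrite mulr0 subr0; apply: fM; rewrite !ger0_norm.
have t0' : 0 <= - t by lra.
have := @mean_value_quadratic (fun r => f ((x + t *: e i) + r *: e i))
    (fun r => 'D_(e i) f ((x + t *: e i) + r *: e i)) a 0 M (- t) t0'.
rewrite mulr0 subr0 scale0r addr0 (ltr0_norm t0) scaleNr addrK.
have -> : f x - f (x + t *: e i) - - t * a = - (f (x + t *: e i) - f x - t * a) by ring.
rewrite normrN; apply => r /andP[r0 rt].
  apply: is_derive_line; rewrite -addrA -scalerDl; apply: df.
  by rewrite (ltr0_norm t0) ler_norml; apply/andP; split; lra.
rewrite mulr0 subr0 -addrA -scalerDl; apply: fM.
by rewrite (ltr0_norm t0) ler_norml; apply/andP; split; lra.
Qed.

Lemma partial_sum_coord h (s : seq 'I_n) j : uniq s ->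
  (\sum_(i <- s) h 0 i *: e i) 0 j = if j \in s then h 0 j else 0.
Proof.
elim: s => [|i s IH]; first by rewrite big_nil mxE.
rewrite /= => /andP[is_ us]; rewrite big_cons !mxE eqxx /= IH// inE.
have [->|ji] := eqVneq j i; first by rewrite (negbTE is_) mulr1 addr0.
by rewrite mulr0 add0r.
Qed.

(* The difference f (x + h) - f x is telescoped along the coordinate axes. *)
Lemma mean_value_box f x h (a : 'I_n -> R) M : 0 <= M ->
  (forall y i, `|y - x| <= `|h| -> derivable f y (e i)) ->
  (forall y i, `|y - x| <= `|h| -> `|'D_(e i) f y - a i| <= M) ->
  `|f (x + h) - f x - \sum_i h 0 i * a i| <= M * (n%:R * `|h|).
Proof.
move=> M0 df fM.
suff main (s : seq 'I_n) : uniq s ->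
    `|f (x + \sum_(i <- s) h 0 i *: e i) - f x - \sum_(i <- s) h 0 i * a i| <=
    M * \sum_(i <- s) `|h 0 i|.
  have := main _ (index_enum_uniq _); rewrite -row_sum_delta => /le_trans; apply.
  rewrite ler_wpM2l// (le_trans (ler_sum _ (fun i _ => coord_le_norm h i)))//.
  by rewrite sumr_const card_ord mulr_natl.
elim: s => [|i s IH] us; first by rewrite !big_nil addr0 subrr subr0 normr0 mulr0.
have /andP[is_ us'] := us; rewrite !big_cons.
set S := \sum_(j <- s) h 0 j *: e j.
have inbox r : `|r| <= `|h 0 i| -> `|(x + S + r *: e i) - x| <= `|h|.
  move=> rh; rewrite addrAC (addrAC x) subrr add0r.
  apply: norm_rV_le => // j; rewrite mxE partial_sum_coord// !mxE eqxx /=.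
  have [->|ji] := eqVneq j i.
    by rewrite (negbTE is_) add0r mulr1 (le_trans rh)// coord_le_norm.
  rewrite mulr0 addr0; case: ifP => _; last by rewrite normr0.
  exact: coord_le_norm.
have := @mean_value_coord f (x + S) i (a i) M (h 0 i)
  (fun r rh => df _ i (inbox r rh)) (fun r rh => fM _ i (inbox r rh)).
rewrite -(addrA x S) (addrC S) => h1.
rewrite mulrDr (le_trans _ (lerD h1 (IH us')))//.
rewrite (le_trans _ (ler_normD _ _))// le_eqVlt; apply/orP; left; apply/eqP.
by congr (`|_|); rewrite -/S; ring.
Qed.

(** [mean_value_box] for each first partial derivative shows that it varies by at most C n |h| over
    the box; [mean_value_box] for f then gives the second-order error. *)
Lemma taylor_box f x h C : 0 <= C ->
  (forall y i, `|y - x| <= `|h| -> derivable f y (e i)) ->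
  (forall y i j, `|y - x| <= `|h| -> derivable ('D_(e i) f) y (e j)) ->
  (forall y i j, `|y - x| <= `|h| -> `|'D_(e j) ('D_(e i) f) y| <= C) ->
  `|f (x + h) - f x - \sum_i h 0 i * 'D_(e i) f x| <= C * (n%:R * `|h|) ^+ 2.
Proof.
move=> C0 df ddf dfC; set N := n%:R * `|h|.
have N0 : 0 <= N by rewrite mulr_ge0.
rewrite expr2 mulrA; apply: mean_value_box => //; first exact: mulr_ge0.
move=> y i yx; have := @mean_value_box ('D_(e i) f) x (y - x) (fun=> 0) C C0.
rewrite [\sum_(_ < _) _]big1 => [|j _]; last by rewrite mulr0.
rewrite subr0 (addrC x) subrK => /(_ _ _)/le_trans; apply.
- by move=> z j zy; apply: ddf; exact: le_trans zy yx.
- by move=> z j zy; rewrite subr0; apply: dfC; exact: le_trans zy yx.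
by rewrite ler_wpM2l// ler_wpM2l.
Qed.

End taylor.

(** * Second differences of C^2 functions *)

Section C2_functions.
Context {R : realType} (n : nat).
Notation V := 'rV[R]_n.
Implicit Types (u f : V -> R) (x y h : V) (Om K : set V) (t : R).
Notation e := (fun i : 'I_n => delta_mx 0 i : V).

Lemma le_sum2 (a : 'I_n -> 'I_n -> R) i j : (forall i j, 0 <= a i j) ->
  a i j <= \sum_i \sum_j a i j.
Proof.
move=> a0; rewrite (bigD1 i)//= (bigD1 j)//= -addrA lerDl.
by rewrite addr_ge0// sumr_ge0// => k _; rewrite sumr_ge0.
Qed.

Lemma C2_local_bound Om f x : open Om -> C2 Om f -> Om x ->
  exists C, 0 <= C /\ \forall y \near x, Om y /\
    forall i j, `|'D_(e j) ('D_(e i) f) y| <= C.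
Proof.
move=> oOm fC2 Ox.
have [_ _ dd] := fC2 x Ox.
pose C := 1 + \sum_i \sum_j `|'D_(e j) ('D_(e i) f) x|.
have Cij i j : `|'D_(e j) ('D_(e i) f) x| < C.
  apply: (@le_lt_trans _ _ (\sum_i \sum_j `|'D_(e j) ('D_(e i) f) x|)).
    exact: (@le_sum2 (fun i j => `|'D_(e j) ('D_(e i) f) x|)).
  by rewrite /C ltrDr.
exists C; split.
  by rewrite addr_ge0//; apply: sumr_ge0 => i _; apply: sumr_ge0.
have hO : \forall y \near x, Om y by exact: open_nbhs_nbhs.
suff hD : \forall y \near x, forall i j, `|'D_(e j) ('D_(e i) f) y| <= C.
  by move: hO hD; apply: filterS2 => y; split.
apply: (@filter_forall V 'I_n
  (fun i y => forall j, `|'D_(e j) ('D_(e i) f) y| <= C) (nbhs x)) => i.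
apply: (@filter_forall V 'I_n (fun j y => `|'D_(e j) ('D_(e i) f) y| <= C) (nbhs x)) => j.
have [_ cij] := dd i j.
have cn : (fun y => `|'D_(e j) ('D_(e i) f) y|) @ x --> `|'D_(e j) ('D_(e i) f) x|.
  exact: (cvg_norm cij).
near=> y; apply/ltW; near: y.
exact: (cvgr_lt _ cn _ (Cij i j)).
Unshelve. all: by end_near. Qed.

Lemma C2_compact_bound Om K f : open Om -> C2 Om f -> compact K -> K `<=` Om ->
  exists r C, [/\ 0 < r, 0 <= C & forall x, K x -> forall y, `|y - x| <= r ->
    Om y /\ forall i j, `|'D_(e j) ('D_(e i) f) y| <= C].
Proof.
move=> oOm fC2 cK KOm.
(* A single parameter r is both the radius and the inverse of the bound, so that uniformity over K
   is one application of compactness to the filter of r -> 0+. *)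
pose P (r : R) x := forall y, `|y - x| <= r ->
    Om y /\ forall i j, `|'D_(e j) ('D_(e i) f) y| <= r^-1.
have ncov := (compact_near_coveringP K).1 cK R (0^'+) P _.
have [|r /= r0 rP] := ncov _ _.
  move=> x Kx; have [C [C0 /nbhs_ballP[d /= d0 dP]]] := C2_local_bound oOm fC2 (KOm _ Kx).
  have d20 : 0 < d / 2 by rewrite divr_gt0.
  have C1 : 0 < (C + 1)^-1 by rewrite invr_gt0; lra.
  exists (ball x (d / 2), [set r | 0 < r /\ r < Num.min (d / 2) (C + 1)^-1]) => /=.
    split; first exact: nbhsx_ballx.
    near=> r; split; near: r; first exact: nbhs_right_gt.
    by apply: nbhs_right_lt; rewrite lt_min d20 C1.
  move=> [x' r] /= [xx' [r0 +]] y yx'; rewrite lt_min => /andP[rd rC].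
  have [|Oy yC] := dP y.
    move: xx'; rewrite -!ball_normE /= => xx'.
    rewrite -(subrK x' x) -addrA (le_lt_trans (ler_normD _ _))//.
    by rewrite (distrC x' y); lra.
  split => // i j; rewrite (le_trans (yC i j))//.
  rewrite -[C]invrK; case: (ltgtP C 0) => [|C0'|->]; first lra.
    rewrite lef_pV2 ?posrE ?invr_gt0//; apply/ltW/(lt_trans rC).
    by rewrite ltf_pV2 ?posrE//; lra.
  by rewrite !invr0 invr_ge0 ltW.
have r20 : 0 < r / 2 by rewrite divr_gt0.
exists (r / 2), (r / 2)^-1; split => //; first by rewrite invr_ge0 ltW.
move=> x Kx; apply: (rP (r / 2)) => //=.
by rewrite sub0r normrN gtr0_norm//; lra.
Unshelve. all: by end_near. Qed.

(** The sign is that of minus the second derivative, to match - laplacian and the fractional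
    Laplacian. *)
Definition sd u h x : R := 2 * u x - u (x + h) - u (x - h).

Lemma sdN u h x : sd u (- h) x = sd u h x.
Proof. by rewrite /sd opprK; ring. Qed.

(** For small h the first-order Taylor terms at h and - h cancel, leaving O(|h|^2); for larger h the
    sup bound of u suffices. *)
Lemma sd_bound Om K u : open Om -> C2 Om u -> compact K -> K `<=` Om -> Cc u ->
  exists C, 0 <= C /\ forall x, K x -> forall h,
    `|sd u h x| <= C * Num.min (enorm h ^+ 2) 1.
Proof.
move=> oOm uC2 cK KOm Cu.
have [r [C [r0 C0 rC]]] := C2_compact_bound oOm uC2 cK KOm.
have [B uB] := Cc_bounded Cu.
have B0 : 0 <= B := le_trans (normr_ge0 _) (uB 0).
have ri : 0 < (r ^+ 2)^-1 by rewrite invr_gt0 exprn_gt0.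
(* The three terms serve the Taylor range |h| <= r, the range where the minimum is 1, and the
   intermediate range |h| > r with [enorm h] at most 1. *)
pose D := 2 * C * n%:R ^+ 2 + 4 * B + 4 * B * (r ^+ 2)^-1.
have CN0 : 0 <= 2 * C * n%:R ^+ 2 by rewrite !mulr_ge0.
have Br0 : 0 <= 4 * B * (r ^+ 2)^-1 by rewrite !mulr_ge0// ltW.
exists D; split; first by rewrite /D; lra.
move=> x Kx h.
have D4 : `|sd u h x| <= 4 * B.
  have := uB x; have := uB (x + h); have := uB (x - h); rewrite /sd !ler_norml.
  by move=> /andP[? ?] /andP[? ?] /andP[? ?]; apply/andP; split; lra.
have h2 : `|h| ^+ 2 <= enorm h ^+ 2.
  by rewrite lerXn2r ?nnegrE ?enorm_ge0// norm_le_enorm.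
have h20 : 0 <= `|h| ^+ 2 by rewrite sqr_ge0.
have [hr|hr] := leP `|h| r; last first.
  rewrite minEle; case: ifP => h1; last by rewrite mulr1 /D; lra.
  have : 4 * B <= 4 * B * (r ^+ 2)^-1 * enorm h ^+ 2.
    rewrite -mulrA; apply: ler_peMr; first lra.
    rewrite mulrC ler_pdivlMr ?exprn_gt0// mul1r (le_trans _ h2)//.
    by apply: lerXn2r; rewrite ?nnegrE ?(ltW r0)// ltW.
  rewrite /D; have : 0 <= enorm h ^+ 2 by rewrite sqr_ge0.
  by move=> ? ?; apply: (le_trans D4); nra.
have Tay k : `|k| <= `|h| -> `|u (x + k) - u x - \sum_i k 0 i * 'D_(e i) u x| <=
    C * (n%:R * `|k|) ^+ 2.
  move=> kh; have box y : `|y - x| <= `|k| -> `|y - x| <= r.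
    by move=> /le_trans; apply; exact: le_trans kh hr.
  apply: taylor_box => //.
  - by move=> y i /box /(rC x Kx) [/uC2[_ + _] _] => /(_ i)[].
  - by move=> y i j /box /(rC x Kx) [/uC2[_ _ +] _] => /(_ i j)[].
  - by move=> y i j /box /(rC x Kx) [_]; exact.
have S2 : `|sd u h x| <= 2 * C * n%:R ^+ 2 * `|h| ^+ 2.
  have := Tay h (lexx _); have := Tay (- h); rewrite normrN => /(_ (lexx _)).
  rewrite (eq_bigr (fun i => - (h 0 i * 'D_(e i) u x))); last first.
    by move=> i _; rewrite mxE mulNr.
  rewrite sumrN; set S := \sum_i _; rewrite exprMn /sd !ler_norml.
  by move=> /andP[? ?] /andP[? ?]; apply/andP; split; lra.
rewrite minEle; case: ifP => h1.
  by apply: (le_trans S2); rewrite /D; nra.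
by rewrite mulr1; apply: (le_trans D4); rewrite /D; lra.
Qed.

(** Second-order expansions on both sides of x along the axis, with error controlled by the
    oscillation of the pure second derivative; the first-order terms cancel. *)
Lemma sd_cvg Om u x i (t_ : nat -> R) : open Om -> C2 Om u -> Om x ->
  (forall m, 0 < t_ m) -> t_ @ \oo --> 0 ->
  (fun m => sd u (t_ m *: e i) x / t_ m ^+ 2) @ \oo --> - 'D_(e i) ('D_(e i) u) x.
Proof.
move=> oOm uC2 Ox t0 tcv.
have [_ _ /(_ i i)[_ cD]] := uC2 x Ox.
have {cD} : 'D_(e i) ('D_(e i) u) y @[y --> x] --> 'D_(e i) ('D_(e i) u) x by exact: cD.
move: ('D_(e i) ('D_(e i) u) x : R) => b cD.
apply/cvgrPdist_le => w w0.
have w20 : 0 < w / 2 by rewrite divr_gt0.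
have : \forall y \near x, Om y /\ `|'D_(e i) ('D_(e i) u) y - b| <= w / 2.
  have hO : \forall y \near x, Om y by exact: open_nbhs_nbhs.
  move: cD => /cvgrPdist_le/(_ _ w20); move: hO; apply: filterS2 => y Oy yb.
  by split; [exact: Oy|rewrite distrC; exact: yb].
move=> /nbhs_ballP[d /= d0 dP].
have box t r : `|t| < d -> `|r| <= `|t| -> ball x d (x + r *: e i).
  move=> td rt; rewrite -ball_normE /= opprD addrA subrr sub0r normrN normrZ.
  by rewrite (le_lt_trans _ td)// (le_trans _ rt)// ler_piMr// norm_delta_le.
pose a := 'D_(e i) u x.
have D1 t : `|t| < d -> `|'D_(e i) u (x + t *: e i) - a - t * b| <= w / 2 * `|t|.
  move=> td; apply: (@mean_value_coord R n ('D_(e i) u) x i b (w / 2) t) => r rt.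
    have [Oy _] := dP _ (box t r td rt).
    by have [_ _ dd] := uC2 _ Oy; have [] := dd i i.
  by have [_] := dP _ (box t r td rt).
have main t : 0 < t < d ->
    `|u (x + t *: e i) - u x - t * a - t ^+ 2 / 2 * b| <= w / 2 * t * t /\
    `|u (x - t *: e i) - u x + t * a - t ^+ 2 / 2 * b| <= w / 2 * t * t.
  move=> /andP[t0' td].
  have in_d (r : R) : 0 <= r <= t -> `|r| < d /\ `|- r| < d.
    by move=> /andP[? ?]; rewrite normrN ger0_norm//; split; lra.
  have dline (r : R) : `|r| < d ->
      is_derive r 1 (fun r0 => u (x + r0 *: e i)) ('D_(e i) u (x + r *: e i)).
    move=> rd; apply: is_derive_line.
    have [Oy _] := dP _ (box r r rd (lexx _)).
    by have [_ dd _] := uC2 _ Oy; have [] := dd i.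
  split.
    have := @mean_value_quadratic R (fun r => u (x + r *: e i))
      (fun r => 'D_(e i) u (x + r *: e i)) a b (w / 2 * t) t (ltW t0').
    rewrite scale0r addr0; apply => r rt; have [rd _] := in_d r rt.
      exact: dline.
    rewrite (le_trans (D1 r rd))// ler_pM2l//.
    by case/andP: rt => *; rewrite ger0_norm.
  have -> : u (x - t *: e i) - u x + t * a - t ^+ 2 / 2 * b =
      u (x + (- t) *: e i) - u (x + (- 0) *: e i) - t * (- a) - t ^+ 2 / 2 * b.
    by rewrite oppr0 scale0r addr0 scaleNr; ring.
  apply: (@mean_value_quadratic R (fun r => u (x + (- r) *: e i))
      (fun r => - 'D_(e i) u (x + (- r) *: e i)) (- a) b (w / 2 * t) t (ltW t0')) => r rt;
    have [_ rd] := in_d r rt.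
    have dN : is_derive (r : R) (1 : R) (-%R : R -> R) (-1 : R) by exact: is_deriveNid.
    have := is_derive1_comp (dline _ rd) dN.
    by rewrite mulrN1 => ?; exact: is_derive_eq.
  have -> : - 'D_(e i) u (x + (- r) *: e i) - - a - r * b =
      - ('D_(e i) u (x + (- r) *: e i) - a - (- r) * b) by ring.
  rewrite normrN.
  rewrite (le_trans (D1 _ rd))// ler_pM2l// normrN.
  by case/andP: rt => *; rewrite ger0_norm.
near=> m.
have tm : 0 < t_ m < d.
  by rewrite t0 /=; near: m; exact: (cvgr_lt _ tcv _ d0).
have [] := main _ tm; move: (t_ m) tm => t /andP[t0' _].
have t20 : 0 < t ^+ 2 by rewrite exprn_gt0.
move=> /ler_normlP[h1 h2] /ler_normlP[h3 h4].
have -> : - b - sd u (t *: e i) x / t ^+ 2 = - (sd u (t *: e i) x + t ^+ 2 * b) / t ^+ 2.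
  by field; rewrite gt_eqF.
rewrite normrM normrN normfV (gtr0_norm t20) ler_pdivrMr// /sd ler_norml.
by apply/andP; split; lra.
Unshelve. all: by end_near. Qed.

End C2_functions.

(** * From the pointwise equation to bilinear forms *)

Section weak_formulation.
Context {R : realType} (n : nat) (s : R).
Hypothesis s01 : 0 < s < 1.
Notation V := 'rV[R]_n.
Implicit Types (u v : V -> R) (x y h : V) (Om K : set V) (t : R).
Notation e := (fun i : 'I_n => delta_mx 0 i : V).

(** A default value: the inverse of 0 is 0, so the kernel vanishes at the origin and the diagonal
    needs no separate treatment. *)
Lemma ker_enorm0 h : enorm h <= 0 -> ker s h = 0.
Proof.
move=> h0; have hE : enorm h = 0 by apply/eqP; rewrite eq_le h0 enorm_ge0.
rewrite /ker hE powR0 ?invr0//; apply/eqP => g0.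
have : 0 < n%:R + 2 * s.
  by move: s01 => /andP[? ?]; rewrite ltr_wpDl// mulr_gt0.
by rewrite g0 ltxx.
Qed.

Lemma measurable_cutoff_ker t (f : V -> R) : measurable_fun setT f ->
  measurable_fun setT (fun h => if t <= enorm h then ker s h * f h else 0).
Proof.
move=> mf; apply: measurable_fun_ifT.
- by apply: measurable_fun_ler; [exact: measurable_cst|exact: measurable_enorm].
- by apply: measurable_funM => //; exact: measurable_ker.
- exact: measurable_cst.
Qed.

Lemma Intg_cutoff_ker t (f : V -> R) B : 0 < t -> measurable_fun setT f ->
  (forall h, `|f h| <= B) ->
  Intg (fun h => if t <= enorm h then ker s h * f h else 0).
Proof.
move=> t0 mf fB; have B0 : 0 <= B := le_trans (normr_ge0 _) (fB 0).
have m0 : 0 < Num.min (t ^+ 2) 1 by rewrite lt_min exprn_gt0// ltr01.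
have wi := IntgZ (B / Num.min (t ^+ 2) 1) (@Intg_ker_weight R n s s01).
apply: le_Intg wi; first exact: measurable_cutoff_ker.
move=> h; have w0 := ker_weight_ge0 s h.
have w0' : 0 <= B / Num.min (t ^+ 2) 1 * ker_weight s h.
  by rewrite mulr_ge0// divr_ge0// ltW.
case: ifPn => [th|_]; last by rewrite normr0.
rewrite normrM (ger0_norm (ker_ge0 _ _)) /ker_weight mulrA mulrC ler_wpM2r ?ker_ge0//.
rewrite mulrAC ler_pdivlMr// (le_trans (y := B * Num.min (t ^+ 2) 1))//.
  by rewrite ler_wpM2r// ltW.
rewrite ler_wpM2l// le_min !ge_min lexx orbT andbT; apply/orP; left.
  by rewrite lerXn2r ?nnegrE ?enorm_ge0 ?(ltW t0).
Qed.

Lemma measurable_sd u x : Cc u -> measurable_fun setT (fun h => sd u h x).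
Proof.
move=> Cu; have mu := Cc_measurable Cu.
apply: (@measurable_funB _ _ _ _ (fun h => 2 * u x - u (x + h)) (fun h => u (x - h))).
  apply: (@measurable_funB _ _ _ _ (fun h => 2 * u x) (fun h => u (x + h))) => //.
  by have := measurable_affine_comp x 1 mu; under eq_fun do rewrite scale1r.
by have := measurable_affine_comp x (- 1) mu; under eq_fun do rewrite scaleN1r.
Qed.

(** Averaging the substitutions y = x + h and y = x - h turns the first difference into half a
    second difference. *)
Lemma punctured_integral u x t : 0 < t -> Cc u ->
  (\int[lebesgue_rV n]_(y in [set y | t <= enorm (x - y)])
    ((u x - u y) / enorm (x - y) `^ (n%:R + 2 * s)) =
  2^-1 * Int (fun h => if (t <= enorm h)%R then (ker s h * sd u h x)%R else 0%R))%R.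
Proof.
move=> t0 Cu; have [B uB] := Cc_bounded Cu.
have mu := Cc_measurable Cu.
pose H h := if t <= enorm h then ker s h * (u x - u (x + h)) else 0.
have Hi : Intg H.
  apply: (@Intg_cutoff_ker t (fun h => u x - u (x + h)) (B + B)) => //.
    apply: (@measurable_funB _ _ _ _ (fun h => u x) (fun h => u (x + h))) => //.
    by have := measurable_affine_comp x 1 mu; under eq_fun do rewrite scale1r.
  by move=> h; rewrite (le_trans (ler_normB _ _))// lerD.
have N1 : -1 != 0 :> R by rewrite oppr_eq0 oner_eq0.
have HNi : Intg (fun h => H (- h)).
  have := Intg_affine 0 N1 Hi.
  by under eq_fun do rewrite add0r scaleN1r.
have HN : Int (fun h => H (- h)) = Int H.
  rewrite (Int_affine 0 N1 Hi) normrN1 expr1n mul1r.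
  by apply: eq_Int => h; rewrite add0r scaleN1r.
rewrite Rintegral_mkcond.
transitivity (Int (fun y => H (y - x))).
  rewrite IntE /Rintegral; congr fine; apply: eq_integral => y _; congr EFin.
  have E1 : enorm (y - x) = enorm (x - y) by rewrite -opprB enormN.
  have E3 : x + (y - x) = y by rewrite addrC subrK.
  rewrite /H E1 E3 /ker E1 patchE.
  have -> : (y \in [set y0 | t <= enorm (x - y0)]) = (t <= enorm (x - y)) by apply/idP/idP; rewrite inE.
  by case: ifP => _; [exact: mulrC|exact: erefl].
rewrite (Int_shift (- x) Hi).
rewrite (_ : Int (fun h => if t <= enorm h then ker s h * sd u h x else 0) =
    Int H + Int (fun h => H (- h))); last first.
  rewrite -IntD//; apply: eq_Int => h; rewrite /H enormN kerN.
  by case: ifP => _; rewrite ?addr0// /sd; ring.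
by rewrite HN; field.
Qed.

(** Once symmetrized, the integrand is dominated by a multiple of [ker_weight], and the principal
    value is a dominated limit. *)
Lemma frac_laplacian_sd Om u x : open Om -> C2 Om u -> Om x -> Cc u ->
  Intg (fun h => ker s h * sd u h x) /\
  frac_laplacian s u x = c_frac n s * (2^-1 * Int (fun h => ker s h * sd u h x)).
Proof.
move=> oOm uC2 Ox Cu.
have [C [C0 sdC]] := sd_bound oOm uC2 (@compact_set1 _ x) (fun y yx => eq_ind_r Om Ox yx) Cu.
have wi := IntgZ C (@Intg_ker_weight R n s s01).
have bound h : `|ker s h * sd u h x| <= C * ker_weight s h.
  rewrite normrM (ger0_norm (ker_ge0 _ _)) /ker_weight mulrA mulrC.
  by rewrite ler_wpM2r ?ker_ge0//; exact: sdC.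
have ms : measurable_fun setT (fun h => ker s h * sd u h x).
  by apply: measurable_funM; [exact: measurable_ker|exact: measurable_sd].
split; first exact: le_Intg ms bound wi.
congr (_ * _); apply/cvg_lim => //; apply/cvg_at_rightP => t_ [t0 tcv].
under eq_fun do rewrite punctured_integral//.
apply: cvgM; first exact: cvg_cst.
apply: (dominated_Int _ wi _ _).2.
- by move=> m; apply: measurable_cutoff_ker; exact: measurable_sd.
- move=> h; have [h0|h0] := ltP 0 (enorm h); last first.
    apply: cvg_near_cst; apply: nearW => m; rewrite ker_enorm0// mul0r.
    by case: ifP.
  apply: cvg_near_cst; near=> m; rewrite ifT//; apply/ltW; near: m.
  by have := cvgr_lt _ tcv; apply; exact: h0.
- move=> m h; case: ifP => _; first exact: bound.
  by rewrite normr0 mulr_ge0// ker_weight_ge0.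
Unshelve. all: by end_near. Qed.

Lemma Cc_mul_sd u v h : Cc u -> Cc v -> Cc (fun x => v x * sd u h x).
Proof.
move=> Cu Cv; apply: CcM => //; apply: Cc_continuous; apply: CcB; last exact: Cc_shift.
by apply: CcB; [exact: CcZ|exact: Cc_shift].
Qed.

(** Stands for the integral of grad u . grad v at scale t, and makes sense without any control of
    the gradient at the boundary. *)
Definition Dform u v t : R := \sum_(i < n) Lam u v (t *: e i) / t ^+ 2.

(** The Gagliardo double integral without its constant, with the increment h integrated last. *)
Definition Gform u v : R := Int (fun h => ker s h * Lam u v h).

Lemma enorm_delta i : enorm (e i) = 1.
Proof.
apply/eqP; rewrite -(@eqrXn2 _ 2) ?enorm_ge0 ?ler01// enorm_sqr expr1n.
rewrite (bigD1 i)//= big1 ?addr0 => [|j ji]; first by rewrite mxE !eqxx expr1n.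
by rewrite mxE (negbTE ji) andbF expr0n.
Qed.

(** [Lam_second] puts all differences on u; on the set K carrying v they are bounded uniformly by
    [sd_bound], so the limit passes under the integral. *)
Lemma Dform_laplacian_cvg Om K u v (t_ : nat -> R) :
  open Om -> C2 Om u -> compact K -> K `<=` Om -> Cc u -> Cc v ->
  (forall x, ~ K x -> v x = 0) ->
  (forall m, 0 < t_ m) -> t_ @ \oo --> 0 ->
  Intg (fun x => v x * - laplacian u x) /\
  (fun m => Dform u v (t_ m)) @ \oo --> Int (fun x => v x * - laplacian u x).
Proof.
move=> oOm uC2 cK KOm Cu Cv vK t0 tcv.
have [C [C0 sdC]] := sd_bound oOm uC2 cK KOm Cu.
pose f m x := v x * (\sum_(i < n) sd u (t_ m *: e i) x / t_ m ^+ 2).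
have Csd h := Cc_mul_sd h Cu Cv.
have fE m : f m = fun x => \sum_(i < n) (t_ m ^+ 2)^-1 * (v x * sd u (t_ m *: e i) x).
  by apply/funext => x; rewrite /f mulr_sumr; apply: eq_bigr => i _; ring.
have fi m : Intg (f m).
  by rewrite fE; apply: Intg_sum => i; apply: IntgZ; exact: Cc_Intg.
have -> : (fun m => Dform u v (t_ m)) = (fun m => Int (f m)).
  apply/funext => m; rewrite fE Int_sum; last first.
    by move=> i; apply: IntgZ; exact: Cc_Intg.
  apply: eq_bigr => i _; rewrite IntZ; last exact: Cc_Intg.
  by rewrite mulrC Lam_second.
have gi : Intg (fun x => n%:R * C * `|v x|) by apply: IntgZ; apply: Intg_norm; exact: Cc_Intg.
apply: (dominated_Int _ gi).
- by move=> m; exact: Intg_measurable.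
- move=> x; have [Kx|/vK vx] := pselect (K x); last first.
    by apply: cvg_near_cst; apply: nearW => m; rewrite /f vx !mul0r.
  apply: cvgM; first exact: cvg_cst.
  rewrite /laplacian -sumrN.
  apply: cvg_big => [|i _]; first exact: add_continuous.
  by apply: (sd_cvg oOm uC2 (KOm _ Kx) t0 tcv).
move=> m x; rewrite /f normrM mulrC; have [Kx|/vK ->] := pselect (K x); last first.
  by rewrite normr0 !mulr0.
rewrite ler_wpM2r//; apply: (le_trans (ler_norm_sum _ _ _)).
rewrite mulr_natl -[X in _ *+ X]card_ord -sumr_const; apply: ler_sum => i _.
have t2 : 0 < t_ m ^+ 2 by rewrite exprn_gt0.
rewrite normrM normfV (gtr0_norm t2) ler_pdivrMr//.
apply: (le_trans (sdC x Kx _)); rewrite ler_wpM2l// enormZ enorm_delta mulr1.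
by rewrite real_normK ?num_real// ge_min lexx.
Qed.

Lemma measurable_frac_integrand u v : Cc u -> Cc v ->
  measurable_fun setT (fun p : V * V => v p.1 * (ker s p.2 * sd u p.2 p.1)).
Proof.
move=> Cu Cv; have mu := Cc_measurable Cu; have mv := Cc_measurable Cv.
apply: measurable_funM; first exact: measurable_fst_comp.
apply: measurable_funM; first exact: (measurable_snd_comp (measurable_ker s)).
apply: (@measurable_funB _ _ _ _ (fun p : V * V => 2 * u p.1 - u (p.1 + p.2))
  (fun p => u (p.1 - p.2))).
  apply: (@measurable_funB _ _ _ _ (fun p : V * V => 2 * u p.1)
    (fun p => u (p.1 + p.2))).
    by apply: measurable_funM => //; exact: measurable_fst_comp.
  by have := measurable_combination 1 1 mu; under eq_fun do rewrite !scale1r.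
by have := measurable_combination 1 (-1) mu; under eq_fun do rewrite scale1r scaleN1r.
Qed.

(** [Lam_second] for each h and an exchange of integrals, justified by the product bound C |v(x)|
    times [ker_weight] of h. *)
Lemma frac_weak Om K u v :
  open Om -> C2 Om u -> compact K -> K `<=` Om -> Cc u -> Cc v ->
  (forall x, ~ K x -> v x = 0) ->
  [/\ Intg (fun x => v x * frac_laplacian s u x),
      Intg (fun h => ker s h * Lam u v h) &
      Int (fun x => v x * frac_laplacian s u x) = c_frac n s / 2 * Gform u v].
Proof.
move=> oOm uC2 cK KOm Cu Cv vK.
have [C [C0 sdC]] := sd_bound oOm uC2 cK KOm Cu.
have ai : Intg (fun x => C * `|v x|) by apply: IntgZ; apply: Intg_norm; exact: Cc_Intg.
have wi := @Intg_ker_weight R n s s01.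
pose F x h := v x * (ker s h * sd u h x).
have Fb x h : `|F x h| <= C * `|v x| * ker_weight s h.
  rewrite /F !normrM (ger0_norm (ker_ge0 _ _)).
  have [Kx|/vK ->] := pselect (K x); last by rewrite normr0 mulr0 !mul0r.
  rewrite (mulrC C) -!mulrA ler_wpM2l// mulrC /ker_weight mulrA.
  by rewrite ler_wpM2r ?ker_ge0//; exact: sdC.
have [i1 i2 E] := Int_swap (measurable_frac_integrand Cu Cv) ai wi Fb.
have E1 : (fun x => v x * frac_laplacian s u x) =
    fun x => c_frac n s / 2 * Int (F x).
  apply/funext => x; rewrite /F; have [Kx|/vK vx] := pselect (K x); last first.
    have -> : (fun h => v x * (ker s h * sd u h x)) = fun=> 0.
      by apply/funext => h; rewrite vx mul0r.
    by rewrite vx mul0r Int0 mulr0.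
  have [ki ->] := frac_laplacian_sd oOm uC2 (KOm _ Kx) Cu.
  by rewrite (IntZ (v x) ki) mulrCA !mulrA; congr (_ * _); ring.
have E2 : (fun h => ker s h * Lam u v h) = fun h => Int (fun x => F x h).
  apply/funext => h.
  have vi : Intg (fun x => v x * (2 * u x - u (x + h) - u (x - h))).
    exact: (Cc_Intg (Cc_mul_sd h Cu Cv)).
  rewrite (Lam_second h Cu Cv) -(IntZ (ker s h) vi); apply: eq_Int => x.
  exact: mulrCA.
split; [by rewrite E1; exact: (IntgZ _ i1)|by rewrite E2|].
by rewrite E1 (IntZ _ i1) E /Gform E2.
Qed.

End weak_formulation.

(** * Energies under scaling, dilation, thresholding and limits *)

Section energies.
Context {R : realType} (n : nat) (s : R).
Hypothesis s01 : 0 < s < 1.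
Notation V := 'rV[R]_n.
Implicit Types (u v w g : V -> R) (x y h c : V) (t tau : R).
Notation e := (fun i : 'I_n => delta_mx 0 i : V).

Lemma compact_level w r : Cc w -> 0 < r -> compact [set x | r <= `|w x|].
Proof.
move=> [cw [B wB]] r0; apply: bounded_closed_compact.
  exists B; split; first exact: num_real.
  move=> M BM x /= rx; rewrite leNgt; apply/negP => Mx.
  by move: rx; rewrite wB ?normr0 ?leNgt ?r0//; exact: lt_trans BM Mx.
rewrite (_ : [set x | _] = (fun v : V => `|w v|) @^-1` [set q | r <= q])//.
apply: closed_comp; last exact: closed_ge.
by move=> x _; apply: (continuous_comp (cw x)); exact: norm_continuous.
Qed.

Lemma Dform_ge0 u tau : 0 <= Dform u u tau.
Proof.
by apply: sumr_ge0 => i _; rewrite divr_ge0 ?Lam_ge0 ?sqr_ge0.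
Qed.

Lemma Dform_natmul u k tau : Cc u -> (0 < k)%N ->
  Dform u u (k%:R * tau) <= Dform u u tau.
Proof.
move=> Cu k0; apply: ler_sum => i _.
have k20 : 0 < k%:R ^+ 2 :> R by rewrite exprn_gt0// ltr0n.
rewrite -scalerA exprMn invfM mulrA ler_wpM2r ?invr_ge0 ?sqr_ge0//.
by rewrite ler_pdivrMr// mulrC; exact: Lam_natmul.
Qed.

(** Hence a limit along the scales tau / (m + 1) bounds the energy at the fixed scale tau from
    above. *)
Lemma Dform_le_fraction u k tau : Cc u ->
  Dform u u tau <= Dform u u (tau / k.+1%:R).
Proof.
move=> Cu; have := @Dform_natmul u k.+1 (tau / k.+1%:R) Cu isT.
by rewrite mulrC divfK// pnatr_eq0.
Qed.

Lemma Dform_sub u v tau : Cc u -> Cc v ->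
  Dform (fun x => u x - v x) (fun x => u x - v x) tau =
  Dform u u tau + Dform v v tau - 2 * Dform u v tau.
Proof.
move=> Cu Cv; rewrite /Dform mulr_sumr -big_split -sumrB /=; apply: eq_bigr => i _.
by rewrite Lam_sub//; ring.
Qed.

Lemma Dform_shrink u r tau : 0 <= r -> Cc u ->
  let v x := shrink r (u x) in
  Dform v v tau <= Dform u v tau /\ Dform v v tau <= Dform u u tau.
Proof.
move=> r0 Cu v; split; apply: ler_sum => i _;
  rewrite ler_wpM2r ?invr_ge0 ?sqr_ge0//; by have [] := Lam_shrink (tau *: e i) r0 Cu.
Qed.

Lemma Lam_dilation u c t h : 0 < t -> Cc u ->
  Lam (fun x => u (c + t *: x)) (fun x => u (c + t *: x)) h =
  (t ^+ n)^-1 * Lam u u (t *: h).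
Proof.
move=> t0 Cu; rewrite (Lam_affine c h (lt0r_neq0 t0) Cu Cu) (gtr0_norm t0).
by rewrite mulrA mulVf ?mul1r// expf_neq0// gt_eqF.
Qed.

Lemma Dform_dilation u c t tau : 0 < t -> Cc u ->
  Dform (fun x => u (c + t *: x)) (fun x => u (c + t *: x)) tau =
  t ^+ 2 / t ^+ n * Dform u u (t * tau).
Proof.
move=> t0 Cu; rewrite /Dform mulr_sumr; apply: eq_bigr => i _.
(* At [tau = 0] both sides vanish because the inverse of 0 is 0. *)
have [->|tau0] := eqVneq tau 0; first by rewrite mulr0 expr0n /= invr0 !mulr0.
rewrite Lam_dilation// scalerA; move: (Lam u u _) => L; field.
by rewrite tau0 expf_neq0 (gt_eqF t0).
Qed.

Lemma Lam_cvg (w_ : nat -> V -> R) w g h : Cc g -> (forall k, Cc (w_ k)) ->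
  (forall x, w_ ^~ x @ \oo --> w x) -> (forall k x, `|w_ k x| <= g x) ->
  (fun k => Lam (w_ k) (w_ k) h) @ \oo --> Lam w w h.
Proof.
move=> Cg Cw wcv wg.
have gi : Intg (fun x => (g (x + h) + g x) * (g (x + h) + g x)).
  have C1 : Cc (fun x => g (x + h) + g x) by apply: CcD => //; exact: Cc_shift.
  by apply: Cc_Intg; apply: CcM C1 (Cc_continuous C1).
apply: (dominated_Int _ gi _ _).2.
- by move=> k; apply: Intg_measurable; exact: Intg_Lam.
- by move=> x; apply: cvgM; apply: cvgB; exact: wcv.
move=> k x; rewrite normrM.
have b : `|w_ k (x + h) - w_ k x| <= g (x + h) + g x.
  by rewrite (le_trans (ler_normB _ _))// lerD.
by rewrite ler_pM.
Qed.

Lemma Dform_cvg (w_ : nat -> V -> R) w g tau : Cc g -> (forall k, Cc (w_ k)) ->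
  (forall x, w_ ^~ x @ \oo --> w x) -> (forall k x, `|w_ k x| <= g x) ->
  (fun k => Dform (w_ k) (w_ k) tau) @ \oo --> Dform w w tau.
Proof.
move=> Cg Cw wcv wg; rewrite /Dform.
apply: cvg_big => [|i _]; first exact: add_continuous.
by apply: cvgM; [exact: (Lam_cvg Cg)|exact: cvg_cst].
Qed.

Lemma Gform_ge0 u : 0 <= Gform s u u.
Proof. by apply: Int_ge0 => h; rewrite mulr_ge0 ?ker_ge0 ?Lam_ge0. Qed.

Lemma measurable_ker_Lam u v : Cc u -> Cc v ->
  measurable_fun setT (fun h => ker s h * Lam u v h).
Proof.
by move=> Cu Cv; apply: measurable_funM; [exact: measurable_ker|exact: measurable_Lam].
Qed.

Lemma Intg_ker_Lam_le u v : Cc u -> Cc v -> (forall h, Lam u u h <= Lam v v h) ->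
  Intg (fun h => ker s h * Lam v v h) ->
  Intg (fun h => ker s h * Lam u u h) /\ Gform s u u <= Gform s v v.
Proof.
move=> Cu Cv uv vi.
have ui : Intg (fun h => ker s h * Lam u u h).
  apply: le_Intg vi; first exact: measurable_ker_Lam.
  move=> h; rewrite ger0_norm ?mulr_ge0 ?ker_ge0 ?Lam_ge0//.
  by rewrite ler_wpM2l ?ker_ge0.
by split => //; apply: le_Int => // h; rewrite ler_wpM2l ?ker_ge0.
Qed.

(** Since [Lam] of u + v is nonnegative, that of u - v is at most 2 (Lam u u + Lam v v). This gives
    integrability first for the difference and then for the cross term. *)
Lemma Gform_polar u v : Cc u -> Cc v ->
  Intg (fun h => ker s h * Lam u u h) -> Intg (fun h => ker s h * Lam v v h) ->
  let d x := u x - v x in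
  [/\ Intg (fun h => ker s h * Lam u v h),
      Intg (fun h => ker s h * Lam d d h) &
      Gform s d d = Gform s u u + Gform s v v - 2 * Gform s u v].
Proof.
move=> Cu Cv ui vi d; have Cd : Cc d by exact: CcB.
have di : Intg (fun h => ker s h * Lam d d h).
  apply: (le_Intg (g := fun h => 2 * (ker s h * Lam u u h + ker s h * Lam v v h))).
  - exact: measurable_ker_Lam.
  - move=> h; rewrite ger0_norm ?mulr_ge0 ?ker_ge0 ?Lam_ge0//.
    rewrite -mulrDr mulrCA ler_wpM2l ?ker_ge0//.
    have := Lam_ge0 (fun x => u x + v x) h; rewrite Lam_add// /d Lam_sub//.
    by lra.
  - by apply: IntgZ; exact: IntgD.
have E : (fun h => ker s h * Lam u v h) = fun h =>
    2^-1 * ((ker s h * Lam u u h + ker s h * Lam v v h) - ker s h * Lam d d h).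
  by apply/funext => h; rewrite /d Lam_sub//; field.
have i2 := IntgD ui vi.
have uvi : Intg (fun h => ker s h * Lam u v h) by rewrite E; apply: IntgZ; exact: IntgB.
split => //; rewrite /Gform E IntZ ?IntB ?IntD//; last exact: IntgB.
by field.
Qed.

(** Dilating x gives t^-n, and in h the Jacobian t^n is absorbed by the homogeneity of the kernel,
    leaving t^(2s). *)
Lemma Gform_dilation u c t : 0 < t -> Cc u ->
  Intg (fun h => ker s h * Lam u u h) ->
  let ut x := u (c + t *: x) in
  Intg (fun h => ker s h * Lam ut ut h) /\
  Gform s ut ut = t `^ (2 * s) / t ^+ n * Gform s u u.
Proof.
move=> t0 Cu ui ut.
have tn : t ^+ n != 0 by rewrite expf_neq0// gt_eqF.
have E : (fun h => ker s h * Lam ut ut h) =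
    fun h => t `^ (2 * s) * (ker s (0 + t *: h) * Lam u u (0 + t *: h)).
  apply/funext => h; rewrite add0r /ut Lam_dilation// kerZ// powR_critical//.
  by field; rewrite tn gt_eqF// powR_gt0.
have ti : Intg (fun h => ker s (0 + t *: h) * Lam u u (0 + t *: h)).
  by apply: (@Intg_affine R n 0 t (fun h => ker s h * Lam u u h)) => //; rewrite gt_eqF.
split; first by rewrite E; exact: (IntgZ _ ti).
rewrite /Gform E (IntZ _ ti) (Int_affine 0 (lt0r_neq0 t0) ui) (gtr0_norm t0).
by rewrite -mulrA mulKf.
Qed.

Lemma Gform_cvg (w_ : nat -> V -> R) w g v : Cc g -> (forall k, Cc (w_ k)) ->
  (forall x, w_ ^~ x @ \oo --> w x) -> (forall k x, `|w_ k x| <= g x) ->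
  (forall k h, Lam (w_ k) (w_ k) h <= v h) -> Intg (fun h => ker s h * v h) ->
  (fun k => Gform s (w_ k) (w_ k)) @ \oo --> Gform s w w.
Proof.
move=> Cg Cw wcv wg wv vi; apply: (dominated_Int _ vi _ _).2.
- by move=> k; exact: measurable_ker_Lam.
- by move=> h; apply: cvgM; [exact: cvg_cst|exact: (Lam_cvg Cg)].
move=> k h; rewrite ger0_norm ?mulr_ge0 ?ker_ge0 ?Lam_ge0//.
by rewrite ler_wpM2l ?ker_ge0.
Qed.

Lemma shrink_cvg (r : R) : shrink k.+1%:R^-1 r @[k --> \oo] --> r.
Proof.
apply/cvgrPdist_le => d d0.
have := near_infty_natSinv_lt (PosNum d0); apply: filterS => k /= kd.
rewrite distrC (le_trans (shrink_dist _ _)) ?invr_ge0//.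
exact: ltW.
Qed.

Lemma Cc_shrink w r : 0 <= r -> Cc w -> Cc (fun x => shrink r (w x)).
Proof.
by move=> r0; apply: Cc_comp; [exact: continuous_shrink|exact: shrink0].
Qed.

End energies.

(** * Energy inequalities for weak solutions *)

Section weak_solutions.
Context {R : realType} (n : nat) (s : R).
Hypothesis s01 : 0 < s < 1.
Notation V := 'rV[R]_n.
Implicit Types (u v w g fu : V -> R) (x y h c : V) (t tau A : R) (Om K : set V).

Lemma cvg_ge (f : nat -> R) (l r : R) : f @ \oo --> l -> (forall m, r <= f m) -> r <= l.
Proof.
move=> fl rf; rewrite -(cvg_lim (@Rhausdorff R) fl); apply: limr_ge; first exact: (cvgP _ fl).
exact: nearW.
Qed.

Lemma cvg_le (f : nat -> R) (l r : R) : f @ \oo --> l -> (forall m, f m <= r) -> l <= r.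
Proof.
move=> fl fr; rewrite -(cvg_lim (@Rhausdorff R) fl); apply: limr_le; first exact: (cvgP _ fl).
exact: nearW.
Qed.

(* The equation in divided differences: no gradient of u occurs. *)
Definition weak_solution A Om u fu : Prop := forall v K,
  Cc v -> compact K -> K `<=` Om -> (forall x, ~ K x -> v x = 0) ->
  Intg (fun h => ker s h * Lam u v h) /\
  forall t_ : nat -> R, (forall m, 0 < t_ m) -> t_ @ \oo --> 0 ->
    (fun m => Dform u v (t_ m)) @ \oo --> Int (fun x => v x * fu x) - A * Gform s u v.

Variables (A : R) (Om : set V) (u fu : V -> R).
Hypotheses (A0 : 0 <= A) (Cu : Cc u) (Cfu : Cc fu).
Hypothesis u0 : forall x, ~ Om x -> u x = 0.
Hypothesis weak : weak_solution A Om u fu.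

Let Q := Int (fun x => u x * fu x).

Lemma fractions_cvg0 tau : (fun m => tau / m.+1%:R) @ \oo --> 0.
Proof.
rewrite -[X in _ --> X](mulr0 tau); apply: cvgM; first exact: cvg_cst.
exact: cvg_harmonic.
Qed.

Lemma Int_shrink_cvg w : Cc w ->
  (fun k => Int (fun x => shrink k.+1%:R^-1 (w x) * fu x)) @ \oo --> Int (fun x => w x * fu x).
Proof.
move=> Cw; have Ca : Cc (fun x => w x * fu x) by apply: CcM => //; exact: Cc_continuous.
apply: (dominated_Int _ (Intg_norm (Cc_Intg Ca)) _ _).2.
- move=> k; apply: Cc_measurable; apply: CcM; first exact: Cc_shrink.
  exact: Cc_continuous.
- by move=> x; apply: cvgM; [exact: shrink_cvg|exact: cvg_cst].
by move=> k x; rewrite !normrM ler_wpM2r// norm_shrink_le.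
Qed.

(** The thresholded v = shrink r u is an admissible test function, being carried by the compact set
    |u| >= r inside [Om], and its energies are bounded by the cross energies with u.
    [Dform_le_fraction] replaces the limit of small scales by the given tau. *)
Lemma shrunk_energy_le r tau : 0 < r -> 0 < tau ->
  let v x := shrink r (u x) in
  Intg (fun h => ker s h * Lam v v h) /\
  Dform v v tau + A * Gform s v v <= Int (fun x => v x * fu x).
Proof.
move=> r0 tau0 v; have r0' := ltW r0; have Cv : Cc v by exact: Cc_shrink.
have KOm : [set x | r <= `|u x|] `<=` Om.
  move=> x /= rx; apply: contrapT => /u0 ux; move: rx; rewrite ux normr0; lra.
have vK x : ~ [set x | r <= `|u x|] x -> v x = 0.
  by move=> /= /negP; rewrite -ltNge => rx; apply: shrink_small => //; exact: ltW.
have [uvi wcv] := weak Cv (compact_level Cu r0) KOm vK.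
have Lvv h := Lam_shrink h r0' Cu.
have vvi : Intg (fun h => ker s h * Lam v v h).
  apply: le_Intg uvi; first exact: measurable_ker_Lam.
  move=> h; rewrite ger0_norm ?mulr_ge0 ?ker_ge0 ?Lam_ge0//.
  by rewrite ler_wpM2l ?ker_ge0//; have [] := Lvv h.
split => //.
have Gvv : Gform s v v <= Gform s u v.
  by apply: le_Int => // h; rewrite ler_wpM2l ?ker_ge0//; have [] := Lvv h.
have := cvg_ge (wcv (fun m => tau / m.+1%:R) _ (fractions_cvg0 tau)).
move=> /(_ (Dform v v tau)) H.
have {}H : Dform v v tau <= Int (fun x => v x * fu x) - A * Gform s u v.
  apply: H => m; first by rewrite divr_gt0.
  apply: (le_trans (Dform_le_fraction m tau Cv)).
  by have [] := Dform_shrink (tau / m.+1%:R) r0' Cu.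
by have := ler_wpM2l A0 Gvv; lra.
Qed.

(** The threshold tends to 0. Fatou gives a finite Gagliardo energy when A > 0; afterwards all terms
    converge by domination. This one-sided bound takes the place of the energy identity. *)
Lemma energy_le : (0 < A -> Intg (fun h => ker s h * Lam u u h)) /\
  forall tau, 0 < tau -> Dform u u tau + A * Gform s u u <= Q.
Proof.
pose v_ k x := shrink k.+1%:R^-1 (u x).
have k0 k : 0 < k.+1%:R^-1 :> R by rewrite invr_gt0.
have Cv k : Cc (v_ k) by apply: Cc_shrink => //; exact: ltW.
have vcv x : v_ ^~ x @ \oo --> u x by exact: shrink_cvg.
have Cg : Cc (fun x => `|u x|).
  by apply: (Cc_comp (phi := fun r => `|r|)) => //; [exact: norm_continuous|exact: normr0].
have vg k x : `|v_ k x| <= `|u x| by apply: norm_shrink_le; exact: ltW.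
have Lv k h : Lam (v_ k) (v_ k) h <= Lam u u h by have [] := Lam_shrink h (ltW (k0 k)) Cu.
have Qcv := Int_shrink_cvg Cu.
have ui : 0 < A -> Intg (fun h => ker s h * Lam u u h).
  move=> A_gt0.
  have Ca : Cc (fun x => u x * fu x) by apply: CcM => //; exact: Cc_continuous.
  apply: (fatou_Int (f_ := fun k h => ker s h * Lam (v_ k) (v_ k) h)
    (B := Int (fun x => `|u x * fu x|) / A) _ _ _ _).1.
  - by move=> k; have [] := shrunk_energy_le (k0 k) ltr01.
  - by move=> k h; rewrite mulr_ge0 ?ker_ge0 ?Lam_ge0.
  - by move=> h; apply: cvgM; [exact: cvg_cst|exact: (Lam_cvg Cg)].
  move=> k; rewrite ler_pdivlMr// mulrC.
  have [_] := shrunk_energy_le (k0 k) ltr01.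
  have := Dform_ge0 (v_ k) 1; rewrite -/(Gform s (v_ k) (v_ k)) -/(v_ k) => D0 H.
  have : Int (fun x => v_ k x * fu x) <= Int (fun x => `|u x * fu x|).
    apply: le_Int.
    - by apply: Cc_Intg; apply: CcM => //; exact: Cc_continuous.
    - exact: Intg_norm (Cc_Intg Ca).
    - move=> x; rewrite (le_trans (ler_norm _))// !normrM ler_wpM2r//; exact: vg.
  by lra.
split => // tau tau0.
have Dcv : (fun k => Dform (v_ k) (v_ k) tau) @ \oo --> Dform u u tau by exact: (Dform_cvg Cg).
have Gcv : (fun k => A * Gform s (v_ k) (v_ k)) @ \oo --> A * Gform s u u.
  (* For A = 0 integrability of the fractional term has not been shown, but the term is multiplied
     by 0 for every k. *)
  have [A_gt0|A_le0] := ltP 0 A.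
    apply: cvgM; first exact: cvg_cst.
    by apply: (Gform_cvg Cg Cv vcv vg Lv); exact: ui.
  have -> : A = 0 by apply/eqP; rewrite eq_le A_le0.
  by rewrite mul0r; under eq_fun do rewrite mul0r; exact: cvg_cst.
have S : (fun k => Int (fun x => v_ k x * fu x) -
    (Dform (v_ k) (v_ k) tau + A * Gform s (v_ k) (v_ k))) @ \oo -->
    Q - (Dform u u tau + A * Gform s u u) by exact: (cvgB Qcv (cvgD Dcv Gcv)).
rewrite -subr_ge0; apply: (cvg_ge S) => k.
by rewrite subr_ge0; have [] := shrunk_energy_le (k0 k) tau0.
Qed.

(** Plays the part of the Dirichlet energy of u: [energy_le] bounds [Dform u u tau] by it at all
    scales. *)
Let D := Q - A * Gform s u u.

(** The equation is tested with thresholded copies of the dilated function, and the cross energies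
    are polarized: twice D(u, v) is D(u) + D(v) - D(u - v). The energies of the dilation are those
    of u up to powers of t. *)
Lemma energy_pair c t tau : 0 < t -> 0 < tau ->
  (forall x, u (c + t *: x) != 0 -> Om x) ->
  Int (fun x => u (c + t *: x) * fu x) +
  2^-1 * Dform (fun x => u x - u (c + t *: x)) (fun x => u x - u (c + t *: x)) tau +
  A / 2 * Gform s (fun x => u x - u (c + t *: x)) (fun x => u x - u (c + t *: x)) <=
  2^-1 * (1 + t ^+ 2 / t ^+ n) * D +
  A / 2 * (1 + t `^ (2 * s) / t ^+ n) * Gform s u u.
Proof.
move=> t0 tau0 utOm; pose ut x := u (c + t *: x); pose d x := u x - ut x.
have [ui EL] := energy_le.
have t0' := lt0r_neq0 t0.
have Cut : Cc ut by exact: Cc_affine.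
pose v_ k x := shrink k.+1%:R^-1 (ut x).
have k0 k : 0 < k.+1%:R^-1 :> R by rewrite invr_gt0.
have Cv k : Cc (v_ k) by apply: Cc_shrink => //; exact: ltW.
pose d_ k x := u x - v_ k x.
have Cd k : Cc (d_ k) by exact: CcB.
have dcv x : d_ ^~ x @ \oo --> d x by apply: cvgB; [exact: cvg_cst|exact: shrink_cvg].
have abs w : Cc w -> Cc (fun x => `|w x|).
  by apply: (Cc_comp (phi := fun r => `|r|)); [exact: norm_continuous|exact: normr0].
have Cg : Cc (fun x => `|u x| + `|ut x|) by apply: CcD; exact: abs.
have dg k x : `|d_ k x| <= `|u x| + `|ut x|.
  rewrite (le_trans (ler_normB _ _))// lerD2l.
  by apply: norm_shrink_le; exact: ltW.
have Lv k h : Lam (v_ k) (v_ k) h <= Lam ut ut h.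
  by have [] := Lam_shrink h (ltW (k0 k)) Cut.
have Gd k : 0 < A -> [/\ Intg (fun h => ker s h * Lam (d_ k) (d_ k) h),
    Gform s (d_ k) (d_ k) = Gform s u u + Gform s (v_ k) (v_ k) - 2 * Gform s u (v_ k) &
    Gform s (v_ k) (v_ k) <= t `^ (2 * s) / t ^+ n * Gform s u u].
  move=> A_gt0; have [uti utE] := Gform_dilation c t0 Cu (ui A_gt0).
  have [vi vle] := Intg_ker_Lam_le (Cv k) Cut (Lv k) uti.
  have [_ di dE] := Gform_polar Cu (Cv k) (ui A_gt0) vi.
  by split => //; rewrite -utE.
pose X := 2^-1 * (1 + t ^+ 2 / t ^+ n) * D +
  A / 2 * (1 + t `^ (2 * s) / t ^+ n) * Gform s u u.
have main k : Int (fun x => v_ k x * fu x) +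
    (2^-1 * Dform (d_ k) (d_ k) tau + A / 2 * Gform s (d_ k) (d_ k)) <= X.
  have KOm : [set x | k.+1%:R^-1 <= `|ut x|] `<=` Om.
    move=> x /= rx; apply: utOm; apply/eqP => ux; move: rx.
    by rewrite /ut ux normr0 leNgt k0.
  have vK x : ~ [set x | k.+1%:R^-1 <= `|ut x|] x -> v_ k x = 0.
    by move=> /= /negP; rewrite -ltNge => rx; apply: shrink_small; exact: ltW.
  have [uvi wcv] := weak (Cv k) (compact_level Cut (k0 k)) KOm vK.
  (* At scale tau / (m + 1): [h2] bounds the energy of u; [h3], [h4] and [h5] bound that of the
     thresholded dilation, through the energy of u at t times that scale; [h1] returns the energy of
     the difference to the fixed scale tau. *)
  have H : Int (fun x => v_ k x * fu x) - A * Gform s u (v_ k) <=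
      2^-1 * (1 + t ^+ 2 / t ^+ n) * D - 2^-1 * Dform (d_ k) (d_ k) tau.
    apply: (cvg_le (wcv (fun m => tau / m.+1%:R) _ (fractions_cvg0 tau))) => m.
      by rewrite divr_gt0.
    have tm0 : 0 < tau / m.+1%:R by rewrite divr_gt0.
    have E := Dform_sub (tau / m.+1%:R) Cu (Cv k).
    have h1 := Dform_le_fraction m tau (Cd k).
    have h2 := EL _ tm0.
    have [_ h3] := Dform_shrink (tau / m.+1%:R) (ltW (k0 k)) Cut.
    have h4 := Dform_dilation c (tau / m.+1%:R) t0 Cu.
    have h5 := EL _ (mulr_gt0 t0 tm0).
    have h6 : 0 <= t ^+ 2 / t ^+ n by rewrite divr_ge0 ?exprn_ge0// ltW.
    have h7 : t ^+ 2 / t ^+ n * Dform u u (t * (tau / m.+1%:R)) <= t ^+ 2 / t ^+ n * D.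
      by rewrite ler_wpM2l// /D; lra.
    rewrite -/(v_ k) -/ut in h3 h4.
    rewrite -/(d_ k) in E.
    have h8 : Dform u u (tau / m.+1%:R) <= D by rewrite /D; lra.
    have -> : 2^-1 * (1 + t ^+ 2 / t ^+ n) * D =
        2^-1 * D + 2^-1 * (t ^+ 2 / t ^+ n * D) by ring.
    move: (t ^+ 2 / t ^+ n * D) h7 h8 => TD h7 h8.
    by lra.
  have [A_gt0|A_le0] := ltP 0 A.
    have [_ dE vle] := Gd k A_gt0.
    have := ler_wpM2l A0 vle; rewrite /X dE.
    move: (t `^ (2 * s) / t ^+ n) => T; move: H.
    move: (Gform s u u) (Gform s u (v_ k)) (Gform s (v_ k) (v_ k)) => G1 G2 G3.
    by move: (_ * D) (Int _) (Dform _ _ _) => r1 r2 r3; nra.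
  have A00 : A = 0 by apply/eqP; rewrite eq_le A_le0.
  by move: H; rewrite /X A00 !mul0r; lra.
have Dcv : (fun k => Dform (d_ k) (d_ k) tau) @ \oo --> Dform d d tau by exact: (Dform_cvg Cg).
have Gcv : (fun k => A / 2 * Gform s (d_ k) (d_ k)) @ \oo --> A / 2 * Gform s d d.
  have [A_gt0|A_le0] := ltP 0 A; last first.
    have -> : A = 0 by apply/eqP; rewrite eq_le A_le0.
    by rewrite !mul0r; under eq_fun do rewrite mul0r; exact: cvg_cst.
  apply: cvgM; first exact: cvg_cst.
  have [uti _] := Gform_dilation c t0 Cu (ui A_gt0).
  apply: (Gform_cvg (v := fun h => 2 * (Lam u u h + Lam ut ut h)) Cg Cd dcv dg).
    move=> k h; have := Lam_ge0 (fun x => u x + v_ k x) h.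
    by rewrite Lam_add// Lam_sub//; have := Lv k h; lra.
  rewrite (_ : (fun h => _) = fun h => 2 * (ker s h * Lam u u h + ker s h * Lam ut ut h)).
    by apply: IntgZ; apply: IntgD => //; exact: ui.
  by apply/funext => h; ring.
have Dcv2 : (fun k => 2^-1 * Dform (d_ k) (d_ k) tau) @ \oo --> 2^-1 * Dform d d tau.
  by apply: cvgM; [exact: cvg_cst|exact: Dcv].
have S : (fun k => Int (fun x => v_ k x * fu x) + (2^-1 * Dform (d_ k) (d_ k) tau +
    A / 2 * Gform s (d_ k) (d_ k))) @ \oo --> Int (fun x => ut x * fu x) +
    (2^-1 * Dform d d tau + A / 2 * Gform s d d).
  exact: (cvgD (Int_shrink_cvg Cut) (cvgD Dcv2 Gcv)).
rewrite -addrA; exact: (cvg_le S main).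
Qed.

End weak_solutions.

(** * Dilations compared with translations in L^2 *)

Section quadratic_increments.
Context {R : realType} (n : nat).
Notation V := 'rV[R]_n.
Implicit Types (u : V -> R) (x y w h c z : V) (t r B : R).
Notation e := (fun i : 'I_n => delta_mx 0 i : V).

Lemma Lam_add_vector u h y : Cc u -> Lam u u (h + y) <= 2 * Lam u u h + 2 * Lam u u y.
Proof.
move=> Cu; have hi := Intg_Lam h Cu Cu; have yi := Intg_Lam y Cu Cu.
have Eh : Lam u u h = Int (fun x => (u (x + y + h) - u (x + y)) * (u (x + y + h) - u (x + y))).
  by rewrite /Lam -(Int_shift y hi).
have hi' := Intg_shift y hi; rewrite /= in hi'.
rewrite Eh -!IntZ// -IntD; [|exact: IntgZ|exact: IntgZ].
apply: le_Int; [exact: Intg_Lam|by apply: IntgD; exact: IntgZ|move=> x].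
rewrite addrA addrAC; move: (u (x + y + h)) (u (x + y)) (u x) => a b d.
by have := sqr_ge0 ((a - b) - (b - d)); nra.
Qed.

(** h is decomposed along the axes, where [Dform] controls the increments; each of the n additions
    costs a factor 2 by [Lam_add_vector]. *)
Lemma Lam_le_sqr u D : Cc u -> 0 <= D ->
  (forall t, 0 < t -> Dform u u t <= D) ->
  exists L, 0 <= L /\ forall h, Lam u u h <= L * `|h| ^+ 2.
Proof.
move=> Cu D0 uD; exists (2 ^+ n * (n%:R * D)); split.
  by rewrite mulr_ge0 ?exprn_ge0// mulr_ge0.
move=> h.
have coord i : Lam u u (h 0 i *: e i) <= D * `|h| ^+ 2.
  have [h0|h0] := eqVneq (h 0 i) 0.
    rewrite h0 scale0r (_ : Lam u u 0 = 0) ?mulr_ge0//.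
    by rewrite /Lam -[RHS](@Int0 R n); apply: eq_Int => x; rewrite addr0 subrr mul0r.
  have E : Lam u u (h 0 i *: e i) = Lam u u (`|h 0 i| *: e i).
    have [h1|h1] := leP 0 (h 0 i); first by rewrite ger0_norm.
    by rewrite ltr0_norm// scaleNr Lam_opp.
  have hi : 0 < `|h 0 i| by rewrite normr_gt0.
  have h2 : 0 < `|h 0 i| ^+ 2 by rewrite exprn_gt0.
  have := uD _ hi; rewrite /Dform (bigD1 i)//= => H.
  have {}H : Lam u u (`|h 0 i| *: e i) / `|h 0 i| ^+ 2 <= D.
    apply: le_trans H; rewrite lerDl; apply: sumr_ge0 => j _.
    by rewrite divr_ge0 ?Lam_ge0// ltW.
  move: H; rewrite ler_pdivrMr// E => /le_trans; apply.
  by rewrite ler_wpM2l// lerXn2r ?nnegrE// coord_le_norm.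
have main (s : seq 'I_n) : Lam u u (\sum_(i <- s) h 0 i *: e i) <=
    2 ^+ size s * ((size s)%:R * (D * `|h| ^+ 2)).
  elim: s => [|i s IH].
    rewrite big_nil mul0r mulr0 (_ : Lam u u 0 = 0)//.
    by rewrite /Lam -[RHS](@Int0 R n); apply: eq_Int => x; rewrite addr0 subrr mul0r.
  rewrite big_cons; apply: (le_trans (Lam_add_vector _ _ Cu)).
  have := coord i; move: IH; rewrite /= (exprS 2 (size s)) -[(size s).+1%:R]natr1.
  move: (Lam u u (h 0 i *: e i)) (Lam u u (\sum_(j <- s) h 0 j *: e j)) => a b.
  have X0 : 0 <= D * `|h| ^+ 2 by rewrite mulr_ge0.
  move: (D * `|h| ^+ 2) X0 => X X0 bX aX.
  have p1 : 1 <= 2 ^+ size s :> R by rewrite exprn_ege1// ler1n.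
  move: bX; move: ((size s)%:R : R) => k; move: (2 ^+ size s : R) p1 => p p1 bX.
  by have := ler_wpM2r X0 p1; rewrite mul1r; nra.
have := main (index_enum _); rewrite -row_sum_delta => /le_trans; apply.
by rewrite /index_enum -enumT size_enum_ord -!mulrA.
Qed.

Definition cube_indicator r x : R := if `|x| <= r then 1 else 0.

Lemma cube_indicator_ge0 r x : 0 <= cube_indicator r x.
Proof. by rewrite /cube_indicator; case: ifP. Qed.

Lemma measurable_cube_indicator r : measurable_fun setT (cube_indicator r).
Proof.
apply: measurable_fun_ifT; [|exact: measurable_cst|exact: measurable_cst].
apply: measurable_fun_ler; last exact: measurable_cst.
by apply: continuous_measurable_rV; exact: norm_continuous.
Qed.

Lemma Intg_cube_indicator r : Intg (cube_indicator r).
Proof.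
apply: (@bounded_support_Intg _ _ _ 1 r); first exact: measurable_cube_indicator.
  by move=> x; rewrite /cube_indicator; case: ifP; rewrite ?normr1 ?normr0.
by move=> x rx; rewrite /cube_indicator leNgt rx.
Qed.

Lemma Int_cube_indicator r : 0 <= r -> Int (cube_indicator r) = (2 * r) ^+ n.
Proof.
move=> r0; pose A := [set x : V | `|x| <= r].
have mA : measurable A.
  have := measurable_cube_indicator r => /(_ measurableT [set 1] (measurable_set1 _)).
  rewrite setTI; congr measurable; apply/seteqP; split => x; rewrite /A /cube_indicator /=.
    by case: ifP => // _ /eqP; rewrite eq_sym oner_eq0.
  by move=> ->.
have -> : cube_indicator r = \1_A.
  apply/funext => x; rewrite indicE /cube_indicator.
  have -> : (x \in A) = (`|x| <= r) by apply/idP/idP; rewrite inE.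
  by case: ifP.
by rewrite IntE integral_indic// setIT [X in fine X]lebesgue_rV_cube.
Qed.

(** Unnormalized mean of squared increments over a cube. Its integral in x is a mean of
    [Lam u u (t *: w)], hence quadratic in t. *)
Definition mean_increment u t r x : R :=
  Int (fun w => cube_indicator r w * (u (x + t *: w) - u x) ^+ 2).

Lemma sqr_sub_le (p q B : R) : `|p| <= B -> `|q| <= B -> (p - q) ^+ 2 <= 4 * B ^+ 2.
Proof.
move=> pB qB; have B0 : 0 <= B := le_trans (normr_ge0 _) pB.
rewrite -(real_normK (num_real (p - q))) (_ : 4 * B ^+ 2 = (B + B) ^+ 2); last by ring.
apply: lerXn2r; rewrite ?nnegrE ?addr_ge0//.
by rewrite (le_trans (ler_normB _ _))// lerD.
Qed.

Lemma mean_increment_bound u L t r : Cc u -> 0 <= L -> 0 <= t -> 0 <= r ->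
  (forall h, Lam u u h <= L * `|h| ^+ 2) ->
  Intg (mean_increment u t r) /\
  Int (mean_increment u t r) <= (2 * r) ^+ n * (L * (t * r) ^+ 2).
Proof.
move=> Cu L0 t0 r0 uL; have [B uB] := Cc_bounded Cu; have [_ [d ud]] := Cu.
have mu := Cc_measurable Cu.
pose F x w := cube_indicator r w * (u (x + t *: w) - u x) ^+ 2.
have mF : measurable_fun setT (fun p : V * V => F p.1 p.2).
  apply: measurable_funM; first exact: (measurable_snd_comp (measurable_cube_indicator r)).
  apply: measurable_funX.
  apply: (@measurable_funB _ _ _ _ (fun p : V * V => u (p.1 + t *: p.2)) (fun p => u p.1)).
    by have := measurable_combination 1 t mu; under eq_fun do rewrite scale1r.
  exact: measurable_fst_comp.
have ai := IntgZ (4 * B ^+ 2) (Intg_cube_indicator (d + t * r)).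
have FB x w : `|F x w| <= 4 * B ^+ 2 * cube_indicator (d + t * r) x * cube_indicator r w.
  have F0 : 0 <= F x w by rewrite mulr_ge0 ?cube_indicator_ge0 ?sqr_ge0.
  rewrite (ger0_norm F0) /F [X in X * _]/cube_indicator [X in _ <= _ * X]/cube_indicator.
  case: ifP => [wr|_]; last by rewrite mul0r mulr0.
  rewrite mul1r mulr1 /cube_indicator; case: ifPn => [_|]; last first.
    rewrite -ltNge => xd.
    have tr0 : 0 <= t * r by rewrite mulr_ge0.
    rewrite (ud x); last by lra.
    rewrite ud ?subrr ?expr0n /= ?mulr0//.
    have := ler_normB (x + t *: w) (t *: w); rewrite addrK.
    have : `|t *: w| <= t * r by rewrite normrZ ger0_norm// ler_wpM2l.
    by lra.
  by rewrite mulr1; exact: sqr_sub_le.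
have [i1 i2 E] := Int_swap mF ai (Intg_cube_indicator r) FB.
split; first exact: i1.
rewrite /mean_increment -/(F _ _) [X in X <= _]E.
rewrite -(Int_cube_indicator r0) mulrC -IntZ; last exact: Intg_cube_indicator.
apply: le_Int; [exact: i2|by apply: IntgZ; exact: Intg_cube_indicator|move=> w].
have -> : Int (fun x => F x w) = cube_indicator r w * Lam u u (t *: w).
  by rewrite /Lam -IntZ; [apply: eq_Int => x; rewrite /F expr2|exact: Intg_Lam].
rewrite mulrC /cube_indicator; case: ifP => [wr|_]; last by rewrite !mulr0.
rewrite !mulr1; apply: (le_trans (uL (t *: w))); apply: ler_wpM2l; first exact: L0.
rewrite normrZ (ger0_norm t0); have h := ler_wpM2l t0 wr.
by apply: lerXn2r => //; rewrite nnegrE mulr_ge0.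
Qed.

(** Arithmetic for [dilation_L2], together with [far_image]: when the averaging variable leaves the
    cube of radius |d| + |z| + 2, both x and the point it is compared with lie off the support of
    u. *)
Lemma far_point (d D z X Y : R) : d <= D -> D + z + 2 - 1 < Y -> Y <= X + z -> d < X.
Proof. lra. Qed.

Lemma far_image (d D z Y Y' S E W : R) : d <= D -> D + z + 2 - 1 < Y -> Y <= Y' ->
  E <= 1 -> Y' <= S + E -> S <= W + z -> d < W.
Proof. lra. Qed.

Lemma three_point (a b b' q : R) : 0 <= q ->
  (a - b) ^+ 2 * q <= 2 * (q * (b' - b) ^+ 2) + 2 * (q * (b' - a) ^+ 2).
Proof.
move=> q0; have : (a - b) ^+ 2 <= 2 * (b' - b) ^+ 2 + 2 * (b' - a) ^+ 2.
  by have := sqr_ge0 ((b' - b) + (b' - a)); nra.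
by move=> /(ler_wpM2l q0); lra.
Qed.

Lemma combine_means (m1 mr m1t P1 Pr L E r2 : R) : m1 <= P1 * (L * E) ->
  mr <= Pr * (L * (E * r2)) -> m1t <= m1 ->
  2 * m1t + 2 * mr <= (2 * (P1 * L) + 2 * (Pr * (L * r2))) * E.
Proof. lra. Qed.

(* u (z + t (x - z)) - u x is compared with u at nearby points and averaged over a
   cube: only translations of u enter. *)
Lemma dilation_L2 u L z : Cc u -> 0 <= L -> (forall h, Lam u u h <= L * `|h| ^+ 2) ->
  exists C, 0 <= C /\ forall t, 1 < t <= 2 ->
    Int (fun x => (u x - u (z - t *: z + t *: x)) ^+ 2) <= C * (t - 1) ^+ 2.
Proof.
move=> Cu L0 uL; have [B uB] := Cc_bounded Cu; have [_ [d ud]] := Cu.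
have mu := Cc_measurable Cu.
pose r := `|d| + `|z| + 2.
have r0 : 0 <= r by rewrite /r !addr_ge0.
pose C := 2 * ((2 * 1) ^+ n * L) + 2 * ((2 * r) ^+ n * (L * r ^+ 2)).
have C0 : 0 <= C by rewrite addr_ge0// ?mulr_ge0 ?exprn_ge0 ?mulr_ge0.
have p0 : 0 < 2 ^+ n :> R by rewrite exprn_gt0.
exists (C / 2 ^+ n); split; first by rewrite divr_ge0// ltW.
move=> t /andP[t1 t2]; pose eta := t - 1.
have eta0 : 0 <= eta by rewrite /eta; lra.
have eta1 : eta <= 1 by rewrite /eta; lra.
have tp : 0 < t by lra.
have t0 : t != 0 by rewrite gt_eqF.
pose c := z - t *: z.
have Cd : Cc (fun x => u x - u (c + t *: x)) by apply: CcB => //; exact: Cc_affine.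
have di : Intg (fun x => (u x - u (c + t *: x)) ^+ 2).
  by apply: Cc_Intg; apply: CcM Cd (Cc_continuous Cd).
have [i1 M1] := mean_increment_bound Cu L0 eta0 ler01 uL.
have [ir Mr] := mean_increment_bound Cu L0 eta0 r0 uL.
have i1t := Intg_affine c t0 i1.
have M1t : Int (fun x => mean_increment u eta 1 (c + t *: x)) <= Int (mean_increment u eta 1).
  rewrite [leRHS](Int_affine c t0 i1) ler_peMl//.
    by apply: Int_ge0 => x; apply: Int_ge0 => w; rewrite mulr_ge0 ?cube_indicator_ge0 ?sqr_ge0.
  by apply: exprn_ege1; rewrite (gtr0_norm tp); exact: ltW.
have point x : 2 ^+ n * (u x - u (c + t *: x)) ^+ 2 <=
    2 * mean_increment u eta 1 (c + t *: x) + 2 * mean_increment u eta r x.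
  set xi := c + t *: x.
  have gi (a : V) (b q : R) : `|b| <= B ->
      Intg (fun w => cube_indicator q w * (u (a + eta *: w) - b) ^+ 2).
    move=> bB; apply: (@bounded_support_Intg _ _ _ (4 * B ^+ 2) q).
    - apply: measurable_funM; first exact: measurable_cube_indicator.
      apply: measurable_funX; apply: measurable_funB => //.
      exact: measurable_affine_comp.
    - move=> w; rewrite ger0_norm; last first.
        by apply: mulr_ge0; [exact: cube_indicator_ge0|exact: sqr_ge0].
      have h := sqr_sub_le (uB (a + eta *: w)) bB.
      rewrite /cube_indicator; case: ifP => _; first by rewrite mul1r; exact: h.
      by rewrite mul0r; exact: le_trans (sqr_ge0 _) h.
    - by move=> w qw; rewrite /cube_indicator leNgt qw mul0r.
  (* Since xi = x + eta (x - z), moving the averaging variable by z - x turns points near xi into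
     points near x; the moved unit cube is covered by the cube of radius r, except when u vanishes
     at both points. *)
  have shiftE : Int (fun w => cube_indicator 1 w * (u (xi + eta *: w) - u x) ^+ 2) <=
      mean_increment u eta r x.
    have gx := gi xi (u x) 1 (uB x).
    rewrite -(Int_shift (z - x) gx); apply: le_Int;
      [exact: (Intg_shift (z - x) gx)|exact: (gi x (u x) r (uB x))|move=> w].
    have -> : xi + eta *: (w + (z - x)) = x + eta *: w.
      rewrite /xi /c /eta; apply/rowP => j; rewrite !mxE; ring.
    rewrite {1}/cube_indicator; case: ifP => [w1|_]; last first.
      by rewrite mul0r mulr_ge0 ?cube_indicator_ge0 ?sqr_ge0.
    rewrite mul1r /cube_indicator; case: ifPn => [_|]; first by rewrite mul1r.
    rewrite -ltNge => rw.
    have dn := ler_norm d.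
    have xz : r - 1 < `|x - z|.
      have E : w + (z - x) + (x - z) = w by rewrite -(opprB z x) addrK.
      rewrite ltrBlDr; apply: (lt_le_trans rw).
      have := ler_normD (w + (z - x)) (x - z); rewrite E => /le_trans; apply.
      by rewrite addrC lerD2l.
    rewrite (ud x); last exact: (far_point dn xz (ler_normB x z)).
    rewrite ud; first by rewrite subrr expr0n mul0r.
    have E : x + eta *: w = (t *: (x - z) + eta *: (w + (z - x))) + z.
      by rewrite /eta; apply/rowP => j; rewrite !mxE; ring.
    have h1 : `|t *: (x - z)| >= `|x - z|.
      by rewrite normrZ (gtr0_norm tp); apply: ler_peMl => //; exact: ltW.
    have h2 : `|eta *: (w + (z - x))| <= 1.
      rewrite normrZ ger0_norm//; apply: (@le_trans _ _ (1 * 1)); last by rewrite mulr1.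
      by rewrite ler_pM.
    have h3 := ler_normB (t *: (x - z) + eta *: (w + (z - x))) (eta *: (w + (z - x))).
    rewrite addrK in h3.
    have h4 := ler_normB (x + eta *: w) z; rewrite {1}E addrK in h4.
    exact: (far_image dn xz h1 h2 h3 h4).
  have -> : 2 ^+ n * (u x - u xi) ^+ 2 =
      Int (fun w => (u x - u xi) ^+ 2 * cube_indicator 1 w).
    by rewrite IntZ ?Int_cube_indicator ?mulr1 1?mulrC//; exact: Intg_cube_indicator.
  apply: (@le_trans _ _ (2 * mean_increment u eta 1 xi +
      2 * Int (fun w => cube_indicator 1 w * (u (xi + eta *: w) - u x) ^+ 2))); last first.
    by rewrite lerD2l ler_wpM2l.
  have g1 := gi xi (u xi) 1 (uB xi); have g2 := gi xi (u x) 1 (uB x).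
  rewrite /mean_increment -!IntZ// -IntD; [|exact: IntgZ|exact: IntgZ].
  apply: le_Int.
  - by apply: IntgZ; exact: Intg_cube_indicator.
  - by apply: IntgD; exact: IntgZ.
  move=> w; have q0 := cube_indicator_ge0 1 w.
  exact: three_point.
rewrite mulrAC ler_pdivlMr// mulrC -IntZ//.
apply: (@le_trans _ _ (Int (fun x => 2 * mean_increment u eta 1 (c + t *: x) +
    2 * mean_increment u eta r x))).
  by apply: le_Int => //; [exact: IntgZ|by apply: IntgD; exact: IntgZ].
rewrite IntD; [|exact: (IntgZ 2 i1t)|exact: IntgZ].
rewrite (IntZ 2 i1t) (IntZ 2 ir).
rewrite (exprMn _ eta r) in Mr; rewrite (mulr1 eta) in M1.
exact: (combine_means M1 Mr M1t).
Qed.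

End quadratic_increments.

(** * Inequalities for real powers *)

Section powers.
Context {R : realType}.
Implicit Types (a b t x y q p B : R).

(** Young's inequality for the product x . 1 with exponents p and p / (p - 1). *)
Lemma bernoulli_powR p x : 1 < p -> 0 <= x -> 1 + p * (x - 1) <= x `^ p.
Proof.
move=> p1 x0; have p0 : 0 < p by lra.
have q0 : 0 < p / (p - 1) by rewrite divr_gt0//; lra.
have := @conjugate_powR R x 1 p (p / (p - 1)) x0 ler01 p0 q0.
have pq : p^-1 + (p / (p - 1))^-1 = 1 by rewrite invf_div; field; lra.
rewrite powR1 => /(_ pq); rewrite mulr1.
have -> : 1 / (p / (p - 1)) = 1 - p^-1 by rewrite -[X in _ = X - _]pq div1r; ring.
rewrite -(ler_pM2l p0) mulrDr mulrCA divff ?gt_eqF// mulr1 mulrBr mulr1 divff ?gt_eqF//.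
by lra.
Qed.

Lemma bernoulli_powR_concave s x : 0 < s < 1 -> 0 <= x -> x `^ s <= 1 + s * (x - 1).
Proof.
move=> /andP[s0 s1] x0.
have := @bernoulli_powR s^-1 (x `^ s) _ (powR_ge0 _ _).
rewrite invf_gt1// => /(_ s1); rewrite -powRrM divff ?gt_eqF// powRr1//.
by rewrite -(ler_pM2l s0) mulrDr mulr1 mulrA divff ?gt_eqF//; lra.
Qed.

(** As q may be below 1, Bernoulli's inequality is applied at exponent 1 + q, and x^(1+q) <= x^q. *)
Lemma powR_diff_le q x : 0 < q -> 0 <= x <= 1 -> 1 - x `^ q <= (1 + q) * (1 - x).
Proof.
move=> q0 /andP[x0 x1].
have := @bernoulli_powR (1 + q) x _ x0; rewrite ltrDl => /(_ q0).
have : x `^ (1 + q) <= x `^ q.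
  rewrite powRD; last by rewrite gt_eqF// addr_gt0.
  by rewrite (powRr1 x0) ler_piMl// powR_ge0.
by lra.
Qed.

Lemma powR_le1 q x : 0 < q -> 0 <= x <= 1 -> x `^ q <= 1.
Proof.
move=> q0 /andP[x0 x1]; have := @ge0_ler_powR R q (ltW q0) x 1.
by rewrite powR1 !nnegrE x0 ler01; exact.
Qed.

Lemma continuous_power q : 0 < q -> continuous (fun r : R => `|r| `^ q * r).
Proof.
move=> q0 x; have [->|x0] := eqVneq x 0.
  rewrite /continuous_at mulr0; apply/cvgrPdist_le => d d0.
  have m0 : 0 < Num.min d 1 by rewrite lt_min d0 ltr01.
  near=> r; rewrite sub0r normrN normrM (ger0_norm (powR_ge0 _ _)).
  have rd : `|r| <= Num.min d 1.
    near: r; have := @nbhsx_ballx R R 0 _ m0; apply: filterS => y.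
    by rewrite -ball_normE /= sub0r normrN => /ltW.
  move: rd; rewrite le_min => /andP[rd r1].
  rewrite (le_trans _ rd)// ler_piMl// powR_le1// normr_ge0//.
apply: cvgM; last exact: cvg_id.
have nx0 : 0 < `|x| by rewrite normr_gt0.
rewrite /continuous_at /powR (gt_eqF nx0).
apply: (@cvg_trans _ ((fun r : R => expR (q * ln `|r|)) @ x)).
  apply: near_eq_cvg; near=> r; rewrite gt_eqF//; near: r.
  by apply: (cvgr_gt `|x|) nx0; exact: norm_continuous.
suff : {for x, continuous (fun r : R => expR (q * ln `|r|))} by [].
apply: (@continuous_comp _ _ _ (fun r : R => q * ln `|r|) (@expR R)); last first.
  exact: continuous_expR.
apply: (@continuous_comp _ _ _ (fun r : R => ln `|r|) (fun y => q * y)); last first.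
  exact: mulrl_continuous.
apply: (@continuous_comp _ _ _ (fun r : R => `|r|) (@ln R)).
  exact: norm_continuous.
exact: continuous_ln.
Unshelve. all: by end_near. Qed.

Definition convexity_constant q B : R := (2 + q) * B `^ q.

(* b |-> |b|^p / p lies below its tangent at a up to a quadratic error; p = q + 2. *)
Lemma power_tangent q B a b : 0 < q -> `|a| <= B -> `|b| <= B ->
  `|b| `^ q * b ^+ 2 / (q + 2) <= `|a| `^ q * a ^+ 2 / (q + 2) +
     `|a| `^ q * a * (b - a) + convexity_constant q B * (b - a) ^+ 2.
Proof.
move=> q0 aB bB; rewrite -(real_normK (num_real b)) -[in X in _ <= X / _ + _ + _](real_normK (num_real a)).
set x := `|a|; set y := `|b|; have B0 : 0 <= B := le_trans (normr_ge0 a) aB.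
have x0 : 0 <= x := normr_ge0 a; have y0 : 0 <= y := normr_ge0 b.
have m0 : 0 < q + 2 by lra.
(* Convexity of the power (q + 2) / 2 in the squared variable, with tangent at y^2. Replacing y^q by
   x^q in the slope costs the product of differences bounded in [D1] and [D2]. *)
have T : y `^ q * y ^+ 2 + (q + 2) / 2 * y `^ q * (x ^+ 2 - y ^+ 2) <= x `^ q * x ^+ 2.
  have [y00|y_neq] := eqVneq y 0.
    by rewrite y00 powR0 ?gt_eqF// !(mul0r, mulr0) addr0 mulr_ge0 ?powR_ge0 ?sqr_ge0.
  have yp : 0 < y by rewrite lt_def y_neq.
  have := @bernoulli_powR ((q + 2) / 2) ((x / y) ^+ 2) _ (sqr_ge0 _).
  have m1 : 1 < (q + 2) / 2 by lra.
  move=> /(_ m1).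
  have xy0 : 0 <= x / y by rewrite divr_ge0.
  have E : ((x / y) ^+ 2) `^ ((q + 2) / 2) = (x / y) `^ q * (x / y) ^+ 2.
    rewrite -powR_mulrn// -powRrM (_ : 2 * _ = q + 2); last by field.
    by rewrite powRD ?(powR_mulrn 2 xy0)//; rewrite gt_eqF.
  have yq : 0 < y `^ q by rewrite powR_gt0.
  have Ex : x `^ q = (x / y) `^ q * y `^ q by rewrite -powRM// divfK.
  rewrite E Ex => H.
  have := ler_wpM2r (ltW (mulr_gt0 yq (exprn_gt0 2 yp))) H.
  rewrite (_ : (1 + (q + 2) / 2 * ((x / y) ^+ 2 - 1)) * (y `^ q * y ^+ 2) =
    y `^ q * y ^+ 2 + (q + 2) / 2 * y `^ q * (x ^+ 2 - y ^+ 2)); last by field.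
  move=> /le_trans; apply; rewrite le_eqVlt; apply/orP; left; apply/eqP; by field.
have Bq (z : R) : 0 <= z -> z <= B -> 0 <= z `^ q <= B `^ q.
  move=> z0 zB; rewrite powR_ge0 /=.
  by apply: ge0_ler_powR; rewrite ?nnegrE//; exact: ltW.
have D1 (z w : R) : 0 <= z -> z <= w -> w <= B ->
    (w `^ q - z `^ q) * (w ^+ 2 - z ^+ 2) <= 2 * (1 + q) * B `^ q * (w - z) ^+ 2.
  move=> z0 zw wB; have w0 : 0 <= w := le_trans z0 zw.
  have [w00|w_neq] := eqVneq w 0.
    have -> : z = 0 by apply/eqP; rewrite eq_le z0 -w00 zw.
    by rewrite w00 !subrr mul0r expr0n mulr0.
  have wp : 0 < w by rewrite lt_def w_neq.
  have zw1 : 0 <= z / w <= 1 by rewrite divr_ge0//= ler_pdivrMr// mul1r.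
  have wq : 0 <= w `^ q by exact: powR_ge0.
  have Ez : z `^ q = (z / w) `^ q * w `^ q by rewrite -powRM ?divfK//; case/andP: zw1.
  have H1 : (w `^ q - z `^ q) * w <= (1 + q) * w `^ q * (w - z).
    have := ler_wpM2r (mulr_ge0 wq w0) (powR_diff_le q0 zw1).
    rewrite (_ : (1 + q) * (1 - z / w) * (w `^ q * w) = (1 + q) * w `^ q * (w - z)); last by field.
    by apply: le_trans; rewrite Ez le_eqVlt; apply/orP; left; apply/eqP; ring.
  have [_ wqB] := andP (Bq w w0 wB).
  have d0 : 0 <= w - z by lra.
  have wzq : 0 <= w `^ q - z `^ q.
    by rewrite subr_ge0; apply: ge0_ler_powR; rewrite ?nnegrE//; exact: ltW.
  apply: (@le_trans _ _ (2 * ((w `^ q - z `^ q) * w) * (w - z))).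
    rewrite (_ : w ^+ 2 - z ^+ 2 = (w + z) * (w - z)); last by ring.
    rewrite mulrA; apply: ler_wpM2r => //.
    rewrite (_ : 2 * _ = (w `^ q - z `^ q) * (w + w)); last by ring.
    by apply: ler_wpM2l => //; lra.
  apply: (@le_trans _ _ (2 * ((1 + q) * w `^ q * (w - z)) * (w - z))).
    by rewrite ler_wpM2r// ler_wpM2l.
  rewrite (_ : 2 * ((1 + q) * w `^ q * (w - z)) * (w - z) =
    2 * (1 + q) * (w - z) ^+ 2 * w `^ q); last by ring.
  rewrite (_ : 2 * (1 + q) * B `^ q * (w - z) ^+ 2 =
    2 * (1 + q) * (w - z) ^+ 2 * B `^ q); last by ring.
  by apply: ler_wpM2l => //; rewrite mulr_ge0 ?sqr_ge0//; lra.
have D2 : (y `^ q - x `^ q) * (y ^+ 2 - x ^+ 2) <= 2 * (1 + q) * B `^ q * (y - x) ^+ 2.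
  have [xy|yx] := leP x y; first exact: D1.
  have := D1 y x y0 (ltW yx) aB; rewrite -[(x - y) ^+ 2]sqrrN opprB; apply: le_trans.
  by rewrite le_eqVlt; apply/orP; left; apply/eqP; ring.
have D3 : (y - x) ^+ 2 <= (b - a) ^+ 2.
  rewrite -[leRHS](real_normK (num_real _)) -[leLHS](real_normK (num_real _)).
  by apply: lerXn2r; rewrite ?nnegrE// ler_dist_dist.
have [xq0 xqB] := andP (Bq x x0 aB); have c0 : 0 <= B `^ q := powR_ge0 _ _.
have a2 : x ^+ 2 = a ^+ 2 by rewrite real_normK ?num_real.
have b2 : y ^+ 2 = b ^+ 2 by rewrite real_normK ?num_real.
have D4 : 2 * (1 + q) * B `^ q * (y - x) ^+ 2 <= 2 * (1 + q) * B `^ q * (b - a) ^+ 2.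
  by rewrite ler_wpM2l//; rewrite !mulr_ge0//; lra.
have D5 : x `^ q * (b - a) ^+ 2 <= B `^ q * (b - a) ^+ 2 by rewrite ler_wpM2r ?sqr_ge0.
have D6 : 0 <= B `^ q * (b - a) ^+ 2 by rewrite mulr_ge0 ?sqr_ge0.
rewrite -subr_ge0 -(pmulr_rge0 _ m0) /convexity_constant.
move: T D2 D4 D5 D6; rewrite a2 b2.
move: (x `^ q) (y `^ q) (B `^ q) ((y - x) ^+ 2) => X Y Z W T D2 D4 D5 D6.
have E : (q + 2) * (X * a ^+ 2 / (q + 2) + X * a * (b - a) + (2 + q) * Z * (b - a) ^+ 2 -
    Y * b ^+ 2 / (q + 2)) = X * a ^+ 2 - Y * b ^+ 2 +
    (q + 2) * (X * (b ^+ 2 - a ^+ 2) / 2 - (X * (b - a) ^+ 2) / 2 +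
      (2 + q) * (Z * (b - a) ^+ 2)) by field; rewrite gt_eqF.
rewrite E.
have E3 : (Y - X) * (b ^+ 2 - a ^+ 2) <= 2 * (1 + q) * (Z * (b - a) ^+ 2).
  by rewrite mulrA; exact: le_trans D2 D4.
move: (Z * (b - a) ^+ 2) (X * (b - a) ^+ 2) D5 D6 E3 => z0 x1 D5 D6 E3.
have : 0 <= q * z0 by rewrite mulr_ge0// ltW.
have : 0 <= (q + 2) * ((2 + q) * z0 - x1 / 2 - (1 + q) * z0).
  by rewrite mulr_ge0 ?(ltW m0)//; nra.
have : 0 <= (q + 2) * (2 * (1 + q) * z0 - (Y - X) * (b ^+ 2 - a ^+ 2)).
  by rewrite mulr_ge0 ?(ltW m0)// subr_ge0.
by lra.
Qed.

(** Bernoulli's inequality in the variable t^2, whose exponent n / 2 exceeds 1 as n >= 3. *)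
Lemma bernoulli_dilation n t : (3 <= n)%N -> 1 <= t ->
  1 + n%:R / 2 * (t ^+ 2 - 1) <= t ^+ n.
Proof.
move=> n3 t1; have t0 : 0 <= t by lra.
have n2 : 1 < n%:R / 2 :> R.
  by rewrite ltr_pdivlMr// mul1r ltr_nat.
apply: (le_trans (bernoulli_powR n2 (sqr_ge0 t))).
rewrite -(powR_mulrn 2 t0) -powRrM (_ : 2 * (n%:R / 2) = n%:R); last by field.
by rewrite powR_mulrn.
Qed.

Lemma dilation_fractional s t : 0 < s < 1 -> 1 <= t ->
  t `^ (2 * s) <= 1 + s * (t ^+ 2 - 1).
Proof.
move=> s01 t1; have t0 : 0 <= t by lra.
have E : (t ^+ 2) `^ s = t `^ (2 * s) by rewrite -(powR_mulrn 2 t0) -powRrM.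
by rewrite -E; exact: bernoulli_powR_concave (sqr_ge0 t).
Qed.

(** The remainder R_n = t^n - 1 - n (t - 1) satisfies R_(n+1) = t R_n + n (t - 1)^2; with t <= 2 and
    n <= 4^n it stays below 4^n (t - 1)^2. *)
Lemma dilation_upper n t : 1 <= t <= 2 ->
  t ^+ n <= 1 + n%:R / 2 * (t ^+ 2 - 1) + 4 ^+ n * (t - 1) ^+ 2.
Proof.
move=> /andP[t1 t2]; have e0 := sqr_ge0 (t - 1).
have p4 k : 0 <= 4 ^+ k :> R by exact: exprn_ge0.
suff H : t ^+ n - 1 - n%:R * (t - 1) <= 4 ^+ n * (t - 1) ^+ 2.
  have : 0 <= n%:R * (t - 1) ^+ 2 by rewrite mulr_ge0.
  have -> : n%:R / 2 * (t ^+ 2 - 1) = n%:R * (t - 1) + n%:R * (t - 1) ^+ 2 / 2 by field.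
  by lra.
elim: n => [|n IH]; first by rewrite !expr0 mul0r mul1r; lra.
have n4 : n%:R <= 4 ^+ n :> R.
  by rewrite -natrX ler_nat; apply/ltnW/ltn_expl.
have Rn0 : 0 <= t ^+ n - 1 - n%:R * (t - 1).
  elim: n {IH n4} => [|n IH]; first by rewrite expr0; lra.
  rewrite exprS -natr1.
  have -> : t * t ^+ n - 1 - (n%:R + 1) * (t - 1) =
    t * (t ^+ n - 1 - n%:R * (t - 1)) + n%:R * (t - 1) ^+ 2 by ring.
  by rewrite addr_ge0// mulr_ge0//; lra.
rewrite (exprS t n) (exprS 4 n) -[n.+1%:R]natr1.
have -> : t * t ^+ n - 1 - (n%:R + 1) * (t - 1) =
    t * (t ^+ n - 1 - n%:R * (t - 1)) + n%:R * (t - 1) ^+ 2 by ring.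
have H1 : t * (t ^+ n - 1 - n%:R * (t - 1)) <= 2 * (4 ^+ n * (t - 1) ^+ 2).
  by apply: ler_pM => //; lra.
have H2 : n%:R * (t - 1) ^+ 2 <= 4 ^+ n * (t - 1) ^+ 2 by rewrite ler_wpM2r.
have := mulr_ge0 (p4 n) e0.
by lra.
Qed.

End powers.

(** * The Pohozaev inequality from dilations *)

Section pohozaev.
Context {R : realType} (n : nat) (s : R).
Hypotheses (s01 : 0 < s < 1) (n3 : (3 <= n)%N).
Notation V := 'rV[R]_n.
Implicit Types (u : V -> R) (x z : V) (t tau A lam : R) (Om : set V).

Definition crit_power : R := crit_exp n - 2.

Definition nonlinearity lam r : R := `|r| `^ crit_power * r + lam * r.

Lemma crit_power_gt0 : 0 < crit_power.
Proof.
have n2 : 0 < n%:R - 2 :> R by rewrite subr_gt0 ltr_nat.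
rewrite /crit_power /crit_exp subr_gt0 ltr_pdivlMr//; lra.
Qed.

Lemma crit_powerE : (crit_power + 2)^-1 = (n%:R - 2) / (2 * n%:R) :> R.
Proof. by rewrite /crit_power /crit_exp subrK invf_div. Qed.

Lemma continuous_nonlinearity lam : continuous (nonlinearity lam).
Proof.
move=> r; apply: (@continuousD _ _ _ (fun r : R => `|r| `^ crit_power * r) (fun r : R => lam * r)).
  exact: continuous_power crit_power_gt0 _.
exact: mulrl_continuous.
Qed.

Lemma nonlinearity0 lam : nonlinearity lam 0 = 0.
Proof. by rewrite /nonlinearity !mulr0 addr0. Qed.

(* Collects the tested equation and the dilated energies; T, t2, ts stand for t ^ n,
   t ^ 2, t ^ (2 s) and m for n. *)
Lemma pohozaev_algebra (Q G D' G' M lam A T t2 ts m C e2 K beta S : R) :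
  0 < m -> 0 <= Q -> 0 <= A * G -> 1 <= T -> 0 <= D' -> 0 <= A * G' -> 0 <= beta ->
  1 + m / 2 * (t2 - 1) <= T -> T <= 1 + m / 2 * (t2 - 1) + K * e2 ->
  ts <= 1 + S * (t2 - 1) -> 0 <= e2 -> 0 <= K -> T <= K -> 0 <= C -> beta <= C * e2 ->
  0 <= M ->
  Q + (T^-1 - 1) * ((m - 2) / (2 * m) * (Q - lam * M) + lam * M / 2) - beta +
     2^-1 * D' + A / 2 * G' <=
  2^-1 * (1 + t2 / T) * (Q - A * G) + A / 2 * (1 + ts / T) * G ->
  A * ((1 - S) * (t2 - 1)) * G + D' + A * G' <=
    lam * M * (t2 - 1) + (2 / m * `|lam| * M * K + 2 * K * C) * e2.
Proof.
move=> m0 Q0 AG0 T1 D0 G0 beta0 TL TU tsU e0 K0 TK C0 bC M0 H.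
have T0 : 0 < T by lra.
have {H} := ler_wpM2l (ltW T0) H.
have -> : T * (2^-1 * (1 + t2 / T) * (Q - A * G) + A / 2 * (1 + ts / T) * G) =
   2^-1 * (T + t2) * Q + 2^-1 * (ts - t2) * (A * G) by field; rewrite gt_eqF.
have -> : T * (Q + (T^-1 - 1) * ((m - 2) / (2 * m) * (Q - lam * M) + lam * M / 2) - beta +
     2^-1 * D' + A / 2 * G') =
   T * Q + (1 - T) * ((m - 2) / (2 * m) * Q + lam * M / m) - T * beta +
     2^-1 * (T * D') + 2^-1 * (T * (A * G')) by field; rewrite !gt_eqF.
have H1 : 0 <= (2 / m * (T - (1 + m / 2 * (t2 - 1)))) * Q.
  by rewrite !mulr_ge0 ?invr_ge0 ?(ltW m0)// subr_ge0.
have E1 : 2 / m * (T - (1 + m / 2 * (t2 - 1))) * Q =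
    (2 * T - (T - 1) * ((m - 2) / m) - T - t2) * Q by field; rewrite gt_eqF.
rewrite E1 in H1.
have H2 : 0 <= (1 + S * (t2 - 1) - ts) * (A * G) by rewrite mulr_ge0// subr_ge0.
have H3 : 0 <= (T - 1) * D' by rewrite mulr_ge0// subr_ge0.
have H4 : 0 <= (T - 1) * (A * G') by rewrite mulr_ge0// subr_ge0.
have H5 : T * beta <= K * C * e2 by rewrite -mulrA ler_pM// ltW.
have H6 : (T - 1) * (2 / m) * (lam * M) <= lam * M * (t2 - 1) + 2 / m * `|lam| * M * K * e2.
  have d0 : 0 <= T - (1 + m / 2 * (t2 - 1)) by lra.
  have d1 : T - (1 + m / 2 * (t2 - 1)) <= K * e2 by lra.
  have E : (T - 1) * (2 / m) * (lam * M) = lam * M * (t2 - 1) +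
      2 / m * (lam * M * (T - (1 + m / 2 * (t2 - 1)))) by field; rewrite gt_eqF.
  rewrite E lerD2l.
  have -> : 2 / m * `|lam| * M * K * e2 = 2 / m * (`|lam| * M * (K * e2)) by ring.
  rewrite ler_wpM2l ?divr_ge0 ?(ltW m0)//.
  apply: (@le_trans _ _ (`|lam| * M * (T - (1 + m / 2 * (t2 - 1))))).
    by rewrite ler_wpM2r// ler_wpM2r// ler_norm.
  by rewrite ler_wpM2l// mulr_ge0.
have E2 : (m - 2) / (2 * m) = 2^-1 * ((m - 2) / m) by field; rewrite gt_eqF.
have E3 : lam * M / m = 2^-1 * (2 / m * (lam * M)) by field; rewrite gt_eqF.
rewrite E2 E3; move: ((m - 2) / m) H1 => m1 H1.
rewrite -mulrA in H6; move: (2 / m * (lam * M)) H6 => Y H6 H.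
by move: (lam * M) (2 / m * `|lam| * M * K) H6 => lM KK H6; lra.
Qed.

(** Pohozaev's identity in integrated form, as an inequality valid for each t. The energies of the
    difference between u and its dilation are kept on the left: they carry the information of the
    boundary term. *)
Theorem key_inequality A lam Om u z : 0 <= A -> Cc u ->
  (forall x, ~ Om x -> u x = 0) ->
  weak_solution s A Om u (fun x => nonlinearity lam (u x)) ->
  (forall t x, 1 < t -> u (z - t *: z + t *: x) != 0 -> Om x) ->
  exists C, 0 <= C /\ forall t tau, 1 < t <= 2 -> 0 < tau ->
    A * ((1 - s) * (t ^+ 2 - 1)) * Gform s u u +
    Dform (fun x => u x - u (z - t *: z + t *: x))
          (fun x => u x - u (z - t *: z + t *: x)) tau +
    A * Gform s (fun x => u x - u (z - t *: z + t *: x))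
                (fun x => u x - u (z - t *: z + t *: x)) <=
    lam * Int (fun x => u x ^+ 2) * (t ^+ 2 - 1) + C * (t - 1) ^+ 2.
Proof.
move=> A0 Cu u0 weak star.
pose fu x := nonlinearity lam (u x).
have Cfu : Cc fu by apply: Cc_comp => //; [exact: continuous_nonlinearity|exact: nonlinearity0].
have [ui EL] := energy_le A0 Cu Cfu u0 weak.
set Q := Int (fun x => u x * fu x) in EL.
set G := Gform s u u in EL *.
have G0 : 0 <= G := Gform_ge0 s u.
have AG0 : 0 <= A * G by rewrite mulr_ge0.
have QAG0 : 0 <= Q - A * G.
  by have := EL 1 ltr01; have := Dform_ge0 u 1; lra.
have Q0 : 0 <= Q by lra.
(* The uniform bound on difference quotients is what makes the L^2 distance between u and its
   dilation of order t - 1. *)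
have [L [L0 uL]] : exists L, 0 <= L /\ forall h, Lam u u h <= L * `|h| ^+ 2.
  apply: (Lam_le_sqr Cu QAG0) => t t0.
  by have := EL t t0; lra.
have [C2 [C20 dil]] := dilation_L2 z Cu L0 uL.
have [B uB] := Cc_bounded Cu.
have B0 : 0 <= B := le_trans (normr_ge0 _) (uB 0).
pose q := crit_power.
have q0 : 0 < q := crit_power_gt0.
pose C1 := convexity_constant q B + `|lam| / 2.
have C10 : 0 <= C1.
  by rewrite /C1 /convexity_constant addr_ge0// ?divr_ge0// mulr_ge0 ?powR_ge0//; lra.
pose m : R := n%:R.
have m0 : 0 < m by rewrite ltr0n; exact: leq_trans n3.
(* The primitive of the nonlinearity; its integral is exactly multiplied by t^-n under dilation. *)
pose Phi r : R := `|r| `^ q * r ^+ 2 / (q + 2) + lam * r ^+ 2 / 2.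
pose M := Int (fun x => u x ^+ 2).
have M0 : 0 <= M by apply: Int_ge0 => x; exact: sqr_ge0.
have Cu2 : Cc (fun x => u x ^+ 2) by apply: CcM Cu (Cc_continuous Cu).
have Cpu : Cc (fun x => `|u x| `^ q * u x).
  by apply: (Cc_comp (phi := fun r => `|r| `^ q * r)) => //;
    [exact: continuous_power|rewrite mulr0].
have Cp2 : Cc (fun x => `|u x| `^ q * u x ^+ 2).
  rewrite (_ : (fun _ => _) = fun x => (`|u x| `^ q * u x) * u x).
    by apply: CcM Cpu (Cc_continuous Cu).
  by apply/funext => x; ring.
pose N := Int (fun x => `|u x| `^ q * u x ^+ 2).
have i2 := Cc_Intg Cu2; have ip2 := Cc_Intg Cp2.
have QE : Q = N + lam * M.
  rewrite /N /M -(IntZ lam i2) -(IntD ip2 (IntgZ lam i2)).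
  by apply: eq_Int => x; rewrite /fu /nonlinearity -/q; ring.
have CPhi : Cc (fun x => Phi (u x)).
  rewrite (_ : (fun _ => _) = fun x =>
    (q + 2)^-1 * (`|u x| `^ q * u x ^+ 2) + (lam / 2) * u x ^+ 2).
    by apply: CcD; exact: CcZ.
  by apply/funext => x; rewrite /Phi; ring.
have PhiE : Int (fun x => Phi (u x)) = (m - 2) / (2 * m) * (Q - lam * M) + lam * M / 2.
  rewrite QE addrK -crit_powerE -/q.
  have -> : lam * M / 2 = (lam / 2) * M by ring.
  rewrite /N /M -(IntZ _ ip2) -(IntZ _ i2) -(IntD (IntgZ _ ip2) (IntgZ _ i2)).
  by apply: eq_Int => x; rewrite /Phi; ring.
exists (2 / m * `|lam| * M * 4 ^+ n + 2 * 4 ^+ n * (C1 * C2)); split.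
  by rewrite addr_ge0// !mulr_ge0 ?invr_ge0 ?exprn_ge0// ltW.
move=> t tau /andP[t1 t2] tau0.
have t0 : 0 < t by lra.
have tT : 1 <= t <= 2 by rewrite t2 ltW.
pose c := z - t *: z.
have Cut : Cc (fun x => u (c + t *: x)) by apply: Cc_affine => //; rewrite gt_eqF.
have EP := energy_pair A0 Cu Cfu u0 weak (c := c) t0 tau0 (fun x => star t x t1).
rewrite -/Q -/G in EP.
pose d x := u x - u (c + t *: x).
have Cd : Cc d by exact: CcB.
have Cd2 : Cc (fun x => d x ^+ 2) by apply: CcM Cd (Cc_continuous Cd).
pose beta := C1 * Int (fun x => d x ^+ 2).
have CPhit : Cc (fun x => Phi (u (c + t *: x))).
  by apply: (@Cc_affine R n c t (fun x => Phi (u x))) => //; rewrite gt_eqF.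
have PhitE : Int (fun x => Phi (u (c + t *: x))) = (t ^+ n)^-1 * Int (fun x => Phi (u x)).
  rewrite (Int_affine c (lt0r_neq0 t0) (Cc_Intg CPhi)) (gtr0_norm t0).
  by rewrite mulKf// expf_neq0// gt_eqF.
(* With a = u(x) and b the dilated value, Phi(b) <= Phi(a) + f(a) (b - a) + C1 (b - a)^2 bounds f(a)
   b from below. *)
have lower : Q + ((t ^+ n)^-1 - 1) * Int (fun x => Phi (u x)) - beta <=
    Int (fun x => u (c + t *: x) * fu x).
  have -> : Q + ((t ^+ n)^-1 - 1) * Int (fun x => Phi (u x)) - beta =
      Int (fun x => (u x * fu x + (Phi (u (c + t *: x)) - Phi (u x))) - C1 * d x ^+ 2).
    have Ca : Intg (fun x => u x * fu x).
      by apply: Cc_Intg; apply: CcM Cu (Cc_continuous Cfu).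
    have Cb : Intg (fun x => Phi (u (c + t *: x)) - Phi (u x)).
      by apply: IntgB; exact: Cc_Intg.
    have Ce : Intg (fun x => C1 * d x ^+ 2) by apply: IntgZ; exact: Cc_Intg.
    rewrite (IntB (IntgD Ca Cb) Ce) (IntD Ca Cb) (IntB (Cc_Intg CPhit) (Cc_Intg CPhi)).
    by rewrite PhitE (IntZ _ (Cc_Intg Cd2)) -/Q /beta; ring.
  apply: le_Int.
  - apply: Cc_Intg; apply: CcB; last exact: CcZ.
    apply: CcD; last exact: CcB.
    by apply: CcM Cu (Cc_continuous Cfu).
  - by apply: Cc_Intg; apply: CcM Cut (Cc_continuous Cfu).
  move=> x; rewrite /fu /d /nonlinearity -/q /Phi /C1.
  have := power_tangent q0 (uB x) (uB (c + t *: x)).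
  move: (u (c + t *: x)) (u x) => b a.
  move: (`|b| `^ q * b ^+ 2 / (q + 2)) => pb.
  move: (convexity_constant q B) => K P.
  have E : `|a| `^ q * a ^+ 2 = a * (`|a| `^ q * a) by ring.
  have P2 : lam * (b - a) ^+ 2 / 2 <= `|lam| / 2 * (a - b) ^+ 2.
    rewrite (_ : (b - a) ^+ 2 = (a - b) ^+ 2); last by ring.
    by rewrite mulrAC ler_wpM2r ?sqr_ge0// ler_pM2r// ler_norm.
  move: (`|a| `^ q) P E => X P E.
  move: (X * a ^+ 2 / (q + 2)) P => pa P.
  by lra.
have bC : beta <= C1 * C2 * (t - 1) ^+ 2.
  rewrite /beta -mulrA ler_wpM2l//; apply: dil.
  by rewrite t1.
rewrite PhiE in lower.
have TK : t ^+ n <= 4 ^+ n.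
  by apply: lerXn2r; rewrite ?nnegrE ?(ltW t0)//; lra.
have T1 : 1 <= t ^+ n by apply: exprn_ege1; exact: ltW.
have AG'0 : 0 <= A * Gform s d d by rewrite mulr_ge0// Gform_ge0.
have beta0 : 0 <= beta.
  by rewrite /beta mulr_ge0//; apply: Int_ge0 => x; exact: sqr_ge0.
apply: (@pohozaev_algebra Q G (Dform d d tau) (Gform s d d) M lam A (t ^+ n) (t ^+ 2)
  (t `^ (2 * s)) m (C1 * C2) ((t - 1) ^+ 2) (4 ^+ n) beta s m0 Q0 AG0 T1 (Dform_ge0 d tau)
  AG'0 beta0) => //.
- by apply: bernoulli_dilation => //; exact: ltW.
- exact: dilation_upper.
- by apply: dilation_fractional => //; exact: ltW.
- exact: sqr_ge0.
- exact: mulr_ge0.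
have := EP; rewrite -/d; move: lower.
by move: (Int (fun x => u (c + t *: x) * fu x)) => I1; lra.
Qed.

End pohozaev.

(** * The fractional eigenvalue and the Gagliardo form *)

Section eigenvalue.
Context {R : realType} (n : nat) (s : R).
Hypothesis s01 : 0 < s < 1.
Notation V := 'rV[R]_n.
Implicit Types (u v w : V -> R) (x y h : V) (Om K : set V) (lam a A : R).

(** Nonnegativity suffices: vanishing of the constant is treated in [reduction] along with a = 0. *)
Lemma c_frac_ge0 : 0 <= c_frac n s.
Proof.
have G0 r : 0 <= Gamma r :> R.
  rewrite /Gamma /Rintegral fine_ge0//; apply: integral_ge0 => t _.
  by rewrite lee_fin mulr_ge0 ?powR_ge0 ?expR_ge0.
move: s01 => /andP[s0 _].
by rewrite /c_frac divr_ge0 ?mulr_ge0 ?powR_ge0 ?G0// ltW.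
Qed.

Lemma weak_solution_of_classical a lam Om u : open Om -> C2 Om u -> Cc u ->
  is_solution s a lam Om u ->
  weak_solution s (a * (c_frac n s / 2)) Om u (fun x => nonlinearity n lam (u x)).
Proof.
move=> oOm uC2 Cu [eqn _] v K Cv cK KOm vK.
have [fi uvi fE] := frac_weak s01 oOm uC2 cK KOm Cu Cv vK.
split => // t_ t0 tcv.
have [li Dcv] := Dform_laplacian_cvg oOm uC2 cK KOm Cu Cv vK t0 tcv.
suff -> : Int (fun x => v x * nonlinearity n lam (u x)) -
    a * (c_frac n s / 2) * Gform s u v = Int (fun x => v x * - laplacian u x) by [].
rewrite -mulrA -fE; apply/eqP; rewrite subr_eq; apply/eqP.
rewrite -(IntZ a fi) -(IntD li (IntgZ a fi)); apply: eq_Int => x.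
have [Kx|/vK ->] := pselect (K x); last by rewrite !mul0r mulr0 addr0.
rewrite mulrCA -mulrDr; congr (_ * _).
by rewrite (eqn x (KOm x Kx)).
Qed.

(** The substitution y = x + h followed by Tonelli. *)
Lemma integral_gagliardo w : Cc w -> Intg (fun h => ker s h * Lam w w h) ->
  (\int[lebesgue_rV n]_x \int[lebesgue_rV n]_y
    (`|w x - w y| ^+ 2 / enorm (x - y) `^ (n%:R + 2 * s))%:E = (Gform s w w)%:E)%E.
Proof.
move=> Cw wi; have mw := Cc_measurable Cw.
pose F (p : V * V) : R := ker s p.2 * (w (p.1 + p.2) - w p.1) ^+ 2.
have mF : measurable_fun setT F.
  apply: measurable_funM; first exact: (measurable_snd_comp (measurable_ker s)).
  apply: measurable_funX.
  apply: (@measurable_funB _ _ _ _ (fun p : V * V => w (p.1 + p.2)) (fun p => w p.1)).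
    by have := measurable_combination 1 1 mw; under eq_fun do rewrite !scale1r.
  exact: measurable_fst_comp.
have F0 p : 0 <= F p by rewrite mulr_ge0 ?ker_ge0 ?sqr_ge0.
transitivity (\int[lebesgue_rV n]_x \int[lebesgue_rV n]_h (F (x, h))%:E)%E.
  apply: eq_integral => x _.
  rewrite [LHS](ge0_integral_affine_EFin x (oner_neq0 R)).
  - rewrite normr1 expr1n mul1e; apply: eq_integral => h _; congr EFin.
    rewrite scale1r /F /=; rewrite opprD addrA subrr sub0r enormN /ker mulrC distrC.
    by rewrite real_normK ?num_real.
  - rewrite (_ : (fun y => _) = fun y => F (x, y - x)).
      have := measurable_fun_pair2 x mF => /(measurable_affine_comp (- x) 1).
      by under eq_fun do rewrite scale1r addrC.
    apply/funext => y; have E3 : x + (y - x) = y by rewrite addrC subrK.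
    rewrite /F /= E3 /ker -(opprB x y) enormN mulrC distrC.
    by rewrite real_normK ?num_real.
  - by move=> y; rewrite divr_ge0 ?powR_ge0 ?sqr_ge0.
rewrite (fubini_tonelli (fun p => (F p)%:E)); last 2 first.
- exact/measurable_EFinP.
- by move=> p; rewrite lee_fin.
rewrite -Intg_EFin//; apply: eq_integral => h _.
have li := Intg_Lam h Cw Cw.
rewrite /Lam -(IntZ _ li) -Intg_EFin; last exact: IntgZ.
by apply: eq_integral => x _; rewrite /F /= expr2.
Qed.

Lemma poweR_half_sqr (r : R) : 0 <= r -> ((r%:E `^ 2^-1) ^+ 2 = r%:E)%E.
Proof.
move=> r0; rewrite poweR_EFin -EFin_expe; congr EFin.
by rewrite -powR_mulrn ?powR_ge0// -powRrM mulVf ?powRr1.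
Qed.

(** Rayleigh quotient: w divided by the square root of its mass is a competitor in the infimum. *)
Lemma lambda1_le Om w : Cc w -> (forall x, ~ Om x -> w x = 0) ->
  Intg (fun h => ker s h * Lam w w h) -> 0 < Int (fun x => w x ^+ 2) ->
  (lambda1 s Om <= (c_frac n s / 2 * Gform s w w / Int (fun x => w x ^+ 2))%:E)%E.
Proof.
move=> Cw w0 wi; set M := Int _ => M0.
pose k := (Num.sqrt M)^-1.
have sM : 0 < Num.sqrt M by rewrite sqrtr_gt0.
have k2 : k ^+ 2 = M^-1 by rewrite exprVn sqr_sqrtr// ltW.
pose v x := k * w x.
have Cv : Cc v by exact: CcZ.
have LE : (fun h => ker s h * Lam v v h) = fun h => k ^+ 2 * (ker s h * Lam w w h).
  by apply/funext => h; rewrite /v Lam_scale//; ring.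
have vi : Intg (fun h => ker s h * Lam v v h) by rewrite LE; exact: IntgZ.
have GE : Gform s v v = Gform s w w / M.
  by rewrite /Gform LE (IntZ _ wi) k2 mulrC.
apply: ereal_inf_lbound; exists v; last first.
  rewrite /gagliardo integral_gagliardo// -EFinM poweR_half_sqr; last first.
    by rewrite mulr_ge0 ?Gform_ge0// divr_ge0// c_frac_ge0.
  by rewrite GE mulrA.
split; first exact: Cc_measurable; last first.
  by move=> x /w0; rewrite /v => ->; rewrite mulr0.
have Cw2 : Cc (fun x => w x ^+ 2) by apply: CcM Cw (Cc_continuous Cw).
rewrite unlock.
suff -> : (\int[lebesgue_rV n]_x (`|(EFin \o v) x| `^ 2) = 1)%E by rewrite poweR_EFin powR1.
  transitivity (\int[lebesgue_rV n]_x (k ^+ 2 * w x ^+ 2)%:E)%E.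
    apply: eq_integral => x _; rewrite -[LHS]/((`|v x|%R `^ 2)%R%:E)%E; congr EFin.
    by rewrite powR_mulrn// real_normK ?num_real// /v exprMn.
  rewrite Intg_EFin; last by apply: IntgZ; exact: Cc_Intg.
  by rewrite (IntZ _ (Cc_Intg Cw2)) k2 -/M mulVf// gt_eqF.
Qed.

Lemma Lam_le_mass w h : Cc w -> Lam w w h <= 4 * Int (fun x => w x ^+ 2).
Proof.
move=> Cw; have Cw2 : Cc (fun x => w x ^+ 2) by apply: CcM Cw (Cc_continuous Cw).
have i2 := Cc_Intg Cw2; have i2h := Intg_shift h i2.
have -> : 4 * Int (fun x => w x ^+ 2) =
    Int (fun x => 2 * w (x + h) ^+ 2 + 2 * w x ^+ 2).
  rewrite (IntD (IntgZ 2 i2h) (IntgZ 2 i2)) (IntZ 2 i2h) (IntZ 2 i2).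
  by rewrite (Int_shift h i2); ring.
apply: le_Int; [exact: Intg_Lam|exact: (IntgD (IntgZ 2 i2h) (IntgZ 2 i2))|move=> x].
move: (w (x + h)) (w x) => p q.
by have := sqr_ge0 (p + q); lra.
Qed.

(** The quadratic bound for small h and the mass bound for large h add up to a multiple of
    [ker_weight]. This gives a finite Gagliardo energy also when A = 0. *)
Lemma Intg_ker_Lam w L : Cc w -> 0 <= L -> (forall h, Lam w w h <= L * `|h| ^+ 2) ->
  Intg (fun h => ker s h * Lam w w h).
Proof.
move=> Cw L0 wL; set M := Int (fun x => w x ^+ 2).
have M0 : 0 <= M by apply: Int_ge0 => x; exact: sqr_ge0.
apply: (le_Intg (g := fun h => (L + 4 * M) * ker_weight s h)).
- exact: measurable_ker_Lam.
- move=> h; rewrite ger0_norm ?mulr_ge0 ?ker_ge0 ?Lam_ge0//.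
  rewrite /ker_weight mulrA mulrC ler_wpM2r ?ker_ge0//.
  have h2 : `|h| ^+ 2 <= enorm h ^+ 2.
    by rewrite lerXn2r ?nnegrE ?enorm_ge0// norm_le_enorm.
  have e0 := sqr_ge0 (enorm h).
  have := wL h; have := Lam_le_mass h Cw; rewrite -/M => b1 b2.
  have b3 : L * `|h| ^+ 2 <= L * enorm h ^+ 2 by rewrite ler_wpM2l.
  have b4 : 0 <= 4 * M * enorm h ^+ 2 by apply: mulr_ge0 => //; apply: mulr_ge0.
  by rewrite minEle; case: ifP => _; lra.
- by apply: IntgZ; exact: Intg_ker_weight.
Qed.

Lemma Lam_disjoint w d h : Cc w -> (forall x, d < `|x| -> w x = 0) -> 2 * d < `|h| ->
  Lam w w h = 2 * Int (fun x => w x ^+ 2).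
Proof.
move=> Cw wd dh; have Cw2 : Cc (fun x => w x ^+ 2) by apply: CcM Cw (Cc_continuous Cw).
have i2 := Cc_Intg Cw2; have i2h := Intg_shift h i2.
have -> : 2 * Int (fun x => w x ^+ 2) = Int (fun x => w (x + h) ^+ 2 + w x ^+ 2).
  by rewrite (IntD i2h i2) (Int_shift h i2); ring.
apply: eq_Int => x; have [xd|xd] := ltP d `|x|; first by rewrite (wd x xd); ring.
rewrite (wd (x + h)); first by ring.
by have := ler_normB (x + h) x; rewrite addrAC subrr add0r; lra.
Qed.

(** For h longer than twice the radius of the support, w and its translate do not overlap and
    [Lam w w h] is twice the mass. The form is bounded below on a bump [psi] of such h, where the
    kernel has a positive lower bound. *)
Lemma Gform_gt0 w : (0 < n)%N -> Cc w -> Intg (fun h => ker s h * Lam w w h) ->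
  0 < Int (fun x => w x ^+ 2) -> 0 < Gform s w w.
Proof.
move=> n0 Cw wi; set M := Int _ => M0; have [_ [d wd]] := Cw.
pose h0 : V := const_mx (2 * `|d| + 2).
have h0E : `|h0| = 2 * `|d| + 2.
  have p0 : 0 <= 2 * `|d| + 2 by rewrite addr_ge0// mulr_ge0.
  apply/eqP; rewrite eq_le; apply/andP; split.
    by apply: norm_rV_le => // i; rewrite mxE ger0_norm.
  by have := coord_le_norm h0 (Ordinal n0); rewrite mxE ger0_norm.
pose psi (h : V) : R := Num.max (1 - `|h - h0|) 0.
have cpsi : continuous psi.
  move=> x; have ch : {for x, continuous (fun h : V => `|h - h0|)}.
    apply: (@continuous_comp _ _ _ (fun h : V => h - h0) (fun h : V => `|h|)).
      by apply: (@continuousB _ _ _ id (fun=> h0)); [exact: cvg_id|exact: cst_continuous].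
    exact: norm_continuous.
  apply: (@continuous_max _ _ (fun h : V => 1 - `|h - h0|) (fun=> 0)).
    exact: (continuousB (@cst_continuous _ _ (1 : R) x) ch).
  exact: cst_continuous.
have psi0 h : 0 <= psi h by rewrite le_max lexx orbT.
have far h : psi h != 0 -> 2 * `|d| + 1 < `|h| < 2 * `|d| + 3.
  rewrite /psi; have [h1|h1] := leP (1 - `|h - h0|) 0; first by rewrite eqxx.
  move=> _; have := ler_normD (h0 - h) h; have := ler_normD (h - h0) h0.
  rewrite !subrK (distrC h0) h0E => ? ?.
  by apply/andP; split; lra.
have Cpsi : Cc psi.
  split => //; exists (2 * `|d| + 3) => h dh; apply/eqP; apply: contraT => /far /andP[_].
  by rewrite ltNge ltW.
have Ipsi : 0 < Int psi.
  apply: (@Int_gt0 _ _ psi h0) => //; first exact: Cc_Intg.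
  by rewrite /psi subrr normr0 subr0 max_l.
pose k := ((n%:R * (2 * `|d| + 3)) `^ (n%:R + 2 * s))^-1.
have d0 := normr_ge0 d.
have nd : 0 < n%:R * (2 * `|d| + 3) by rewrite mulr_gt0// ?ltr0n//; lra.
have k0 : 0 < k by rewrite invr_gt0 powR_gt0.
have kk h : psi h != 0 -> k <= ker s h.
  move=> /far /andP[h1 h2]; have e0 : 0 < enorm h.
    by apply: lt_le_trans (norm_le_enorm h); lra.
  rewrite lef_pV2 ?posrE ?powR_gt0//; apply: ge0_ler_powR.
  - by move: s01 => /andP[s0 _]; rewrite addr_ge0// mulr_ge0// ltW.
  - by rewrite nnegrE ltW.
  - by rewrite nnegrE ltW.
  - by rewrite (le_trans (enorm_le_norm h))// ler_wpM2l// ltW.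
apply: (@lt_le_trans _ _ (2 * M * k * Int psi)); first by rewrite !mulr_gt0.
rewrite -(IntZ _ (Cc_Intg Cpsi)); apply: le_Int => //; first by apply: IntgZ; exact: Cc_Intg.
move=> h; have [->|ph] := eqVneq (psi h) 0.
  by rewrite mulr0 mulr_ge0 ?ker_ge0 ?Lam_ge0.
have /andP[h1 _] := far h ph; have dn := ler_norm d.
rewrite (Lam_disjoint Cw wd); last by lra.
have kpsi : k * psi h <= ker s h.
  apply: (le_trans _ (kk h ph)); rewrite ler_piMr ?(ltW k0)//.
  by rewrite /psi ge_max ler01 andbT lerBlDr lerDl.
have M20 : 0 <= 2 * M by rewrite mulr_ge0// ltW.
by rewrite -/M -(mulrA (2 * M)) (mulrC (ker s h)); exact: ler_wpM2l.
Qed.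

End eigenvalue.

(** * Consequences of the key inequality *)

Section nonexistence.
Context {R : realType} (n : nat) (s : R).
Hypotheses (s01 : 0 < s < 1) (n3 : (3 <= n)%N).
Notation V := 'rV[R]_n.
Implicit Types (u v w : V -> R) (x y h z : V) (Om K : set V) (lam a A t : R).

(** Extracts the first-order part of an estimate with quadratic error, in place of dividing by eta
    and passing to the limit. *)
Lemma le0_of_quadratic (X C : R) : 0 <= C ->
  (forall eta, 0 < eta <= 1 -> X * eta <= C * eta ^+ 2) -> X <= 0.
Proof.
move=> C0 H; rewrite leNgt; apply/negP => X0.
have D0 : 0 < 2 * (C + X) by lra.
have e0 : 0 < X / (2 * (C + X)) by rewrite divr_gt0.
have e1 : X / (2 * (C + X)) <= 1 by rewrite ler_pdivrMr// mul1r; lra.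
have eE : X / (2 * (C + X)) * (2 * (C + X)) = X by rewrite divfK// gt_eqF.
have := H _ (introT andP (conj e0 e1)); move: (X / _) e0 e1 eE => e e0 e1 eE He.
have He2 : X <= C * e by rewrite -(ler_pM2r e0) -mulrA -expr2.
have := ler_wpM2r (ltW D0) He2; rewrite -mulrA eE.
by have := mulr_gt0 X0 X0; have := mulr_ge0 C0 (ltW X0); lra.
Qed.

(** Lower counterpart of [dilation_fractional]: the concave Bernoulli inequality at t^-2 instead of
    t^2. *)
Lemma dilation_fractional_lower t : 1 <= t <= 2 ->
  s / 2 * (t - 1) <= t `^ (2 * s) - 1.
Proof.
move=> /andP[t1 t2]; have t0 : 0 < t by lra.
have := bernoulli_powR_concave s01 (sqr_ge0 t^-1).
set P := t `^ (2 * s).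
have P1 : 1 <= P.
  rewrite /P -[leLHS](powRr0 t); apply: ler_powR => //.
  by move: s01 => /andP[s0 _]; apply: mulr_ge0 => //; exact: ltW.
have P0 : 0 < P by lra.
have -> : (t^-1 ^+ 2) `^ s = P^-1.
  by rewrite -powR_mulrn ?invr_ge0 ?ltW// -powRrM -powR_inv1 ?ltW// -powRrM mulN1r powRN.
rewrite -(ler_pM2l P0) divff ?gt_eqF// => H.
have ti : t^-1 ^+ 2 <= 1 by rewrite exprn_ile1 ?invr_ge0 ?(ltW t0)// invf_le1.
have s0 : 0 < s by case/andP: s01.
have H2 : s * (1 - t^-1 ^+ 2) <= P * (s * (1 - t^-1 ^+ 2)).
  by rewrite ler_peMl// mulr_ge0 ?subr_ge0// ltW.
have H3 : 2^-1 * (t - 1) <= 1 - t^-1 ^+ 2.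
  have t20 : 0 < t ^+ 2 by rewrite exprn_gt0.
  rewrite -(ler_pM2r t20) mulrBl mul1r -exprMn mulVf ?gt_eqF// expr1n.
  have -> : t ^+ 2 - 1 = (t - 1) * (t + 1) by ring.
  have -> : 2^-1 * (t - 1) * t ^+ 2 = (t - 1) * (t ^+ 2 / 2) by ring.
  by rewrite ler_wpM2l//; [lra|nra].
have := ler_wpM2l (ltW s0) H3; lra.
Qed.

Lemma Lam_scalel (k : R) u v h : Cc u -> Cc v ->
  Lam (fun x => k * u x) v h = k * Lam u v h.
Proof.
move=> Cu Cv; rewrite /Lam -(IntZ _ (Intg_Lam h Cu Cv)).
by apply: eq_Int => x; ring.
Qed.

Definition mass u := Int (fun x => u x ^+ 2).

Lemma mass_ge0 u : 0 <= mass u.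
Proof. by apply: Int_ge0 => x; exact: sqr_ge0. Qed.

Lemma dilation_bound_linear (X C eta : R) : 0 < eta -> X <= 0 ->
  0 <= X * ((1 + eta) ^+ 2 - 1) + C * (1 + eta - 1) ^+ 2 -> - X * eta <= C * eta ^+ 2.
Proof.
move=> e0 X0; rewrite [1 + eta - 1]addrAC subrr add0r.
have : 0 <= - X * (eta * (1 + eta)) by rewrite !mulr_ge0 ?oppr_ge0//; lra.
by lra.
Qed.

Lemma critical_expansion (B lam G M g m p q k : R) : B * G = lam * M ->
  B * (k ^+ 2 * G + g - 2 * (k * p)) - lam * (k ^+ 2 * M + m - 2 * k * q) =
  B * g - lam * m - 2 * k * (B * p - lam * q).
Proof.
move=> E; apply/eqP; rewrite -subr_eq0.
by rewrite (_ : _ - _ = k ^+ 2 * (B * G - lam * M)); [rewrite E subrr mulr0|ring].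
Qed.

(* If the variational inequality is saturated by u, then u is a critical point of
   the quadratic form q = A (1 - s) G - lam |.|^2, so q (u - u_t) = q (u_t), which is
   of order t - 1, while the key inequality forces it to be of order (t - 1)^2. *)
Lemma saturated_contradiction A lam C Om u z : 0 < A -> 0 <= C -> Cc u ->
  (forall x, ~ Om x -> u x = 0) ->
  (forall t x, 1 < t -> u (z - t *: z + t *: x) != 0 -> Om x) ->
  Intg (fun h => ker s h * Lam u u h) -> 0 < mass u ->
  (forall w, Cc w -> (forall x, ~ Om x -> w x = 0) ->
    Intg (fun h => ker s h * Lam w w h) -> lam * mass w <= A * (1 - s) * Gform s w w) ->
  (forall t, 1 < t <= 2 -> A * ((1 - s) * (t ^+ 2 - 1)) * Gform s u u +
     A * Gform s (fun x => u x - u (z - t *: z + t *: x))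
                 (fun x => u x - u (z - t *: z + t *: x)) <=
    lam * mass u * (t ^+ 2 - 1) + C * (t - 1) ^+ 2) -> False.
Proof.
move=> A0 C0 Cu u0 star ui M0 E key.
have /andP[s0 s1] := s01.
have n0 : (0 < n)%N by exact: leq_trans n3.
have G0 : 0 < Gform s u u := Gform_gt0 s01 n0 Cu ui M0.
set G := Gform s u u in G0 key; set M := mass u in M0 key.
have EX := E u Cu u0 ui; rewrite -/G -/M in EX.
(* The first-order part of the key inequality; with [EX] it gives equality in the variational
   inequality for u. *)
have X0 : A * (1 - s) * G - lam * M <= 0.
  apply: (le0_of_quadratic C0) => eta /andP[e0 e1].
  have t12 : 1 < 1 + eta <= 2 by apply/andP; split; lra.
  have := key _ t12; rewrite addrAC subrr add0r.
  have -> : (1 + eta) ^+ 2 - 1 = eta * (2 + eta) by ring.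
  have := Gform_ge0 s (fun x => u x - u (z - (1 + eta) *: z + (1 + eta) *: x)).
  move=> /(mulr_ge0 (ltW A0)); move: (A * Gform _ _ _) => Gd Gd0.
  have : 0 <= (A * (1 - s) * G - lam * M) * (eta * (1 + eta)).
    by rewrite mulr_ge0 ?subr_ge0// mulr_ge0; lra.
  by lra.
have XE : A * (1 - s) * G = lam * M by apply/eqP; rewrite eq_le EX andbT; lra.
have lM0 : 0 < lam * M by rewrite -XE !mulr_gt0//; lra.
have lam0 : 0 < lam by rewrite -(pmulr_lgt0 _ M0).
(* This positive number is a lower bound for q(u_t) / (t - 1) on 1 < t <= 2. *)
suff : (2 ^+ n)^-1 * (s / 2) * (lam * M) <= 0.
  by rewrite leNgt !mulr_gt0 ?invr_gt0 ?exprn_gt0 ?divr_gt0.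
apply: (le0_of_quadratic C0) => eta /andP[e0 e1].
pose t := 1 + eta.
have t12 : 1 < t <= 2 by rewrite /t; apply/andP; split; lra.
have t0 : 0 < t by rewrite /t; lra.
have tE : t - 1 = eta by rewrite /t; ring.
have := key t t12; rewrite tE.
pose c := z - t *: z; rewrite -/c.
pose v x := u (c + t *: x).
have Cv : Cc v by apply: Cc_affine => //; rewrite gt_eqF.
have v0 x : ~ Om x -> v x = 0.
  by move=> Ox; apply/eqP; apply: contraT => /(star t x) H; exfalso; apply/Ox/H; case/andP: t12.
have [vi vG] := Gform_dilation c t0 Cu ui.
have sqCc w : Cc w -> Cc (fun x => w x ^+ 2) by move=> Cw; apply: CcM Cw (Cc_continuous Cw).
have vM : mass v = (t ^+ n)^-1 * M.
  rewrite /M /mass (Int_affine c (lt0r_neq0 t0) (Cc_Intg (sqCc u Cu))) (gtr0_norm t0).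
  by rewrite mulKf// expf_neq0// gt_eqF.
pose qv := A * (1 - s) * Gform s v v - lam * mass v.
have [uvi _ _] := Gform_polar Cu Cv ui vi.
have Cuv : Cc (fun x => u x * v x) by apply: CcM Cu (Cc_continuous Cv).
pose b := A * (1 - s) * Gform s u v - lam * Int (fun x => u x * v x).
(* Here q is evaluated at k u - v. Because q(u) = 0 there is no quadratic term in k, and an affine
   function that is nonnegative for all k has slope 0. *)
have polar k : 0 <= qv - 2 * k * b /\
    A * (1 - s) * Gform s (fun x => k * u x - v x) (fun x => k * u x - v x) -
    lam * mass (fun x => k * u x - v x) = qv - 2 * k * b.
  have Ck : Cc (fun x => k * u x) by exact: CcZ.
  have LE : (fun h => ker s h * Lam (fun x => k * u x) (fun x => k * u x) h) =
      fun h => k ^+ 2 * (ker s h * Lam u u h).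
    by apply/funext => h; rewrite Lam_scale//; ring.
  have LE2 : (fun h => ker s h * Lam (fun x => k * u x) v h) =
      fun h => k * (ker s h * Lam u v h).
    by apply/funext => h; rewrite Lam_scalel//; ring.
  have ki : Intg (fun h => ker s h * Lam (fun x => k * u x) (fun x => k * u x) h).
    by rewrite LE; exact: IntgZ.
  have [_ di dE] := Gform_polar Ck Cv ki vi.
  have GE1 : Gform s (fun x => k * u x) (fun x => k * u x) = k ^+ 2 * G.
    by rewrite /Gform LE IntZ.
  have GE2 : Gform s (fun x => k * u x) v = k * Gform s u v by rewrite /Gform LE2 (IntZ _ uvi).
  have mE : mass (fun x => k * u x - v x) =
      k ^+ 2 * M + mass v - 2 * k * Int (fun x => u x * v x).
    have i1 := Cc_Intg (sqCc u Cu); have i2 := Cc_Intg (sqCc v Cv).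
    have i3 := Cc_Intg Cuv.
    rewrite /M /mass -(IntZ _ i1) -(IntD (IntgZ _ i1) i2) -(IntZ _ i3).
    rewrite -(IntB (IntgD (IntgZ _ i1) i2) (IntgZ _ i3)).
    by apply: eq_Int => x; ring.
  have qE : A * (1 - s) * Gform s (fun x => k * u x - v x) (fun x => k * u x - v x) -
      lam * mass (fun x => k * u x - v x) = qv - 2 * k * b.
    rewrite dE GE1 GE2 mE /qv /b.
    exact: (critical_expansion _ _ _ _ _ XE).
  split => //; rewrite -qE subr_ge0; apply: E di; first exact: CcB.
  by move=> x Ox; rewrite u0// v0// mulr0 subr0.
have b0 : b = 0.
  (* This k would make the nonnegative value equal to -1. *)
  apply/eqP; apply: contraT => bn; have [+ _] := polar ((qv + 1) / (2 * b)).
  rewrite (_ : qv - 2 * ((qv + 1) / (2 * b)) * b = -1); last by field.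
  by rewrite leNgt ltrN10.
have [_ qd] := polar 1; rewrite b0 mulr0 subr0 in qd.
have dE : (fun x => 1 * u x - v x) = fun x => u x - u (c + t *: x).
  by apply/funext => x; rewrite mul1r.
rewrite dE in qd; set Gd := Gform s _ _ in qd *.
have Gd0 : 0 <= Gd by exact: Gform_ge0.
have md0 := mass_ge0 (fun x => u x - u (c + t *: x)).
have lmd : 0 <= lam * mass (fun x => u x - u (c + t *: x)) by rewrite mulr_ge0// ltW.
have sGd : 0 <= s * (A * Gd) by rewrite !mulr_ge0// ltW.
have T0 : 0 < (t ^+ n)^-1 by rewrite invr_gt0 exprn_gt0.
have qvE : qv = (t ^+ n)^-1 * (t `^ (2 * s) - 1) * (lam * M).
  rewrite /qv vG vM -/G; transitivity
    ((t ^+ n)^-1 * t `^ (2 * s) * (A * (1 - s) * G) - (t ^+ n)^-1 * (lam * M)).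
    by move: (t `^ _) ((t ^+ n)^-1) => P1 P2; ring.
  by rewrite XE; move: (t `^ _) ((t ^+ n)^-1) (lam * M) => P1 P2 P3; ring.
have low : (2 ^+ n)^-1 * (s / 2) * (lam * M) * eta <= qv.
  rewrite qvE -[leLHS]mulrA [(lam * M) * _]mulrC mulrA ler_wpM2r ?(ltW lM0)//.
  rewrite -mulrA ler_pM ?invr_ge0 ?exprn_ge0 ?mulr_ge0 ?divr_ge0 ?(ltW s0) ?(ltW e0)//.
    rewrite lef_pV2 ?posrE ?exprn_gt0//.
    by apply: lerXn2r; rewrite ?nnegrE ?(ltW t0)//; case/andP: t12.
  by rewrite -tE; apply: dilation_fractional_lower; case/andP: t12 => ? ?; rewrite ltW.
have XE' : A * ((1 - s) * (t ^+ 2 - 1)) * G = lam * M * (t ^+ 2 - 1) by rewrite -XE; ring.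
rewrite XE'; move: low; rewrite -qd.
by move: (lam * mass _) lmd => lm lmd; lra.
Qed.

(** x lies on the segment from z to its dilated image, at parameter 1/t, and the image is in [Om]
    since u does not vanish there. *)
Lemma star_dilation Om z u : (forall x, ~ Om x -> u x = 0) ->
  (forall x, Om x -> forall t : R, 0 <= t <= 1 -> Om (z + t *: (x - z))) ->
  forall t x, 1 < t -> u (z - t *: z + t *: x) != 0 -> Om x.
Proof.
move=> u0 star t x t1 ut.
have Oy : Om (z - t *: z + t *: x).
  by apply: contrapT => /u0 y0; move: ut; rewrite y0 eqxx.
have t0 : 0 < t by lra.
have ti : 0 <= t^-1 <= 1 by rewrite invr_ge0 invf_le1 ?ltW.
have := star _ Oy _ ti; congr Om.
apply/rowP => j; rewrite !mxE; field; rewrite gt_eqF//.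
Qed.

(** Everything that does not look at the boundary. A > 0 is impossible by [saturated_contradiction];
    for A = 0 the eigenvalue bound gives lam <= 0 and the key inequality gives lam >= 0. The first
    conclusion settles the strict case, the last one is to be contradicted for positive u. *)
Lemma reduction a lam Om u z : 0 <= a -> open Om ->
  (forall x, Om x -> forall t : R, 0 <= t <= 1 -> Om (z + t *: (x - z))) ->
  C2 Om u -> Cc u -> is_solution s a lam Om u -> 0 < mass u ->
  (lam%:E <= (a * (1 - s))%:E * lambda1 s Om)%E ->
  [/\ ~ (lam%:E < (a * (1 - s))%:E * lambda1 s Om)%E, lam = 0, a * c_frac n s = 0 &
    exists C, 0 <= C /\ forall t tau, 1 < t <= 2 -> 0 < tau ->
      Dform (fun x => u x - u (z - t *: z + t *: x))
            (fun x => u x - u (z - t *: z + t *: x)) tau <= C * (t - 1) ^+ 2].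
Proof.
move=> a0 oOm star uC2 Cu sol M0 lamle.
have /andP[s0 s1] := s01.
have u0 : forall x, ~ Om x -> u x = 0 by case: sol.
have staru := star_dilation u0 star.
have weak := weak_solution_of_classical s01 oOm uC2 Cu sol.
have [A AE] : exists A, A = a * (c_frac n s / 2) by exists (a * (c_frac n s / 2)).
rewrite -AE in weak.
have c0 := c_frac_ge0 n s01.
have A0 : 0 <= A by rewrite AE mulr_ge0// divr_ge0.
have as0 : (0 <= (a * (1 - s))%:E)%E by rewrite lee_fin mulr_ge0// subr_ge0 ltW.
have bound w (Cw : Cc w) (w0 : forall x, ~ Om x -> w x = 0)
    (wi : Intg (fun h => ker s h * Lam w w h)) (Mw : 0 < mass w) :
    ((a * (1 - s))%:E * lambda1 s Om <= (A * (1 - s) * Gform s w w / mass w)%:E)%E.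
  have := lee_wpmul2l as0 (lambda1_le s01 Cw w0 wi Mw).
  move=> /le_trans; apply; rewrite -EFinM lee_fin -/(mass w) AE.
  by rewrite le_eqVlt; apply/orP; left; apply/eqP; ring.
have [C [C0 key]] := key_inequality s01 n3 A0 Cu u0 weak staru.
have ui : Intg (fun h => ker s h * Lam u u h).
  pose fu x := nonlinearity n lam (u x).
  have Cfu : Cc fu.
    by apply: Cc_comp => //; [exact: continuous_nonlinearity|exact: nonlinearity0].
  have [_ EL] := energy_le A0 Cu Cfu u0 weak.
  pose Q := Int (fun x => u x * fu x) - A * Gform s u u.
  have Q0 : 0 <= Q by rewrite /Q; have := EL 1 ltr01; have := Dform_ge0 u 1; lra.
  have [L [L0 uL]] : exists L, 0 <= L /\ forall h, Lam u u h <= L * `|h| ^+ 2.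
    by apply: (Lam_le_sqr Cu Q0) => t t0; have := EL t t0; rewrite /Q; lra.
  exact: (Intg_ker_Lam s01 Cu L0 uL).
have A00 : A = 0.
  apply/eqP; rewrite eq_le A0 andbT leNgt; apply/negP => A_gt0.
  apply: (@saturated_contradiction A lam C Om u z A_gt0 C0 Cu u0 staru ui M0).
    move=> w Cw w0 wi; have [->|Mw] := eqVneq (mass w) 0.
      by rewrite mulr0; apply: mulr_ge0 (Gform_ge0 s w); rewrite mulr_ge0 ?subr_ge0 ?(ltW s1) ?(ltW A_gt0).
    have Mw0 : 0 < mass w by rewrite lt_def Mw mass_ge0.
    by have := le_trans lamle (bound w Cw w0 wi Mw0); rewrite lee_fin ler_pdivlMr.
  move=> t t12; have := key t 1 t12 ltr01; rewrite -/(mass u).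
  by apply: le_trans; rewrite lerD2r lerDl Dform_ge0.
have key0 t tau : 1 < t <= 2 -> 0 < tau ->
    Dform (fun x => u x - u (z - t *: z + t *: x))
          (fun x => u x - u (z - t *: z + t *: x)) tau <=
    lam * mass u * (t ^+ 2 - 1) + C * (t - 1) ^+ 2.
  by move=> t12 tau0; have := key t tau t12 tau0; rewrite A00 mul0r (mul0r (Gform _ _ _)) add0r (mul0r (Gform _ _ _)) addr0.
(* With A = 0 the Rayleigh quotient of u shows that a (1 - s) [lambda1] is at most 0. *)
have bu := bound u Cu u0 ui M0; rewrite A00 !mul0r in bu.
have lam_le0 : lam <= 0 by have := le_trans lamle bu; rewrite lee_fin.
have lam_ge0 : 0 <= lam.
  have : - (lam * mass u) <= 0.
    apply: (le0_of_quadratic C0) => eta /andP[e0 e1].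
    have t12 : 1 < 1 + eta <= 2 by apply/andP; split; lra.
    have lM : lam * mass u <= 0 by rewrite mulr_le0_ge0// ltW.
    exact: (dilation_bound_linear e0 lM (le_trans (Dform_ge0 _ _) (key0 _ 1 t12 ltr01))).
  by rewrite oppr_le0 pmulr_lge0.
have lam0 : lam = 0 by apply/eqP; rewrite eq_le lam_le0.
split=> //.
- by move=> /lt_le_trans /(_ bu); rewrite lte_fin lam0 ltxx.
- by have := A00; rewrite AE mulrA => /eqP; rewrite mulf_eq0 invr_eq0 pnatr_eq0 orbF => /eqP.
exists C; split => // t tau t12 tau0.
by have := key0 t tau t12 tau0; rewrite lam0 !mul0r add0r.
Qed.

End nonexistence.

(** * Hopf's barrier on a ball *)

Section hopf.
Context {R : realType} (n : nat).
Notation V := 'rV[R]_n.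
Implicit Types (u : V -> R) (x y c v : V) (Om K : set V) (t rho : R).
Notation e := (fun i : 'I_n => delta_mx 0 i : V).

Lemma enorm_sqr_delta v t i :
  enorm (v + t *: e i) ^+ 2 = enorm v ^+ 2 + 2 * t * v 0 i + t ^+ 2.
Proof.
rewrite !enorm_sqr (bigD1 i)//= [in RHS](bigD1 i)//= !mxE !eqxx mulr1.
rewrite (eq_bigr (fun j => v 0 j ^+ 2)) => [|j /negbTE ji]; last first.
  by rewrite !mxE ji andbF mulr0 addr0.
by move: (\sum_(_ < n | _) _) => S; ring.
Qed.

(** Discrete form of strict superharmonicity, so that the comparison below uses only exact second
    differences of the barrier and none of its derivatives. *)
Lemma superharmonic_second_difference Om u x d : open Om -> C2 Om u -> Om x ->
  0 < - laplacian u x -> 0 < d ->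
  exists t, 0 < t < d /\ 0 < \sum_(i < n) sd u (t *: e i) x.
Proof.
move=> oOm uC2 Ox lu d0.
pose t_ m : R := d / 2 * m.+1%:R^-1.
have t0 m : 0 < t_ m by rewrite mulr_gt0 ?divr_gt0 ?invr_gt0.
have tcv : t_ @ \oo --> 0.
  rewrite -(mulr0 (d / 2)); apply: cvgM; first exact: cvg_cst.
  exact: cvg_harmonic.
have S : (fun m => \sum_(i < n) sd u (t_ m *: e i) x / t_ m ^+ 2) @ \oo -->
    - laplacian u x.
  rewrite /laplacian -sumrN.
  apply: cvg_big => [|i _]; first exact: add_continuous.
  exact: (sd_cvg oOm uC2 Ox t0 tcv).
have [m _ /(_ m (leqnn m)) H] := cvgr_gt _ S _ lu.
exists (t_ m); split.
  rewrite t0 /t_ /= (@le_lt_trans _ _ (d / 2))//; last by lra.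
  by rewrite ler_piMr// ?invf_le1 ?ler1n// ltW// divr_gt0.
by move: H; rewrite -mulr_suml pmulr_lgt0// invr_gt0 exprn_gt0.
Qed.

(** A step of length t along an axis changes y = rho^2 - |x - c|^2 by -2 t xi - t^2, with xi the
    coordinate of x - c; this is the second difference of y + b y^2. *)
Lemma barrier_second_difference (b Y xi t : R) :
  2 * (Y + b * Y ^+ 2) -
    (Y - 2 * t * xi - t ^+ 2 + b * (Y - 2 * t * xi - t ^+ 2) ^+ 2) -
    (Y + 2 * t * xi - t ^+ 2 + b * (Y + 2 * t * xi - t ^+ 2) ^+ 2) =
  t ^+ 2 * (2 + b * (4 * Y - 2 * t ^+ 2)) - 8 * b * t ^+ 2 * xi ^+ 2.
Proof. ring. Qed.

(* The function y + b y^2 with y = rho^2 - |x - c|^2 is subharmonic on the annulus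
   (n + 2) y <= rho^2, hence a multiple of it is a barrier from below. *)
Lemma hopf_ball Om u c rho m : open Om -> C2 Om u -> continuous u ->
  (forall x, 0 <= u x) -> (forall x, Om x -> 0 < - laplacian u x) ->
  0 < rho -> 0 <= m -> (forall x, enorm (x - c) < rho -> Om x) ->
  (forall x, rho ^+ 2 <= n.+2%:R * (rho ^+ 2 - enorm (x - c) ^+ 2) -> m <= u x) ->
  forall x, enorm (x - c) <= rho ->
    m / (n.+2%:R * rho ^+ 2) * (rho ^+ 2 - enorm (x - c) ^+ 2) <= u x.
Proof.
move=> oOm uC2 cu u0 su rho0 m0 ball inner.
pose Y x := rho ^+ 2 - enorm (x - c) ^+ 2.
(* Chosen so that 2 n - 4 b rho^2 = 0: the summed second difference of the barrier then has the sign
   of (n + 2) y - rho^2, up to a nonpositive term. *)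
pose b : R := n%:R / (2 * rho ^+ 2).
have r20 : 0 < rho ^+ 2 by rewrite exprn_gt0.
have b0 : 0 <= b := divr_ge0 (ler0n R n) (mulr_ge0 (ler0n R 2) (ltW r20)).
have brho : b * rho ^+ 2 = n%:R / 2 by rewrite /b; field; rewrite gt_eqF.
pose eps := m / (n.+2%:R * rho ^+ 2).
have eps0 : 0 <= eps by rewrite divr_ge0// mulr_ge0 ?(ltW r20).
have epsm : eps * (n.+2%:R * rho ^+ 2) = m.
  by rewrite /eps divfK// mulf_neq0 ?pnatr_eq0// gt_eqF.
pose B x := Y x + b * Y x ^+ 2.
pose K := [set x | enorm (x - c) <= rho].
have cE : continuous (fun x => enorm (x - c)).
  move=> x; apply: (@continuous_comp _ _ _ (fun x => x - c) (@enorm R n)).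
    rewrite (_ : (fun _ => _) = fun x => - c + 1 *: x); first exact: continuous_affine_rV.
    by apply/funext => y; rewrite scale1r addrC.
  exact: continuous_enorm.
have KY x : K x <-> 0 <= Y x.
  by rewrite /K /Y /= subr_ge0 ler_pXn2r ?nnegrE ?enorm_ge0 ?(ltW rho0)//.
have YE x : Y x <= rho ^+ 2 by rewrite /Y gerBl sqr_ge0.
have csq (f : V -> R) : continuous f -> continuous (fun x => f x ^+ 2).
  move=> cf x; rewrite (_ : (fun y => _) = fun y => f y * f y); last first.
    by apply/funext => y; rewrite expr2.
  exact: (@continuousM _ _ f f x (cf x) (cf x)).
have cst (k : R) : continuous (fun _ : V => k) by move=> x; exact: cst_continuous.
have cY : continuous Y.
  by move=> x; exact: (@continuousB _ _ _ (fun=> rho ^+ 2) (fun y => enorm (y - c) ^+ 2) x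
    (cst _ x) (csq _ cE x)).
have cB : continuous B.
  have cbY x := @continuousM _ _ (fun=> b) (fun y => Y y ^+ 2) x (cst b x) (csq Y cY x).
  by move=> x; exact: (@continuousD _ _ _ Y (fun y => b * Y y ^+ 2) x (cY x) (cbY x)).
pose w x := u x - eps * B x.
have cw : continuous w.
  have ceB x := @continuousM _ _ (fun=> eps) B x (cst eps x) (cB x).
  by move=> x; exact: (@continuousB _ _ _ u (fun y => eps * B y) x (cu x) (ceB x)).
have cK : compact K.
  apply: bounded_closed_compact.
    exists (`|c| + rho); split; first exact: num_real.
    move=> M MB x Kx; apply: le_trans (ltW MB).
    rewrite -[x in `|x|](subrK c) addrC (le_trans (ler_normD _ _))// lerD2l.
    exact: le_trans (norm_le_enorm _) Kx.
  by apply: (closed_comp _ (@closed_le _ rho)) => x _; exact: cE.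
suff wK x : K x -> 0 <= w x.
  move=> x Kx; have Yx := (KY x).1 Kx.
  have := wK x Kx; rewrite subr_ge0; apply: le_trans.
  by rewrite -/(Y x) -/eps ler_wpM2l// /B lerDl mulr_ge0 ?sqr_ge0.
have K0 : K !=set0 by exists c; rewrite /K /= subrr enorm0 ltW.
have [x0 /set_mem Kx0 xmin] := EVT_min_rV K0 cK (continuous_subspaceT cw).
move=> Kx; apply: le_trans (xmin x (mem_set Kx)).
have {}xmin y : K y -> w x0 <= w y by move=> Ky; apply: xmin; exact: mem_set.
(* A negative minimum is neither on the sphere, where the barrier vanishes, nor in the inner region,
   where the barrier is at most m. At such a point the second differences of w, of u and of the
   barrier have incompatible signs. *)
rewrite leNgt; apply/negP => wx0.
have Y0 : 0 <= Y x0 := (KY x0).1 Kx0.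
have Ypos : 0 < Y x0.
  rewrite lt_def Y0 andbT; apply/eqP => Yx0.
  by move: wx0; rewrite /w /B Yx0 expr0n /= mulr0 addr0 mulr0 subr0 ltNge u0.
have Yout : n.+2%:R * Y x0 < rho ^+ 2.
  rewrite ltNge; apply/negP => /inner mu; move: wx0; rewrite ltNge subr_ge0 => /negP; apply.
  apply: le_trans mu; rewrite -epsm ler_wpM2l// /B.
  have : b * Y x0 ^+ 2 <= b * (rho ^+ 2 * rho ^+ 2).
    by rewrite ler_wpM2l// expr2 ler_pM.
  rewrite mulrA brho -[n.+2%:R]natr1 -[n.+1%:R]natr1; have := YE x0; have := mulr_ge0 (ler0n R n) (ltW r20).
  by move: (n%:R : R) (rho ^+ 2) r20 (Y x0) (b * Y x0 ^+ 2) => N r r20 Yx bY; lra.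
have Ox0 : Om x0.
  by apply: ball; rewrite -(ltr_pXn2r (ltn0Sn 1)) ?nnegrE ?enorm_ge0 ?(ltW rho0)// -subr_gt0.
(* Steps shorter than d along the axes stay in the closed ball. *)
pose d := Num.min 1 (Y x0 / (2 * rho + 1)).
have D0 : 0 < 2 * rho + 1 by lra.
have d0 : 0 < d by rewrite lt_min ltr01 divr_gt0.
have [t [/andP[t0 td] St]] := superharmonic_second_difference oOm uC2 Ox0 (su _ Ox0) d0.
have t1 : t < 1 by move: td; rewrite lt_min => /andP[].
have tY : t * (2 * rho + 1) < Y x0 by rewrite -ltr_pdivlMr//; move: td; rewrite lt_min => /andP[].
have Yt i (k : R) : Y (x0 + k *: e i) = Y x0 - 2 * k * (x0 - c) 0 i - k ^+ 2.
  by rewrite /Y addrAC enorm_sqr_delta; move: (enorm _ ^+ 2) (rho ^+ 2) => E r; ring.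
have xi_le i : `|(x0 - c) 0 i| <= rho := le_trans (coord_le_enorm _ _) Kx0.
have Kt i (k : R) : `|k| = t -> K (x0 + k *: e i).
  move=> kt; apply/KY; rewrite Yt.
  have k2 : k ^+ 2 <= t by rewrite -real_normK ?num_real// kt expr2 ler_piMl ?ltW.
  have kx : k * (x0 - c) 0 i <= t * rho.
    apply: le_trans (ler_norm _) _; rewrite normrM kt ler_wpM2l ?(ltW t0)//.
  have tY2 : 2 * (t * rho) + t < Y x0 by rewrite (_ : _ + t = t * (2 * rho + 1))//; ring.
  rewrite -[2 * k * _]mulrA.
  by move: (k * (x0 - c) 0 i) (t * rho) (Y x0) (k ^+ 2) kx tY2 k2 => q p y k2 *; lra.
have minus i : x0 - t *: e i = x0 + (- t) *: e i by rewrite scaleNr.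
have Sw : \sum_(i < n) sd w (t *: e i) x0 <= 0.
  apply: sumr_le0 => i _; rewrite /sd.
  have := xmin _ (Kt i t (gtr0_norm t0)).
  have := xmin _ (Kt i (- t) (etrans (normrN t) (gtr0_norm t0))).
  by rewrite -minus; move: (w x0) (w _) (w _) => p q r; lra.
have SB : \sum_(i < n) sd B (t *: e i) x0 <= 0.
  have sdB i : sd B (t *: e i) x0 =
      t ^+ 2 * (2 + b * (4 * Y x0 - 2 * t ^+ 2)) - 8 * b * t ^+ 2 * (x0 - c) 0 i ^+ 2.
    rewrite -barrier_second_difference /sd /B minus !Yt.
    by move: ((x0 - c) 0 i) (Y x0) => xi y; ring.
  rewrite (eq_bigr _ (fun i _ => sdB i)) sumrB sumr_const card_ord -mulr_sumr -enorm_sqr.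
  have -> : enorm (x0 - c) ^+ 2 = rho ^+ 2 - Y x0 by rewrite /Y; ring.
  rewrite -[_ *+ n]mulr_natl.
  have -> : n%:R * (t ^+ 2 * (2 + b * (4 * Y x0 - 2 * t ^+ 2))) -
      8 * b * t ^+ 2 * (rho ^+ 2 - Y x0) =
    t ^+ 2 * (4 * b * (n.+2%:R * Y x0 - rho ^+ 2) - 2 * n%:R * b * t ^+ 2 +
              (2 * n%:R - 4 * (b * rho ^+ 2))).
    by rewrite -!natr1; ring.
  rewrite brho (_ : 2 * n%:R - 4 * (n%:R / 2) = 0); last by field.
  rewrite addr0 mulr_ge0_le0 ?sqr_ge0//.
  have h1 : 4 * b * (n.+2%:R * Y x0 - rho ^+ 2) <= 0.
    by apply: mulr_ge0_le0; [exact: mulr_ge0|rewrite subr_le0 ltW].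
  have h2 : 0 <= 2 * n%:R * b * t ^+ 2 := (mulr_ge0 (mulr_ge0 (mulr_ge0 (ler0n R 2) (ler0n R n)) b0) (sqr_ge0 t)).
  by move: (4 * b * _) (2 * n%:R * b * _) h1 h2 => p q; lra.
have : \sum_(i < n) sd w (t *: e i) x0 =
    \sum_(i < n) sd u (t *: e i) x0 - eps * \sum_(i < n) sd B (t *: e i) x0.
  by rewrite mulr_sumr -sumrB; apply: eq_bigr => i _; rewrite /sd /w; ring.
have := mulr_ge0_le0 eps0 SB.
by move: (eps * _) (\sum_(i < n) sd w _ _) Sw St => p q; lra.
Qed.

End hopf.

(** * A Hopf constant common to many balls *)

Section uniform_hopf.
Context {R : realType} (n : nat).
Notation V := 'rV[R]_n.
Implicit Types (u : V -> R) (x y c v : V) (Om K : set V) (t rho : R).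

Lemma enorm_sqrD_le v (h : V) :
  enorm (v + h) ^+ 2 <= enorm v ^+ 2 + n%:R * (2 * enorm v * `|h| + `|h| ^+ 2).
Proof.
rewrite !enorm_sqr mulr_natl -[X in _ *+ X]card_ord -sumr_const -big_split/=.
apply: ler_sum => i _; rewrite mxE sqrrD -addrA lerD2l.
have hi := coord_le_norm h i; have vi := coord_le_enorm v i.
rewrite -[v 0 i * h 0 i *+ 2]mulr_natl -[2 * enorm v * _]mulrA.
apply: lerD; last by rewrite -real_normK ?num_real// lerXn2r ?nnegrE.
rewrite ler_wpM2l//; apply: le_trans (ler_norm _) _.
by rewrite normrM ler_pM.
Qed.

Lemma compact_interior Om d : bounded_set Om -> 0 < d ->
  compact [set x | forall y, ~ Om y -> d <= `|y - x|].
Proof.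
move=> bOm d0; apply: bounded_closed_compact.
  move: bOm => [M [Mr HM]]; exists M; split=> // B MB x /= dx; apply: (HM B MB).
  apply: contrapT => /dx.
  by rewrite subrr normr0 leNgt d0.
rewrite (_ : [set _ | _] = \bigcap_(y in ~` Om) [set x | d <= `|y - x|])//.
apply: closed_bigI => y _; apply: (closed_comp _ (@closed_ge _ d)) => x _.
apply: (@continuous_comp _ _ _ (fun x => y - x) (fun v : V => `|v|)).
  rewrite (_ : (fun _ => _) = fun x => y + (-1) *: x); first exact: continuous_affine_rV.
  by apply/funext => v; rewrite scaleN1r.
exact: norm_continuous.
Qed.

(** The inner regions of all balls in [Om] with radius at least r0 keep a fixed distance d from the
    complement, so one compact set, and the positive minimum of u on it, serves them all. *)
Lemma uniform_hopf Om u r0 r1 : open Om -> bounded_set Om -> C2 Om u -> continuous u ->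
  (forall x, 0 <= u x) -> (forall x, Om x -> 0 < u x) ->
  (forall x, Om x -> 0 < - laplacian u x) -> 0 < r0 -> r0 <= r1 ->
  exists C, 0 < C /\ forall rho c, r0 <= rho <= r1 ->
    (forall x, enorm (x - c) < rho -> Om x) ->
    forall x, enorm (x - c) <= rho -> C * (rho ^+ 2 - enorm (x - c) ^+ 2) <= u x.
Proof.
move=> oOm bOm uC2 cu u0 upos su r00 r01.
pose N : R := n%:R + 2.
have N0 : 2 <= N by rewrite /N lerDr.
have Np : 0 < N by lra.
(* With N = n + 2, a displacement below d raises |y - c|^2 by less than rho^2 / N, which is the
   margin left by the inner region. *)
pose d := r0 / (3 * N ^+ 2).
have N20 : 0 < 3 * N ^+ 2 by rewrite mulr_gt0// exprn_gt0//; lra.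
have d0 : 0 < d by rewrite divr_gt0.
have dE : d * (3 * N ^+ 2) = r0 by rewrite /d divfK// gt_eqF.
have cK := compact_interior bOm d0.
set K := [set x | _] in cK.
have KOm x : K x -> Om x.
  by move=> Kx; apply: contrapT => /Kx; rewrite subrr normr0 leNgt d0.
have [m [m0 um]] : exists m, 0 < m /\ forall x, K x -> m <= u x.
  have [K0|/nonemptyPn K0] := pselect (K !=set0); last first.
    by exists 1; split => // x; rewrite K0.
  have [x0 /set_mem Kx0 xmin] := EVT_min_rV K0 cK (continuous_subspaceT cu).
  by exists (u x0); split=> [|x Kx]; [exact/upos/KOm|exact: xmin (mem_set Kx)].
have r10 : 0 < r1 := lt_le_trans r00 r01.
have D0 : 0 < n.+2%:R * r1 ^+ 2 by rewrite mulr_gt0// exprn_gt0.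
exists (m / (n.+2%:R * r1 ^+ 2)); split; first by rewrite divr_gt0.
move=> rho c /andP[r0rho rhor1] ball x xrho.
have rho0 : 0 < rho := lt_le_trans r00 r0rho.
have y0 : 0 <= rho ^+ 2 - enorm (x - c) ^+ 2.
  by rewrite subr_ge0 lerXn2r ?nnegrE ?enorm_ge0 ?(ltW rho0).
apply: le_trans (hopf_ball oOm uC2 cu u0 su rho0 (ltW m0) ball _ xrho).
  rewrite ler_wpM2r// ler_wpM2l ?(ltW m0)// lef_pV2 ?posrE ?mulr_gt0 ?exprn_gt0//.
  by rewrite ler_wpM2l// lerXn2r ?nnegrE ?(ltW rho0) ?(ltW r10).
move=> y; rewrite (_ : n.+2%:R = N); last by rewrite /N -natrD addn2.
move=> Hy; apply: um => q Oq; rewrite leNgt; apply/negP => qd; apply: Oq; apply: ball.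
rewrite -(ltr_pXn2r (ltn0Sn 1)) ?nnegrE ?enorm_ge0 ?(ltW rho0)//.
rewrite (_ : q - c = (y - c) + (q - y)); last by rewrite [RHS]addrC addrA subrK.
apply: le_lt_trans (enorm_sqrD_le _ _) _.
have yrho : enorm (y - c) <= rho.
  rewrite -(@ler_pXn2r _ 2) ?nnegrE ?enorm_ge0 ?(ltW rho0)// -subr_ge0.
  rewrite -(pmulr_rge0 _ Np); apply: le_trans Hy; exact: sqr_ge0.
have E0 := enorm_ge0 (y - c); have Q0 := normr_ge0 (q - y).
have nN : n%:R <= N - 2 by rewrite /N addrK.
have n0 := ler0n R n.
move: (enorm (y - c)) `|q - y| (n%:R : R) E0 Q0 yrho qd nN n0 Hy => E Q k E0 Q0 Er Qd kN k0 Hy.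
have h1 : 2 * E * Q + Q ^+ 2 <= 3 * rho * d.
  have := ler_pM E0 Q0 Er (ltW Qd); have Qr : Q <= rho.
    apply: le_trans (ltW Qd) _; apply: le_trans r0rho; rewrite -dE ler_peMr ?(ltW d0)//.
    by have := ler_pM (ler0n R 2) (ler0n R 2) N0 N0; rewrite -expr2; lra.
  have := ler_pM Q0 Q0 Qr (ltW Qd); rewrite -expr2 -!mulrA; move: (rho * d) (E * Q) => a b; lra.
have h2 : k * (2 * E * Q + Q ^+ 2) <= (N - 2) * (3 * rho * d).
  by apply: ler_pM => //; rewrite addr_ge0 ?sqr_ge0// !mulr_ge0.
have h3 : N * ((N - 2) * (3 * rho * d)) < rho ^+ 2.
  apply: lt_le_trans (_ : rho * r0 <= _); last by rewrite expr2 ler_wpM2l ?(ltW rho0).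
  have := mulr_gt0 (mulr_gt0 rho0 d0) Np; rewrite -dE.
  by move: d0 => _; nra.
rewrite -(ltr_pM2l Np) mulrDr; apply: le_lt_trans (_ : N * E ^+ 2 + N * ((N - 2) * (3 * rho * d)) < _).
  by rewrite lerD2l ler_wpM2l// ltW.
by rewrite mulrBr in Hy; rewrite -ltrBrDl; exact: lt_le_trans h3 Hy.
Qed.

End uniform_hopf.

(** * Defining function of a C^2 graph *)

Section C2_graph.
Context {R : realType}.

Lemma C2_taylor n (Om : set 'rV[R]_n) (f : 'rV[R]_n -> R) p : open Om -> C2 Om f -> Om p ->
  exists r C, [/\ 0 < r, 0 <= C & forall x h, `|x - p| <= r -> `|h| <= r ->
    `|f (x + h) - f x - \sum_i h 0 i * 'D_(delta_mx 0 i) f x| <= C * `|h| ^+ 2].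
Proof.
move=> oOm fC2 Op.
have [r [C [r0 C0 rC]]] := C2_compact_bound oOm fC2 (@compact_set1 _ p)
  (fun y yp => eq_ind_r Om Op yp).
exists (r / 2), (C * n%:R ^+ 2); split; [by rewrite divr_gt0|by rewrite mulr_ge0|].
move=> x h xp hr.
have near y : `|y - x| <= `|h| -> `|y - p| <= r.
  move=> yx; rewrite -[y](subrK x) -addrA (le_trans (ler_normD _ _))//.
  by rewrite [r]splitr lerD// (le_trans yx).
rewrite -mulrA -exprMn; apply: taylor_box => // y i.
- by move=> /near yp; have [Oy _] := rC p erefl y yp; have [_ /(_ i)[]] := fC2 y Oy.
- move=> j /near yp; have [Oy _] := rC p erefl y yp.
  by have [_ _ /(_ i j)[]] := fC2 y Oy.
- by move=> j /near yp; have [_] := rC p erefl y yp.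
Qed.

Lemma C2_gradient_near n (Om : set 'rV[R]_n) (f : 'rV[R]_n -> R) p w : C2 Om f -> Om p ->
  0 < w -> exists r, 0 < r /\ forall x, `|x - p| <= r ->
    forall i, `|'D_(delta_mx 0 i) f x - 'D_(delta_mx 0 i) f p| <= w.
Proof.
move=> fC2 Op w0; have [_ cD _] := fC2 p Op.
have : \forall y \near p, forall i, `|'D_(delta_mx 0 i) f y - 'D_(delta_mx 0 i) f p| <= w.
  apply: (@filter_forall _ 'I_n (fun i y =>
    `|'D_(delta_mx 0 i) f y - 'D_(delta_mx 0 i) f p| <= w) (nbhs p)) => i.
  have [_ ci] := cD i.
  by have /cvgrPdist_le/(_ w w0) := ci; apply: filterS => y; rewrite distrC.
move=> /nbhs_ballP[d /= d0 dP]; exists (d / 2); split; first by rewrite divr_gt0.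
move=> x xp; apply: dP; rewrite -ball_normE /= distrC (le_lt_trans xp)//.
by rewrite ltr_pdivrMr// ltr_pMr// ltr1n.
Qed.

Variables (n : nat) (k : 'I_n) (b : bool) (g : 'rV[R]_n.-1 -> R).
Hypothesis gC2 : C2 setT g.
Notation V := 'rV[R]_n.
Implicit Types (p x h : V).

(** Near a boundary point it is positive exactly in the domain, and it grows at unit speed along the
    signed axis k. *)
Definition graph_height x : R := (-1) ^+ b * x 0 k - g (col' k x).

(** The gradient of [graph_height], an inner normal that is not normalized; its k-th entry is a
    sign, so its length is at least 1. *)
Definition graph_gradient x : V := \row_i
  if unlift k i is Some j then - 'D_(delta_mx 0 j) g (col' k x) else (-1) ^+ b.

Lemma graph_gradient_axis x : graph_gradient x 0 k = (-1) ^+ b.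
Proof. by rewrite mxE unlift_none. Qed.

Lemma graph_gradientE x h : \sum_i graph_gradient x 0 i * h 0 i =
  (-1) ^+ b * h 0 k - \sum_j (col' k h) 0 j * 'D_(delta_mx 0 j) g (col' k x).
Proof.
rewrite (bigD1_ord k)//= graph_gradient_axis; congr (_ + _).
rewrite -sumrN; apply: eq_bigr => j _.
by rewrite !mxE liftK mulNr mulrC.
Qed.

Lemma norm_col'_le h : `|col' k h| <= `|h|.
Proof. by apply: norm_rV_le => // i; rewrite mxE coord_le_norm. Qed.

Lemma col'B x y : col' k (x - y : V) = col' k x - col' k y.
Proof. by apply/rowP => j; rewrite !mxE. Qed.

Lemma col'D x y : col' k (x + y : V) = col' k x + col' k y.
Proof. by apply/rowP => j; rewrite !mxE. Qed.

Lemma graph_height_axis x t :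
  graph_height (x + t *: ((-1) ^+ b *: delta_mx 0 k)) = graph_height x + t.
Proof.
rewrite /graph_height col'D (_ : col' k (t *: _) = 0) ?addr0; last first.
  by apply/rowP => j; rewrite !mxE eqxx eq_sym (negbTE (neq_lift k j)) !mulr0.
by rewrite !mxE !eqxx mulr1 mulrDr [_ * (t * _)]mulrCA -expr2 sqrr_sign mulr1 addrAC.
Qed.

Lemma graph_height_taylor p : exists r C, [/\ 0 < r, 0 <= C &
  forall x h, `|x - p| <= r -> `|h| <= r ->
    `|graph_height (x + h) - graph_height x - \sum_i graph_gradient x 0 i * h 0 i|
      <= C * `|h| ^+ 2].
Proof.
have [r [C [r0 C0 rC]]] := C2_taylor openT gC2 (I : setT (col' k p)).
exists r, C; split => // x h xp hr.
have xp' : `|col' k x - col' k p| <= r.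
  by rewrite -col'B (le_trans (norm_col'_le _)).
have := rC _ _ xp' (le_trans (norm_col'_le h) hr).
rewrite graph_gradientE /graph_height col'D mxE.
move: (\sum_j _) (g (col' k x + col' k h)) (g (col' k x)) => S g1 g2 H.
rewrite (_ : _ - _ = - (g1 - g2 - S)); last by move: (x 0 k) (h 0 k) => a c; ring.
rewrite normrN (le_trans H)// ler_wpM2l// lerXn2r ?nnegrE//.
exact: norm_col'_le.
Qed.

Lemma graph_gradient_near p w : 0 < w -> exists r, 0 < r /\ forall x, `|x - p| <= r ->
  `|graph_gradient x - graph_gradient p| <= w.
Proof.
move=> w0; have [r [r0 rw]] := C2_gradient_near gC2 (I : setT (col' k p)) w0.
exists r; split => // x xp; apply: norm_rV_le => [|i]; first exact: ltW.
rewrite !mxE; case: unliftP => [j _|_]; last by rewrite subrr normr0 ltW.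
rewrite -opprD normrN; apply: rw _ j.
by rewrite -col'B (le_trans (norm_col'_le _)).
Qed.

Lemma enorm_graph_gradient_ge1 x : 1 <= enorm (graph_gradient x).
Proof.
by apply: le_trans (coord_le_enorm _ k); rewrite graph_gradient_axis normr_sign.
Qed.

End C2_graph.

(** * Transversality and linear growth at the boundary *)

Section boundary_growth.
Context {R : realType} (n : nat).
Notation V := 'rV[R]_n.
Implicit Types (u : V -> R) (x y c v w h z q : V) (Om K : set V) (t rho : R).
Notation e := (fun i : 'I_n => delta_mx 0 i : V).

Definition dot v w : R := \sum_i v 0 i * w 0 i.

Lemma dotBl v w h : dot (v - w) h = dot v h - dot w h.
Proof. by rewrite /dot -sumrB; apply: eq_bigr => i _; rewrite !mxE mulrBl. Qed.

Lemma dotBr v w h : dot v (w - h) = dot v w - dot v h.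
Proof. by rewrite /dot -sumrB; apply: eq_bigr => i _; rewrite !mxE mulrBr. Qed.

Lemma dotZr t v w : dot v (t *: w) = t * dot v w.
Proof. by rewrite /dot mulr_sumr; apply: eq_bigr => i _; rewrite !mxE; ring. Qed.

Lemma norm_dot_le v w : `|dot v w| <= n%:R * (`|v| * `|w|).
Proof.
apply: (le_trans (ler_norm_sum _ _ _)).
rewrite mulr_natl -[X in _ *+ X]card_ord -sumr_const; apply: ler_sum => i _.
by rewrite normrM ler_pM// coord_le_norm.
Qed.

Lemma enorm_sqrBZ h v t :
  enorm (h - t *: v) ^+ 2 = enorm h ^+ 2 - 2 * t * dot v h + t ^+ 2 * enorm v ^+ 2.
Proof.
rewrite !enorm_sqr /dot !mulr_sumr -sumrB -big_split/=.
by apply: eq_bigr => i _; rewrite !mxE; ring.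
Qed.

(** The boundary enters through a defining function F and its gradient nu only; [graph_height] and
    [graph_gradient] are the instance used. *)
Variables (p : V) (F : V -> R) (nu : V -> V) (k : 'I_n) (sg : R).
Hypothesis sg2 : sg ^+ 2 = 1.
Hypothesis F_axis : forall x t, F (x + t *: (sg *: e k)) = F x + t.
Hypothesis nu_axis : forall x, nu x 0 k = sg.
Hypothesis F_taylor : exists r C, [/\ 0 < r, 0 <= C &
  forall x h, `|x - p| <= r -> `|h| <= r ->
    `|F (x + h) - F x - dot (nu x) h| <= C * `|h| ^+ 2].
Hypothesis nu_near : forall w : R, 0 < w -> exists r, 0 < r /\ forall x, `|x - p| <= r ->
  `|nu x - nu p| <= w.

Lemma nu_bounded : exists r, 0 < r /\ forall x, `|x - p| <= r -> `|nu x| <= `|nu p| + 1.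
Proof.
have [r [r0 rw]] := nu_near ltr01; exists r; split=> // x /rw H.
by rewrite -[nu x](subrK (nu p)) addrC (le_trans (ler_normD _ _))// lerD2l.
Qed.

(** Linear increase of F from p towards z means that nu(p) . (z - p) is positive. By continuity of
    nu, F decreases at a definite rate along x - z for all x near p. *)
Lemma transversal_dilation z eps t0 : 0 < eps -> 0 < t0 ->
  (forall t, 0 < t <= t0 -> F p + eps * t <= F (p + t *: (z - p))) ->
  exists kap d, [/\ 0 < kap, 0 < d & forall x eta, `|x - p| <= d -> 0 <= eta <= d ->
    F (x + eta *: (x - z)) <= F x - kap * eta].
Proof.
move=> eps0 t00 Ft.
have [r [C [r0 C0 FC]]] := F_taylor.
set W := `|z - p|; have W0 : 0 <= W by exact: normr_ge0.
have W1 : 0 < W + 1 by rewrite ltr_wpDl.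
have CW : 0 <= C * W ^+ 2 by rewrite mulr_ge0// sqr_ge0.
have CW1 : 0 <= C * (W + 1) ^+ 2 by rewrite mulr_ge0// sqr_ge0.
have slope : eps / 2 <= dot (nu p) (z - p).
  pose t := Num.min t0 (Num.min (r / (W + 1)) (eps / 2 / (C * W ^+ 2 + 1))).
  have t_gt0 : 0 < t by rewrite !lt_min t00 !divr_gt0// ltr_wpDl.
  have tt0 : t <= t0 by rewrite ge_min lexx.
  have tr : t * W <= r.
    apply: (@le_trans _ _ (t * (W + 1))); first by rewrite ler_wpM2l ?(ltW t_gt0)// lerDl.
    by rewrite -ler_pdivlMr// !ge_min lexx orbT.
  have tC : t * (C * W ^+ 2) <= eps / 2.
    apply: (@le_trans _ _ (t * (C * W ^+ 2 + 1))).
      by rewrite ler_wpM2l ?(ltW t_gt0)// lerDl.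
    by rewrite -ler_pdivlMr ?ltr_wpDl// !ge_min lexx !orbT.
  have tv : `|t *: (z - p)| = t * W by rewrite normrZ gtr0_norm.
  have := Ft t (introT andP (conj t_gt0 tt0)).
  have := FC p (t *: (z - p)); rewrite subrr normr0 tv => /(_ (ltW r0) tr).
  rewrite dotZr => /ler_normlW H1 H2.
  rewrite -(ler_pM2l t_gt0).
  have := ler_wpM2l (ltW t_gt0) tC; rewrite exprMn in H1.
  move: (F p) (F _) (dot _ _) H1 H2 => a b D H1 H2.
  have -> : t * (t * (C * W ^+ 2)) = C * (t ^+ 2 * W ^+ 2) by ring.
  by move: (C * _) H1 => E H1; lra.
have w0 : 0 < eps / (8 * (n%:R * W + 1)).
  by rewrite divr_gt0// mulr_gt0// ltr_wpDl// mulr_ge0.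
have [r2 [r20 nuw]] := nu_near w0.
have [r3 [r30 nub]] := nu_bounded.
set N1 := `|nu p| + 1 in nub.
have N10 : 0 <= N1 by rewrite addr_ge0.
have nN : 0 <= n%:R * N1 by rewrite mulr_ge0.
pose d := Num.min 1 (Num.min r (Num.min r2 (Num.min r3 (Num.min (r / (W + 1))
  (Num.min (eps / (8 * (n%:R * N1 + 1))) (eps / (8 * (C * (W + 1) ^+ 2 + 1)))))))).
have D1 : 0 < 8 * (n%:R * N1 + 1) by rewrite mulr_gt0// ltr_wpDl.
have D2 : 0 < 8 * (C * (W + 1) ^+ 2 + 1) by rewrite mulr_gt0// ltr_wpDl.
(* Of the slope eps / 2 at p, one eighth of eps pays for moving from p to x, one for the variation
   of nu and one for the Taylor remainder. *)
exists (eps / 8), d; split; first by rewrite divr_gt0.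
  by rewrite /d !lt_min ltr01 r0 r20 r30 !divr_gt0.
have dd : [/\ d <= 1, d <= r, d <= r2, d <= r3 & d <= r / (W + 1)] /\
    d <= eps / (8 * (n%:R * N1 + 1)) /\ d <= eps / (8 * (C * (W + 1) ^+ 2 + 1)).
  by rewrite /d !ge_min !lexx !orbT.
move: d dd => d [[d1 dr dr2 dr3 drW] [dN dC]] x eta xp /andP[eta0 etad].
have hW : `|x - z| <= W + 1.
  rewrite (_ : x - z = (x - p) - (z - p)); last by rewrite opprB addrA subrK.
  by rewrite (le_trans (ler_normB _ _))// addrC lerD2l (le_trans xp).
have := FC x (eta *: (x - z)) (le_trans xp dr).
rewrite normrZ ger0_norm// => H.
have {H} := H _; rewrite dotZr => H.
have etaW : eta * `|x - z| <= r.
  apply: (@le_trans _ _ (eta * (W + 1))); first by rewrite ler_wpM2l.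
  by rewrite -ler_pdivlMr// (le_trans etad).
have {H}/ler_normlW := H etaW.
have h1 : dot (nu x) (x - p) <= eps / 8.
  apply: le_trans (ler_norm _) _; apply: (le_trans (norm_dot_le _ _)).
  apply: (@le_trans _ _ ((n%:R * N1 + 1) * d)).
    rewrite mulrA ler_pM// ?mulr_ge0//.
    by rewrite ler_wpDr// ler_wpM2l// nub// (le_trans xp).
  move: dN; rewrite ler_pdivlMr// => dN; rewrite ler_pdivlMr//.
  by rewrite mulrC [_ * d]mulrC mulrA [8 * d]mulrC -mulrA.
have h2 : - dot (nu x - nu p) (z - p) <= eps / 8.
  apply: le_trans (ler_norm _) _; rewrite normrN; apply: (le_trans (norm_dot_le _ _)).
  rewrite -/W mulrCA; have := nuw x (le_trans xp dr2).
  rewrite ler_pdivlMr; last by rewrite mulr_gt0// ltr_wpDl// mulr_ge0.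
  rewrite ler_pdivlMr// => H; apply: le_trans H.
  rewrite -mulrA ler_wpM2l// mulrC ler_wpM2l//.
  by rewrite lerDl.
have h3 : dot (nu x) (x - z) = dot (nu x) (x - p) - dot (nu x - nu p) (z - p) -
    dot (nu p) (z - p).
  rewrite dotBl -[in RHS]addrA -opprD subrK -dotBr; congr dot.
  by rewrite opprB addrA subrK.
have h4 : C * (eta * `|x - z|) ^+ 2 <= eta * (eps / 8).
  have -> : C * (eta * `|x - z|) ^+ 2 = eta * (eta * (C * `|x - z| ^+ 2)) by ring.
  rewrite ler_wpM2l//; apply: (@le_trans _ _ (d * (C * (W + 1) ^+ 2 + 1))).
    rewrite ler_pM ?mulr_ge0 ?sqr_ge0//.
    by rewrite ler_wpDr// ler_wpM2l// lerXn2r ?nnegrE// ltW.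
  move: dC; rewrite ler_pdivlMr// => dC; rewrite ler_pdivlMr//.
  by rewrite -mulrA [_ * 8]mulrC.
have h5 : eta * dot (nu x) (x - z) <= eta * (- (eps / 4)).
  rewrite ler_wpM2l// h3.
  move: (dot (nu x) (x - p)) (dot (nu x - nu p) (z - p)) (dot (nu p) (z - p)) h1 h2 slope.
  by move=> a b c h1 h2 slope; lra.
move: (F _) (F x) (eta * dot _ _) (C * _) h4 h5 => a b q s h4 h5.
by rewrite -(mulrC eta); lra.
Qed.

(** Uniform interior ball condition. In the ball touching at q one has |x - q|^2 < 2 rho nu(q) . (x
    - q), which beats the Taylor error C |x - q|^2 once 2 rho C <= 1; a single rho works for all q
    near p. *)
Lemma interior_ball Om r0 : 0 < r0 -> (forall x, `|x - p| <= r0 -> 0 < F x -> Om x) ->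
  exists rho d, [/\ 0 < rho, 0 < d & forall q, `|q - p| <= d -> F q = 0 ->
    forall x, enorm (x - (q + rho *: nu q)) < rho * enorm (nu q) -> Om x].
Proof.
move=> r00 FOm.
have [r [C [r1 C0 FC]]] := F_taylor.
have [r3 [r30 nub]] := nu_bounded.
set N1 := `|nu p| + 1 in nub.
have N10 : 0 <= N1 by rewrite addr_ge0.
pose d := Num.min r (Num.min (r0 / 2) r3).
have d0 : 0 < d by rewrite !lt_min r1 r30 divr_gt0.
have [dr [dr0 dr3]] : d <= r /\ d <= r0 / 2 /\ d <= r3 by rewrite /d !ge_min !lexx !orbT.
pose D := 2 * (n%:R * N1 + C + 1).
have D0 : 0 < D by rewrite mulr_gt0// ltr_wpDl// addr_ge0// mulr_ge0.
have m0 : 0 < Num.min d 1 by rewrite lt_min d0 ltr01.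
have [rho [rho0 rhoE]] : exists rho, 0 < rho /\ rho * D = Num.min d 1.
  by exists (Num.min d 1 / D); rewrite divr_gt0// divfK// gt_eqF.
have nN : 0 <= n%:R * N1 by rewrite mulr_ge0.
have rhoN : 2 * rho * (n%:R * N1) <= d.
  apply: (@le_trans _ _ (rho * D)); last by rewrite rhoE ge_min lexx.
  rewrite [2 * rho]mulrC -mulrA ler_wpM2l ?(ltW rho0)// /D ler_wpM2l// -addrA lerDl.
  by rewrite addr_ge0.
have rhoC : 2 * rho * C <= 1.
  apply: (@le_trans _ _ (rho * D)); last by rewrite rhoE ge_min lexx orbT.
  rewrite [2 * rho]mulrC -mulrA ler_wpM2l ?(ltW rho0)// /D ler_wpM2l// addrAC lerDr.
  by rewrite addr_ge0.
exists rho, d; split => // q qp Fq x.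
rewrite -(ltr_pXn2r (ltn0Sn 1)) ?nnegrE ?enorm_ge0 ?mulr_ge0 ?enorm_ge0 ?(ltW rho0)//.
rewrite opprD addrA enorm_sqrBZ exprMn gtrDr.
have [h hE] : exists h, h = x - q by exists (x - q).
rewrite -hE subr_lt0 => H.
have h2 : `|h| ^+ 2 < 2 * rho * dot (nu q) h.
  by apply: le_lt_trans H; rewrite lerXn2r ?nnegrE ?enorm_ge0// norm_le_enorm.
have dothN : dot (nu q) h <= n%:R * N1 * `|h|.
  apply: le_trans (ler_norm _) _; apply: (le_trans (norm_dot_le _ _)).
  by rewrite mulrA ler_wpM2r// ler_wpM2l// nub// (le_trans qp).
have hd : `|h| <= d.
  have [h0|hpos] := eqVneq `|h| 0; first by rewrite h0 ltW.
  have {}hpos : 0 < `|h| by rewrite lt_def hpos normr_ge0.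
  rewrite -(ler_pM2r hpos) -expr2; apply: (le_trans (ltW h2)).
  apply: (@le_trans _ _ (2 * rho * (n%:R * N1 * `|h|))).
    by rewrite ler_wpM2l// mulr_ge0// ltW.
  by rewrite mulrA ler_wpM2r.
have xE : x = q + h by rewrite hE addrC subrK.
apply: FOm.
  rewrite xE addrAC (le_trans (ler_normD _ _))// [r0]splitr lerD//.
    exact: le_trans qp dr0.
  exact: le_trans hd dr0.
have := FC q h (le_trans qp dr) (le_trans hd dr); rewrite -xE Fq subr0.
rewrite distrC => /ler_normlW H1.
have r20 : 0 < 2 * rho by rewrite mulr_gt0.
rewrite -(pmulr_rgt0 _ r20).
have H2 : 2 * rho * dot (nu q) h - 2 * rho * F x <= 2 * rho * C * `|h| ^+ 2.
  by rewrite -mulrBr -mulrA ler_wpM2l// ltW.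
have := ler_wpM2r (sqr_ge0 `|h|) rhoC; rewrite mul1r.
move: (2 * rho * dot (nu q) h) (2 * rho * F x) (2 * rho * C * `|h| ^+ 2) (`|h| ^+ 2) h2 H2.
by move=> a b s t *; lra.
Qed.

(** x is moved along axis k to the point q with F(q) = 0. In the interior ball at q, of radius
    between two fixed bounds, the barrier of [uniform_hopf] at x is at least a multiple of rho
    F(x). *)
Lemma linear_growth Om u r0 : open Om -> bounded_set Om -> C2 Om u -> continuous u ->
  (forall x, 0 <= u x) -> (forall x, Om x -> 0 < u x) ->
  (forall x, Om x -> 0 < - laplacian u x) ->
  0 < r0 -> (forall x, `|x - p| <= r0 -> 0 < F x -> Om x) ->
  exists a d, [/\ 0 < a, 0 < d & forall x, `|x - p| <= d -> 0 <= F x <= d ->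
    a * F x <= u x].
Proof.
move=> oOm bOm uC2 cu u0 upos su r00 FOm.
have [rho [d [rho0 d0 ball]]] := interior_ball r00 FOm.
have [r3 [r30 nub]] := nu_bounded.
have snorm : `|sg| = 1.
  by apply/eqP; rewrite -(@eqrXn2 _ 2) ?ler01// real_normK ?num_real// sg2 expr1n.
have nu1 x : 1 <= enorm (nu x).
  by apply: le_trans (coord_le_enorm _ k); rewrite nu_axis snorm.
have rN : rho <= rho * (n%:R * (`|nu p| + 1)).
  rewrite ler_peMr ?(ltW rho0)//; apply: le_trans (nu1 p) _.
  by apply: le_trans (enorm_le_norm _) _; rewrite ler_wpM2l// lerDl.
have [a [a0 hopf]] := uniform_hopf oOm bOm uC2 cu u0 upos su rho0 rN.
pose d' := Num.min rho (Num.min (d / 2) (r3 / 2)).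
have d'0 : 0 < d' by rewrite !lt_min rho0 !divr_gt0.
have [d'rho [d'd d'r]] : d' <= rho /\ d' <= d / 2 /\ d' <= r3 / 2.
  by rewrite /d' !ge_min !lexx !orbT.
exists (a * rho), d'; split => //; first exact: mulr_gt0.
move=> x xp /andP[F0 Fd].
pose q := x + (- F x) *: (sg *: e k).
have Fq : F q = 0 by rewrite F_axis subrr.
have ek : `|e k| <= 1.
  by apply: norm_rV_le => // i; rewrite mxE eqxx /=; case: (i == k); rewrite ?normr1 ?normr0.
have qx : `|q - x| <= d'.
  rewrite /q addrAC subrr add0r !normrZ normrN snorm mul1r ger0_norm//.
  by rewrite (le_trans _ Fd)// ler_piMr.
have qp (D : R) : d' <= D / 2 -> `|q - p| <= D.
  move=> dD; rewrite -[q](subrK x) -addrA (le_trans (ler_normD _ _))//.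
  by rewrite [D]splitr lerD// (le_trans _ dD).
have rq : rho <= rho * enorm (nu q) <= rho * (n%:R * (`|nu p| + 1)).
  rewrite ler_peMr ?(ltW rho0)//= ler_wpM2l ?(ltW rho0)//.
  by apply: le_trans (enorm_le_norm _) _; rewrite ler_wpM2l// nub// qp.
have H := hopf _ _ rq (ball q (qp _ d'd) Fq) x.
(* Exact because x - q is F(x) times the signed axis vector, whose product with nu(q) is 1. *)
have E : enorm (x - (q + rho *: nu q)) ^+ 2 =
    (rho * enorm (nu q)) ^+ 2 - 2 * (rho * F x) + F x ^+ 2.
  have -> : x - (q + rho *: nu q) = (- rho) *: nu q + (F x * sg) *: e k.
    by rewrite /q !opprD !scaleNr opprK !addrA subrr add0r addrC scalerA.
  rewrite enorm_sqr_delta enormZ normrN (gtr0_norm rho0) !mxE nu_axis.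
  have -> : 2 * (F x * sg) * (- rho * sg) = - (2 * (rho * F x) * sg ^+ 2) by ring.
  by rewrite (exprMn _ (F x)) sg2 !mulr1.
have Frho : F x ^+ 2 <= rho * F x by rewrite expr2 ler_wpM2r// (le_trans Fd).
have rF : 0 <= rho * F x by rewrite mulr_ge0// ltW.
rewrite E in H; apply: le_trans (H _).
  rewrite -[a * rho * _]mulrA ler_wpM2l ?(ltW a0)//.
  by move: ((rho * enorm (nu q)) ^+ 2) (F x ^+ 2) (rho * F x) Frho => A b f Frho; lra.
rewrite -(@ler_pXn2r _ 2) ?nnegrE ?mulr_ge0 ?enorm_ge0 ?(ltW rho0)// E.
by move: ((rho * enorm (nu q)) ^+ 2) (F x ^+ 2) (rho * F x) Frho rF => A b f Frho rF; lra.
Qed.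

End boundary_growth.

(** * Energy of the dilation difference in a boundary layer *)

Section boundary_layer.
Context {R : realType} (n : nat).
Notation V := 'rV[R]_n.
Implicit Types (u : V -> R) (x y z : V) (t eta : R).
Notation e := (fun i : 'I_n => delta_mx 0 i : V).

Lemma norm_delta_le1 (k : 'I_n) : `|e k| <= 1.
Proof.
by apply: norm_rV_le => // i; rewrite mxE eqxx /=; case: (i == k); rewrite ?normr1 ?normr0.
Qed.

Lemma Lam_le_Dform w (k : 'I_n) (sg t : R) : Cc w -> sg ^+ 2 = 1 -> 0 < t ->
  Lam w w (t *: (sg *: e k)) <= t ^+ 2 * Dform w w t.
Proof.
move=> Cw sg2 t0; have t20 : 0 < t ^+ 2 by rewrite exprn_gt0.
have -> : Lam w w (t *: (sg *: e k)) = Lam w w (t *: e k).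
  move/eqP: sg2; rewrite sqrf_eq1 => /orP[]/eqP ->; first by rewrite scale1r.
  by rewrite scaleN1r scalerN Lam_opp.
rewrite /Dform mulr_sumr (bigD1 k)//= mulrCA divff ?gt_eqF// mulr1 lerDl.
apply: sumr_ge0 => i _; apply: mulr_ge0; first exact: ltW.
by apply: divr_ge0; [exact: Lam_ge0|exact: ltW].
Qed.

(* The translates of the strip -tau/2 < F <= 0 by multiples of tau/2 along the axis k
   cover {F < 0} near p, and w jumps by at least A across the strip. *)
Lemma strip_energy w psi (F : V -> R) p (k : 'I_n) (sg tau A d : R) :
  Cc w -> sg ^+ 2 = 1 -> (forall x t, F (x + t *: (sg *: e k)) = F x + t) ->
  0 < tau <= d -> 0 <= A ->
  (forall x, `|x - p| <= 2 * d -> - (tau / 2) < F x <= 0 ->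
     A <= `|w (x + tau *: (sg *: e k)) - w x|) ->
  Cc psi -> (forall x, 0 <= psi x <= 1) ->
  (forall x, psi x != 0 -> `|x - p| <= d /\ - d <= F x <= 0) ->
  A ^+ 2 * Int psi * tau <= 4 * d * Lam w w (tau *: (sg *: e k)).
Proof.
move=> Cw sg2 F_axis /andP[tau0 taud] A0 jump Cpsi psi01 psiF.
set h := tau *: (sg *: e k).
pose f x := (w (x + h) - w x) * (w (x + h) - w x).
have fi : Intg f by exact: Intg_Lam.
have f0 x : 0 <= f x by rewrite /f -expr2 sqr_ge0.
pose s j : V := (j%:R * (tau / 2)) *: (sg *: e k).
(* Enough half-steps tau / 2 to climb from F = - d to F = 0, yet at most 4 d / tau of them. *)
have [J [Jd JT]] : exists J : nat, 2 * d < J%:R * tau /\ J%:R * tau <= 4 * d.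
  have d0 : 0 <= 2 * d / tau by rewrite divr_ge0 ?(ltW tau0)//; lra.
  have /andP[] := truncn_itv d0; set T := Num.truncn _ => T1 T2.
  exists T.+1; move: T2; rewrite ltr_pdivrMr// => T2; split => //.
  by move: T1; rewrite ler_pdivlMr// -natr1 mulrDl mul1r => T1; lra.
have main x : A ^+ 2 * psi x <= \sum_(j < J) f (x + s j).
  have /andP[p0 p1] := psi01 x.
  have S0 : 0 <= \sum_(j < J) f (x + s j) by apply: sumr_ge0.
  have [->|/psiF [xp /andP[Fd F0]]] := eqVneq (psi x) 0; first by rewrite mulr0.
  have tau2 : 0 < tau / 2 by rewrite divr_gt0.
  have q0 : 0 <= - F x / (tau / 2) by rewrite divr_ge0 ?(ltW tau2)// oppr_ge0.
  (* The j-th translate of x is the one lying in the strip - tau / 2 < F <= 0. *)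
  have /andP[] := truncn_itv q0; set j := Num.truncn _ => j1 j2.
  rewrite ler_pdivlMr// in j1; rewrite ltr_pdivrMr// -natr1 mulrDl mul1r in j2.
  have jJ : (j < J)%N.
    by rewrite -(ltr_nat R) -(ltr_pM2r tau0); move: j1; rewrite mulrA; lra.
  rewrite (bigD1 (Ordinal jJ))//=; apply: ler_wpDr; first exact: sumr_ge0.
  apply: (@le_trans _ _ (A ^+ 2)); first by rewrite ler_piMr ?sqr_ge0.
  rewrite /f -expr2 -[leRHS]real_normK ?num_real// lerXn2r ?nnegrE//.
  have snorm : `|sg| = 1.
    by apply/eqP; rewrite -(@eqrXn2 _ 2) ?ler01// real_normK ?num_real// sg2 expr1n.
  apply: jump.
    rewrite addrAC (le_trans (ler_normD _ _))// mulr_natl mulr2n lerD//.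
    have js0 : 0 <= j%:R * (tau / 2) by rewrite mulr_ge0// ltW.
    rewrite /s normrZ [`|sg *: _|]normrZ snorm mul1r (ger0_norm js0).
    apply: le_trans (ler_piMr js0 (norm_delta_le1 k)) _.
    by apply: le_trans j1 _; rewrite lerNl.
  by rewrite /s F_axis; apply/andP; split; lra.
have si j : Intg (fun x => f (x + s j)) by exact: Intg_shift.
have pi : Intg (fun x => A ^+ 2 * psi x) by apply: IntgZ; exact: Cc_Intg.
have := le_Int pi (Intg_sum (index_enum 'I_J) (fun j => si (nat_of_ord j))) main.
rewrite (IntZ _ (Cc_Intg Cpsi)) Int_sum; last by move=> j; exact: si.
rewrite (eq_bigr (fun=> Int f)) => [|j _]; last exact: Int_shift.
rewrite sumr_const card_ord -[_ *+ J]mulr_natl => H.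
have L0 : 0 <= Int f by exact: Int_ge0.
apply: (@le_trans _ _ (J%:R * Int f * tau)); first by exact: (ler_wpM2r (ltW tau0) H).
by rewrite mulrAC ler_wpM2r.
Qed.

(** With tau = kap eta, transversality makes the dilated function vanish where F <= tau, so there
    the difference w equals u. It is 0 for F <= 0 and at least a tau / 2 where F is between tau / 2
    and tau. [strip_energy] turns this jump into Lam >= c tau^3, that is, Dform >= c tau. *)
Lemma boundary_layer_energy u (F : V -> R) p z (k : 'I_n) (sg kap d a r : R) :
  Cc u -> sg ^+ 2 = 1 -> (forall x t, F (x + t *: (sg *: e k)) = F x + t) ->
  continuous F -> F p = 0 -> 0 < kap -> 0 < d -> 0 < a -> 0 < r ->
  (forall x, `|x - p| <= r -> F x <= 0 -> u x = 0) ->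
  (forall x eta, `|x - p| <= d -> 0 <= eta <= d ->
     F (x + eta *: (x - z)) <= F x - kap * eta) ->
  (forall x, `|x - p| <= d -> 0 <= F x <= d -> a * F x <= u x) ->
  exists X eta0, [/\ 0 < X, 0 < eta0 & forall eta, 0 < eta <= eta0 ->
    exists tau, 0 < tau /\ X * eta <=
      Dform (fun x => u x - u (z - (1 + eta) *: z + (1 + eta) *: x))
            (fun x => u x - u (z - (1 + eta) *: z + (1 + eta) *: x)) tau].
Proof.
move=> Cu sg2 F_axis cF Fp kap0 d0 a0 r0 uF transversal growth.
have [D [D0 D1 Dd Dr]] : exists D, [/\ 0 < D, D <= 1, 3 * D <= d & 3 * D <= r / 2].
  pose D := Num.min 1 (Num.min (d / 3) (r / 6)); exists D.
  have [? ? ?] : [/\ D <= 1, D <= d / 3 & D <= r / 6].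
    by split; rewrite /D !ge_min lexx ?orbT.
  by split; [rewrite !lt_min ltr01 !divr_gt0|done|lra|lra].
have [d1 [d10 d1D Fd1]] : exists d1, [/\ 0 < d1, d1 <= D &
    forall x, `|x - p| < d1 -> `|F x| <= D].
  have /cvgrPdist_le/(_ D D0)/nbhs_ballP[q /= q0 qP] := cF p.
  exists (Num.min q D); split; first by rewrite lt_min q0.
    by rewrite ge_min lexx orbT.
  move=> x; rewrite lt_min => /andP[xq _]; have := qP x.
  by rewrite -ball_normE /= distrC Fp sub0r normrN; apply.
(* A bump on the outer side of the graph near p; its integral measures how much of {F < 0} the
   translated strips cover. *)
pose psi x := Num.max 0 (d1 - `|x - p|) * Num.max 0 (- F x).
have cst (c : R) : continuous (fun _ : V => c) by move=> x; exact: cst_continuous.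
have cdist : continuous (fun x => d1 - `|x - p|).
  move=> x; apply: (@continuousB _ _ _ (fun=> d1) (fun x => `|x - p|) x (cst d1 x)).
  apply: (@continuous_comp _ _ _ (fun x => x - p) (fun v : V => `|v|)).
    rewrite (_ : (fun _ => _) = fun x => - p + 1 *: x); first exact: continuous_affine_rV.
    by apply/funext => v; rewrite scale1r addrC.
  exact: norm_continuous.
have Cpsi : Cc psi.
  split.
    move=> x; apply: (@continuousM _ _ (fun x => Num.max 0 (d1 - `|x - p|))
      (fun x => Num.max 0 (- F x)) x).
      exact: (continuous_max (cst 0 x) (cdist x)).
    exact: (continuous_max (cst 0 x) (continuousN (cF x))).
  exists (`|p| + d1) => x xp; rewrite /psi max_l ?mul0r// subr_le0.
  have := lerB_dist x p; lra.
have psi0 x : psi x != 0 -> `|x - p| < d1 /\ F x < 0.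
  move=> px; split; rewrite ltNge; apply: contraNN px => H.
    by rewrite /psi max_l ?mul0r ?subr_le0.
  by rewrite /psi [Num.max 0 (- F x)]max_l ?mulr0 ?oppr_le0.
have psi01 x : 0 <= psi x <= 1.
  have [->|px] := eqVneq (psi x) 0; first by rewrite lexx ler01.
  have [xp Fx] := psi0 x px; have := Fd1 x xp; rewrite (ler0_norm (ltW Fx)) => FD.
  rewrite /psi !max_r ?subr_ge0 ?oppr_ge0 ?(ltW xp) ?(ltW Fx)//.
  rewrite mulr_ge0 ?subr_ge0 ?oppr_ge0 ?(ltW xp) ?(ltW Fx)//=.
  rewrite mulr_ile1 ?subr_ge0 ?oppr_ge0 ?(ltW xp) ?(ltW Fx)//; last exact: le_trans FD D1.
  by have := normr_ge0 (x - p); lra.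
have snorm : `|sg| = 1.
  by apply/eqP; rewrite -(@eqrXn2 _ 2) ?ler01// real_normK ?num_real// sg2 expr1n.
have axis_norm c : 0 <= c -> `|c *: (sg *: e k)| <= c.
  by move=> c0; rewrite !normrZ snorm mul1r ger0_norm// ler_piMr// norm_delta_le1.
pose P := Int psi.
have P0 : 0 < P.
  have d120 : 0 < d1 / 2 by rewrite divr_gt0.
  apply: (@Int_gt0 _ _ psi (p + (- (d1 / 2)) *: (sg *: e k))).
  - exact: Cc_continuous.
  - exact: Cc_Intg.
  - by move=> x; have /andP[] := psi01 x.
  rewrite /psi F_axis Fp add0r opprK mulr_gt0// lt_max ?d120 ?orbT//.
  rewrite addrAC subrr add0r scaleNr normrN subr_gt0.
  rewrite (le_lt_trans (axis_norm _ (ltW d120))) ?orbT//.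
  by rewrite ltr_pdivrMr// ltr_pMr// ltr1n.
pose W := `|p - z|; have W0 : 0 <= W by exact: normr_ge0.
pose eta0 := Num.min 1 (Num.min d (Num.min (D / kap) (r / 2 / (W + r)))).
have Wr : 0 < W + r by rewrite ltr_wpDl.
have eta00 : 0 < eta0 by rewrite !lt_min ltr01 d0 !divr_gt0.
exists (a ^+ 2 * P * kap / (16 * D)), eta0; split => //.
  by rewrite !mulr_gt0 ?exprn_gt0 ?invr_gt0 ?mulr_gt0.
move=> eta /andP[e0 ee]; exists (kap * eta).
have [e1 ed eD eW] : [/\ eta <= 1, eta <= d, kap * eta <= D & eta * (W + r) <= r / 2].
  move: ee; rewrite /eta0 !le_min => /and4P[? ? H1 H2]; split=> //.
    by rewrite mulrC -ler_pdivlMr.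
  by rewrite -ler_pdivlMr.
set tau := kap * eta in eD *.
have tau0 : 0 < tau by rewrite mulr_gt0.
split => //.
pose w x := u x - u (z - (1 + eta) *: z + (1 + eta) *: x); rewrite -/w.
have wE x : w x = u x - u (x + eta *: (x - z)).
  by congr (_ - u _); apply/rowP => i; rewrite !mxE; ring.
have Cw : Cc w.
  by apply: CcB Cu (Cc_affine _ _ Cu); rewrite gt_eqF// addr_gt0.
have dil x : `|x - p| <= 3 * D -> F x <= tau -> u (x + eta *: (x - z)) = 0.
  move=> xp Fx; apply: uF.
    rewrite addrAC (le_trans (ler_normD _ _))// [r]splitr lerD ?(le_trans xp)//.
    rewrite normrZ gtr0_norm//; apply: le_trans eW; rewrite ler_wpM2l ?(ltW e0)//.
    rewrite -[x](subrK p) -addrA (le_trans (ler_normD _ _))// [leLHS]addrC lerD2l.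
    by apply: (le_trans xp); apply: (le_trans Dr); lra.
  apply: le_trans (transversal x eta (le_trans xp Dd) _) _; first by rewrite (ltW e0).
  by rewrite subr_le0.
have jump x : `|x - p| <= 2 * D -> - (tau / 2) < F x <= 0 ->
    a * (tau / 2) <= `|w (x + tau *: (sg *: e k)) - w x|.
  move=> xp /andP[F1 F2].
  have xp3 : `|x + tau *: (sg *: e k) - p| <= 3 * D.
    rewrite addrAC (le_trans (ler_normD _ _))//.
    by have := axis_norm tau (ltW tau0); lra.
  have xp3' : `|x - p| <= 3 * D by lra.
  rewrite !wE (dil x) ?(le_trans F2 (ltW tau0))// subr0.
  rewrite (uF x) ?subr0//; last by apply: (le_trans xp3'); apply: (le_trans Dr); lra.
  rewrite dil// ?subr0 ?F_axis; last by rewrite gerDr.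
  apply: le_trans (ler_norm _); apply: (@le_trans _ _ (a * (F x + tau))).
    by rewrite ler_wpM2l ?(ltW a0)//; lra.
  rewrite -F_axis; apply: growth; first exact: le_trans xp3 Dd.
  by rewrite F_axis; apply/andP; split; lra.
have A0 : 0 <= a * (tau / 2) by rewrite mulr_ge0 ?divr_ge0 ?(ltW a0) ?(ltW tau0).
have tauD : 0 < tau <= D by rewrite tau0.
have S := strip_energy Cw sg2 F_axis tauD A0 jump Cpsi psi01.
have {S}S := S _; have {S} : a ^+ 2 * (tau / 2) ^+ 2 * P * tau <=
    4 * D * (tau ^+ 2 * Dform w w tau).
  rewrite -exprMn; apply: le_trans (S _) _.
    move=> x /psi0 [xp Fx]; split; first by rewrite (le_trans (ltW xp)).
    have := Fd1 x xp; rewrite (ler0_norm (ltW Fx)) => FD; rewrite lerNl FD.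
    exact: ltW.
  by rewrite ler_wpM2l ?mulr_ge0 ?(ltW D0)// Lam_le_Dform.
have t20 : 0 < tau ^+ 2 by rewrite exprn_gt0.
have D160 : 0 < 16 * D by rewrite mulr_gt0.
move=> S; rewrite -(ler_pM2r t20) -(ler_pM2l D160).
have -> : 16 * D * (a ^+ 2 * P * kap / (16 * D) * eta * tau ^+ 2) =
    4 * (a ^+ 2 * (tau / 2) ^+ 2 * P * tau).
  by rewrite /tau; field; rewrite gt_eqF.
by move: S; move: (Dform w w tau) => E S; lra.
Qed.

End boundary_layer.

(** * The boundary point closest to the centre *)

Section closest_boundary_point.
Context {R : realType} (n : nat).
Notation V := 'rV[R]_n.
Implicit Types (u : V -> R) (x y z p : V) (Om : set V) (t : R).
Notation e := (fun i : 'I_n => delta_mx 0 i : V).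

Lemma norm_delta (k : 'I_n) : `|e k| = 1.
Proof.
apply/eqP; rewrite eq_le norm_delta_le1 /=.
by apply: le_trans (coord_le_norm _ k); rewrite mxE !eqxx normr1.
Qed.

Lemma closest_point Om z : (0 < n)%N -> open Om -> bounded_set Om -> Om z ->
  exists p, [/\ ~ Om p, 0 < enorm (p - z) & forall x, enorm (x - z) < enorm (p - z) -> Om x].
Proof.
move=> n0 oOm [M [_ bM]] Oz.
have [x1 Ox1] : exists x, ~ Om x.
  exists ((`|M| + 2) *: e (Ordinal n0)) => Ox.
  have MM : M < `|M| + 1 by rewrite (le_lt_trans (ler_norm M))// ltrDl.
  have := bM _ MM _ Ox; rewrite /= normrZ norm_delta mulr1 ger0_norm ?addr_ge0//.
  by rewrite lerD2l leNgt ltr1n.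
have cE : continuous (fun x => enorm (x - z)).
  move=> x; apply: (@continuous_comp _ _ _ (fun x => x - z) (@enorm R n)).
    rewrite (_ : (fun _ => _) = fun x => - z + 1 *: x); first exact: continuous_affine_rV.
    by apply/funext => y; rewrite scale1r addrC.
  exact: continuous_enorm.
pose K := ~` Om `&` [set x | enorm (x - z) <= enorm (x1 - z)].
have cK : compact K.
  apply: bounded_closed_compact.
    exists (`|z| + enorm (x1 - z)); split; first exact: num_real.
    move=> B MB x [_ Kx]; apply: le_trans (ltW MB).
    rewrite -[x in `|x|](subrK z) addrC (le_trans (ler_normD _ _))// lerD2l.
    exact: le_trans (norm_le_enorm _) Kx.
  apply: closedI; first exact: open_closedC.
  by apply: (closed_comp _ (@closed_le _ _)) => x _; exact: cE.
have K0 : K !=set0 by exists x1; split => //=.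
have [p /set_mem [Op Kp] pmin] := EVT_min_rV K0 cK (continuous_subspaceT cE).
exists p; split => //.
  apply: lt_le_trans (norm_le_enorm _); rewrite normr_gt0 subr_eq0.
  by apply/eqP => pz; apply: Op; rewrite pz.
move=> x xp; apply: contrapT => Ox.
have /pmin : x \in K by apply: mem_set; split => //=; exact: le_trans (ltW xp) Kp.
by rewrite leNgt xp.
Qed.

Lemma closest_point_boundary Om z p : open Om -> ~ Om p -> 0 < enorm (p - z) ->
  (forall x, enorm (x - z) < enorm (p - z) -> Om x) -> (closure Om `\` Om°) p.
Proof.
move=> oOm Op d0 ball; split; last by move=> /interior_subset.
move=> B /nbhs_ballP[q /= q0 qB].
pose W := `|z - p|; have W0 : 0 < W + 1 := ltr_wpDl (normr_ge0 (z - p)) ltr01.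
pose t := Num.min 1 (q / 2 / (W + 1)).
have t0 : 0 < t by rewrite lt_min ltr01 !divr_gt0.
have t1 : t <= 1 by rewrite ge_min lexx.
exists (p + t *: (z - p)); split.
  apply: ball; rewrite (_ : _ - z = (1 - t) *: (p - z)); last first.
    by apply/rowP => j; rewrite !mxE; ring.
  by rewrite enormZ ger0_norm ?subr_ge0// gtr_pMl// gtrBl.
apply: qB; rewrite -ball_normE /= opprD addrA subrr add0r normrN normrZ gtr0_norm//.
apply: (@le_lt_trans _ _ (t * (W + 1))); first by rewrite ler_wpM2l ?(ltW t0)// lerDl.
apply: (@le_lt_trans _ _ (q / 2)); last by rewrite ltr_pdivrMr// ltr_pMr// ltr1n.
by rewrite -ler_pdivlMr// ge_min lexx orbT.
Qed.

(* At the point of the complement of Om closest to z, the inner ball centred at z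
   forces the boundary graph to be transversal to the rays through z. *)
Lemma closest_point_graph Om z p (F : V -> R) (k : 'I_n) (sg r : R) :
  sg ^+ 2 = 1 -> (forall x t, F (x + t *: (sg *: e k)) = F x + t) -> continuous F ->
  ~ Om p -> 0 < enorm (p - z) -> (forall x, enorm (x - z) < enorm (p - z) -> Om x) ->
  0 < r -> (forall x, `|x - p| <= r -> Om x <-> 0 < F x) ->
  F p = 0 /\ exists eps t0, [/\ 0 < eps, 0 < t0 &
    forall t, 0 < t <= t0 -> F p + eps * t <= F (p + t *: (z - p))].
Proof.
move=> sg2 F_axis cF Op; set d := enorm (p - z) => d0 ball r0 OF.
have snorm : `|sg| = 1.
  by apply/eqP; rewrite -(@eqrXn2 _ 2) ?ler01// real_normK ?num_real// sg2 expr1n.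
pose W := `|z - p|; have W0 : 0 < W + d := ltr_wpDl (normr_ge0 (z - p)) d0.
pose t0 := Num.min 1 (r / (W + d)).
have t00 : 0 < t0 by rewrite lt_min ltr01 divr_gt0.
(* Going from p towards z by the fraction t and then down the axis by d t / 2 stays in the ball
   around z, so F is still positive at the lowered point. *)
have dir t : 0 < t <= t0 -> d / 2 * t < F (p + t *: (z - p)).
  move=> /andP[t_gt0 tt0].
  have t1 : t <= 1 by rewrite (le_trans tt0)// ge_min lexx.
  pose y := p + t *: (z - p) + (- (d / 2 * t)) *: (sg *: e k).
  have dt0 : 0 < d / 2 * t by rewrite mulr_gt0// divr_gt0.
  suff : 0 < F y by rewrite /y F_axis subr_gt0.
  apply/OF.
    rewrite /y -[p + _ + _]addrA [p + _]addrC addrK (le_trans (ler_normD _ _))//.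
    apply: (@le_trans _ _ (t * (W + d))).
      rewrite mulrDr lerD//; first by rewrite normrZ gtr0_norm.
      rewrite scaleNr normrN !normrZ snorm norm_delta !mul1r mulr1.
      rewrite !gtr0_norm ?invr_gt0// mulrC ler_wpM2l ?(ltW t_gt0)//.
      by rewrite ler_pdivrMr// ler_peMr ?(ltW d0)// ler1n.
    by rewrite -ler_pdivlMr// (le_trans tt0)// ge_min lexx orbT.
  apply: ball; rewrite -(ltr_pXn2r (ltn0Sn 1)) ?nnegrE ?enorm_ge0//.
  have -> : y - z = (1 - t) *: (p - z) + (- (d / 2 * t) * sg) *: e k.
    by apply/rowP => j; rewrite !mxE; ring.
  rewrite enorm_sqr_delta enormZ -/d exprMn real_normK ?num_real// exprMn sg2 mulr1.
  have xi : - (sg * (p - z) 0 k) <= d.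
    by apply: le_trans (ler_norm _) _; rewrite normrN normrM snorm mul1r coord_le_enorm.
  have H : 0 <= d * t * (1 - t) * (d + sg * (p - z) 0 k).
    rewrite !mulr_ge0 ?subr_ge0 ?(ltW d0) ?(ltW t_gt0)//.
    by rewrite -[sg * _]opprK subr_ge0.
  rewrite [((1 - t) *: (p - z)) 0 k]mxE; move: ((p - z) 0 k) H => xi' H.
  have H2 : 0 < d ^+ 2 * t * (1 - t / 4).
    by rewrite !mulr_gt0 ?exprn_gt0// subr_gt0; lra.
  by lra.
have pr : `|p - p| <= r by rewrite subrr normr0 ltW.
have Fp0 : F p <= 0 by rewrite leNgt; apply/negP => Fp; exact: Op ((OF p pr).2 Fp).
split; last first.
  exists (d / 2), t0; split => //; first by rewrite divr_gt0.
  by move=> t tt; rewrite -[leRHS]add0r lerD ?(ltW (dir t tt)).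
(* If F(p) were negative, so would be F near p, against [dir] for small t. *)
apply/eqP; rewrite eq_le Fp0 leNgt; apply/negP => Fp.
have Fn : \forall x \near p, F x < 0 := cvgr_lt _ (cF p) _ Fp.
have [q /= q0 qF] := (nbhs_ballP p _).1 (Fn _).
pose t := Num.min t0 (q / 2 / (W + d)).
have t_gt0 : 0 < t by rewrite lt_min t00 !divr_gt0.
have tt : 0 < t <= t0 by rewrite t_gt0 ge_min lexx.
have := dir t tt; apply/negP; rewrite -leNgt; apply: (@le_trans _ _ 0); last first.
  by rewrite mulr_ge0 ?divr_ge0 ?(ltW d0) ?(ltW t_gt0).
apply/ltW/qF; rewrite -ball_normE /= opprD addrA subrr add0r normrN normrZ gtr0_norm//.
apply: (@le_lt_trans _ _ (t * (W + d))).
  by rewrite ler_wpM2l ?(ltW t_gt0)// lerDl ltW.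
apply: (@le_lt_trans _ _ (q / 2)); last by rewrite ltr_pdivrMr// ltr_pMr// ltr1n.
by rewrite -ler_pdivlMr// ge_min lexx orbT.
Qed.

(** The closest point provides transversality, superharmonicity provides linear growth. The
    resulting lower bound is linear in eta, where [reduction] allows only a quadratic one. *)
Lemma superharmonic_dilation_energy Om u z : (0 < n)%N -> open Om -> C2_boundary Om ->
  bounded_set Om -> Om z -> C2 Om u -> Cc u -> (forall x, ~ Om x -> u x = 0) ->
  (forall x, Om x -> 0 < u x) -> (forall x, Om x -> 0 < - laplacian u x) ->
  exists X eta0, [/\ 0 < X, 0 < eta0 & forall eta, 0 < eta <= eta0 ->
    exists tau, 0 < tau /\ X * eta <=
      Dform (fun x => u x - u (z - (1 + eta) *: z + (1 + eta) *: x))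
            (fun x => u x - u (z - (1 + eta) *: z + (1 + eta) *: x)) tau].
Proof.
move=> n0 oOm bdry bOm Oz uC2 Cu u0 upos su.
have [p [Op d0 ball]] := closest_point n0 oOm bOm Oz.
have [r [r0 [k [b [g [gC2 OF]]]]]] := bdry p (closest_point_boundary oOm Op d0 ball).
pose F := graph_height k b g.
pose sg : R := (-1) ^+ b.
have sg2 : sg ^+ 2 = 1 by rewrite sqrr_sign.
have F_axis x t : F (x + t *: (sg *: e k)) = F x + t by exact: graph_height_axis.
have nN : 0 < n%:R + 1 :> R by rewrite ltr_wpDl.
pose r1 := r / 2 / (n%:R + 1).
have r10 : 0 < r1 by rewrite !divr_gt0.
have {}OF x : `|x - p| <= r1 -> Om x <-> 0 < F x.
  move=> xp; rewrite /F /graph_height subr_gt0; apply: OF.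
  apply: le_lt_trans (enorm_le_norm _) _; apply: (@le_lt_trans _ _ (r / 2)).
    move: xp; rewrite /r1 ler_pdivlMr//; apply: le_trans.
    by rewrite mulrC ler_wpM2l// lerDl.
  by rewrite ltr_pdivrMr// ltr_pMr// ltr1n.
have cF : continuous F.
  have cg : continuous g by move=> q; have [] := gC2 q I.
  move=> x; apply: (@continuousB _ _ _ (fun x => sg * x 0 k) (fun x => g (col' k x)) x).
    apply: (@continuousM _ _ (fun=> sg) (fun x : V => x 0 k) x); first exact: cst_continuous.
    exact: coord_continuous.
  apply: (@continuous_comp _ _ _ (fun x : V => col' k x) g); last exact: cg.
  apply/(@cvgrPdist_le _ _ _ (nbhs x) _ (fun y : V => col' k y)) => w w0.
  apply/nbhs_ballP; exists w => //= y; rewrite -ball_normE /= => xy.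
  by rewrite -col'B (le_trans (norm_col'_le _ _))// ltW.
have [Fp [eps [t0 [eps0 t00 Ft]]]] := closest_point_graph sg2 F_axis cF Op d0 ball r10 OF.
have tay := graph_height_taylor k b gC2 p.
have near := graph_gradient_near k b gC2 p.
have [kap [d1 [kap0 d10 trans]]] := transversal_dilation tay near eps0 t00 Ft.
have u_ge0 x : 0 <= u x.
  by have [/upos/ltW//|/u0 ->] := pselect (Om x).
have [a [d2 [a0 d20 grow]]] := linear_growth sg2 F_axis (graph_gradient_axis k b g)
  tay near oOm bOm uC2 (Cc_continuous Cu) u_ge0 upos su r10 (fun x xp => (OF x xp).2).
pose d := Num.min d1 d2.
have dd0 : 0 < d by rewrite lt_min d10.
have [dd1 dd2] : d <= d1 /\ d <= d2 by rewrite /d !ge_min !lexx orbT.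
apply: (boundary_layer_energy Cu sg2 F_axis cF Fp kap0 dd0 a0 r10).
- by move=> x xp Fx; apply: u0 => /(OF x xp).1; rewrite ltNge Fx.
- move=> x eta xp /andP[e0 ed]; apply: trans; first exact: le_trans xp dd1.
  by rewrite e0 (le_trans ed).
- move=> x xp /andP[Fx0 Fxd]; apply: grow; first exact: le_trans xp dd2.
  by rewrite Fx0 (le_trans Fxd).
Qed.

End closest_boundary_point.

(** * Conclusion *)

Lemma bounded_support_Cc (R : realType) (n : nat) (Om : set 'rV[R]_n) (u : 'rV[R]_n -> R) :
  bounded_set Om -> continuous u -> (forall x, ~ Om x -> u x = 0) -> Cc u.
Proof.
move=> [M [_ bM]] cu u0; split => //; exists (`|M| + 1) => x Mx; apply: u0 => Ox.
have MM : M < `|M| + 1 by rewrite (le_lt_trans (ler_norm M))// ltrDl.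
by have := bM _ MM _ Ox; rewrite /= leNgt Mx.
Qed.

Lemma mass_gt0 (R : realType) (n : nat) (u : 'rV[R]_n -> R) x : Cc u -> u x <> 0 ->
  0 < mass u.
Proof.
move=> Cu ux; apply: (@Int_gt0 _ _ _ x).
- by move=> y; apply: (@continuousM _ _ u u y); exact: (Cc_continuous Cu).
- exact: Cc_Intg (CcM Cu (Cc_continuous Cu)).
- by move=> y; exact: sqr_ge0.
- by rewrite lt_def sqr_ge0 sqrf_eq0 andbT; apply/eqP.
Qed.

Theorem corollary1p5 (R : realType) (n : nat) (s a lam : R)
    (Om : set 'rV[R]_n) (hn : (3 <= n)%N) (hs : 0 < s < 1) (ha : 0 <= a)
    (hOm : C2_domain Om) (bOm : bounded_set Om) (sOm : star_shaped Om) :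
  ((lam%:E < (a * (1 - s))%:E * lambda1 s Om)%E ->
    ~ exists u : 'rV[R]_n -> R,
      [/\ C2 Om u, continuous u, is_solution s a lam Om u &
          exists x, u x <> 0]) /\
  ((lam%:E <= (a * (1 - s))%:E * lambda1 s Om)%E ->
    ~ exists u : 'rV[R]_n -> R,
      [/\ C2 Om u, continuous u, is_solution s a lam Om u &
          forall x, Om x -> 0 < u x]).
Proof.
case: hOm => [[x1 Ox1] oOm _ bdry]; have [z Oz star] := sOm.
have n0 : (0 < n)%N by exact: leq_trans hn.
split.
  move=> lamlt [u [uC2 cu sol [x ux]]].
  have Cu := bounded_support_Cc bOm cu sol.2.
  by have [] := reduction hs hn ha oOm star uC2 Cu sol (mass_gt0 Cu ux) (ltW lamlt).
move=> lamle [u [uC2 cu sol upos]].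
have Cu := bounded_support_Cc bOm cu sol.2.
have ux1 : u x1 <> 0 by apply/eqP; rewrite gt_eqF// upos.
have [_ lam0 ac0 [C [C0 Dle]]] := reduction hs hn ha oOm star uC2 Cu sol (mass_gt0 Cu ux1) lamle.
(* With lam = 0 and a c_frac = 0 the equation reduces to - laplacian u = |u|^q u, q the critical
   exponent minus 2. *)
have su x : Om x -> 0 < - laplacian u x.
  move=> Ox; have := sol.1 x Ox; rewrite /frac_laplacian mulrA ac0 mul0r addr0 lam0 mul0r addr0.
  move=> ->; apply: mulr_gt0; last exact: upos.
  by apply: powR_gt0; rewrite normr_gt0 gt_eqF// upos.
have [X [eta0 [X0 eta00 XD]]] :=
  superharmonic_dilation_energy n0 oOm bdry bOm Oz uC2 Cu sol.2 upos su.
(* The boundary estimate holds for eta <= eta0 and the key inequality for eta <= 1; scaling by h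
   lets eta range over the whole interval required by [le0_of_quadratic]. *)
pose h := Num.min 1 eta0; have h0 : 0 < h by rewrite lt_min ltr01.
suff : X * h <= 0 by rewrite leNgt mulr_gt0.
have Ch : 0 <= C * h ^+ 2 by rewrite mulr_ge0// sqr_ge0.
apply: (le0_of_quadratic Ch) => eta /andP[e0 e1].
have he0 : 0 < h * eta by rewrite mulr_gt0.
have heh : h * eta <= h by rewrite ler_piMr// ltW.
have he : 0 < h * eta <= eta0 by rewrite he0 (le_trans heh)// ge_min lexx orbT.
have [tau [tau0 Xt]] := XD _ he.
have t12 : 1 < 1 + h * eta <= 2.
  rewrite ltrDl he0 (_ : 2 = 1 + 1)// lerD2l (le_trans heh)//.
  by rewrite ge_min lexx.
have := le_trans Xt (Dle _ tau t12 tau0).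
by rewrite addrAC subrr add0r exprMn !mulrA.
Qed.
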